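(* Let $\mathcal F$ be a radial foliation of $\mathbb A$ and let $f$ be an $\mathcal F$-increasing and non wandering homeomorphism of $\mathbb A$. Suppose that for a certain lift $\tilde f$ of $f$ to $\tilde{\mathbb A}$ it holds that: (i) for every $\tilde z\in\tilde C_0$, $\tilde z\neq\tilde f(\tilde z)$ and $\dot\theta_{\tilde z,\tilde f(\tilde z)}(\mathcal F)=-\dot1$; (ii) for every $\tilde z\in\tilde C_1$, $\tilde z\neq\tilde f(\tilde z)$ and $\dot\theta_{\tilde z,\tilde f(\tilde z)}(\mathcal F)=\dot1$. Then there exist at least two points of $\mathbb A$ that are lifted to fixed points of $\tilde f$ (i.e. $\pi(\{\tilde z\in\tilde{\mathbb A}:\tilde f(\tilde z)=\tilde z\})$ has at least two elements).
   Context: Notation. $\mathbb T=\mathbb R/\mathbb Z$, $\mathbb A=\mathbb T\times[0,1]$, $C_0=\mathbb T\times\{0\}$, $C_1=\mathbb T\times\{1\}$, $\mathrm{int}(\mathbb A)=\mathbb T\times(0,1)$; $\tilde{\mathbb A}=\mathbb R\times[0,1]$ is the universal covering space, with covering projection $\pi(\tilde x,y)=(\tilde x+\mathbb Z,y)$; $\tilde C_i=\pi^{-1}(C_i)$. $\mathrm{Homeo}_*(\mathbb A)$ is the group of homeomorphisms of $\mathbb A$ isotopic to the identity, with the $C^0$ topology. Radial foliations. A radial foliation is an oriented topological foliation of $\mathbb A$ such that every leaf $\phi$ is a segment going from a point $\alpha(\phi)\in C_0$ to a point $\omega(\phi)\in C_1$ with $\phi\setminus\{\alpha(\phi),\omega(\phi)\}\subset\mathrm{int}(\mathbb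 A)$. $\mathfrak F$ is the set of radial foliations. $\mathrm{Homeo}_*(\mathbb A)$ acts transitively on $\mathfrak F$ ($f(\mathcal F)$ is the foliation whose leaves are the images by $f$ of the leaves of $\mathcal F$), and $\mathfrak F$ carries the quotient topology coming from this action; it is then simply connected. $\tilde{\mathcal F}$ is the lift of $\mathcal F$ to $\tilde{\mathbb A}$. For a leaf $\tilde\phi$ of $\tilde{\mathcal F}$, $L(\tilde\phi)$ is the component of $\tilde{\mathbb A}\setminus\tilde\phi$ on the left of $\tilde\phi$; leaves are totally ordered by $\tilde\phi\preceq_{\mathcal F}\tilde\phi'\iff L(\tilde\phi)\subset L(\tilde\phi')$ (strict version $\prec_{\mathcal F}$). Write $\tilde z<_{\mathcal F}\tilde z'$ if $\tilde z\neq\tilde z'$ lie on the same leaf of $\tilde{\mathcal F}$ and $\tilde z$ precedes $\tilde z'$ for its orientation. $\tilde\phi_{\tilde z}$ is the leaf of $\tilde{\mathcal F}$ through $\tilde z$. Angles. $\mathbb Z$ has the topology generated by the sets $\{2k+1\}$ and $\{2k+1,2k,2k-1\}$, $k\in\mathbb Z$ (digital line topology), $\mathbb Z/4\mathbb Z$ the quotient topology, and $\Pi:\mathbb Z\to\mathbb Z/4\mathbb Z$, $k\mapsto\dot k$, is the projection (a covering map). Let $\tilde W=\{(\tilde z,\tilde z')\in\tilde{\mathbb A}^2: \tilde z\neq\tilde z'\}$. Define the continuous map $\dot\theta:\tilde W\times\mathfrak F\to\mathbb Z/4\mathbb Z$, also written $\dot\theta_{\tilde z,\tilde z'}(\mathcal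 F)=\dot\theta(\tilde z,\tilde z',\mathcal F)$, to be $-\dot1$ if $\tilde\phi_{\tilde z}\prec_{\mathcal F}\tilde\phi_{\tilde z'}$, $\dot0$ if $\tilde z<_{\mathcal F}\tilde z'$, $\dot1$ if $\tilde\phi_{\tilde z'}\prec_{\mathcal F}\tilde\phi_{\tilde z}$, $\dot2$ if $\tilde z'<_{\mathcal F}\tilde z$. For fixed $(\tilde z,\tilde z')\in\tilde W$, let $\theta:\mathfrak F\to\mathbb Z$ be any continuous map with $\Pi\circ\theta=\dot\theta_{\tilde z,\tilde z'}$, and set $\tau(\tilde z,\tilde z',\mathcal F,\mathcal F')=\theta(\mathcal F')-\theta(\mathcal F)$ (independent of the choice of $\theta$). Monotone maps. $f\in\mathrm{Homeo}_*(\mathbb A)$ is $\mathcal F$-increasing if for every $(\tilde z,\tilde z')\in\tilde W$ one has $\tau(\tilde z,\tilde z',\mathcal F,f^{-1}(\mathcal F))\ge0$, and $\tau(\tilde z,\tilde z',\mathcal F,f^{-1}(\mathcal F))=0$ implies $\dot\theta_{\tilde z,\tilde z'}(\mathcal F)=\dot\theta_{\tilde z,\tilde z'}(f^{-1}(\mathcal F))\in\{-\dot1,\dot1\}$. Non wandering. $f$ is non wandering if the only open set $O$ such that the sets $f^k(O)$, $k\in\mathbb Z$, are pairwise disjoint is the empty set. *)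

(* Defs.v *)
From HB Require Import structures.
From mathcomp Require Import all_boot all_order all_algebra.
From mathcomp Require Import all_classical all_reals all_analysis.
Set Implicit Arguments.
Unset Strict Implicit.
Unset Printing Implicit Defensive.
Import Order.TTheory GRing.Theory Num.Theory.
Import numFieldNormedType.Exports.
Local Open Scope classical_set_scope.
Local Open Scope ring_scope.
Local Open Scope quotient_scope.

Section Annulus.
Context (R : realType).

Definition int_congr (x y : R) : bool := (x - y) \is a Num.int.

Lemma int_congr_refl : reflexive int_congr.
Proof. by move=> x; rewrite /int_congr subrr. Qed.

Lemma int_congr_sym : symmetric int_congr.
Proof. by move=> x y; rewrite /int_congr -opprB rpredN. Qed.

Lemma int_congr_trans : transitive int_congr.
Proof.
by move=> y x z xy yz; rewrite /int_congr -(subrKA y x); exact: rpredD.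
Qed.

Definition int_equiv : equiv_rel R :=
  EquivRel int_congr int_congr_refl int_congr_sym int_congr_trans.

Definition circle : Type := quotient_topology {eq_quot int_equiv}.
HB.instance Definition _ := Topological.on circle.
HB.instance Definition _ := Quotient.on circle.

Definition unit_itv : Type := set_type `[0 : R, 1]%classic.
HB.instance Definition _ := Topological.on unit_itv.

Definition ucoord (t : unit_itv) : R := set_val t.

Lemma itv01_0 : (0 : R) \in `[0 : R, 1]%classic.
Proof. by apply/mem_set; rewrite /= in_itv /= lexx ler01. Qed.

Lemma itv01_1 : (1 : R) \in `[0 : R, 1]%classic.
Proof. by apply/mem_set; rewrite /= in_itv /= lexx ler01. Qed.

Definition unit0 : unit_itv := exist _ (0 : R) itv01_0.
Definition unit1 : unit_itv := exist _ (1 : R) itv01_1.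

Definition annulus : Type := (circle * unit_itv)%type.
HB.instance Definition _ := Topological.on annulus.

Definition strip : Type := (R * unit_itv)%type.
HB.instance Definition _ := Topological.on strip.

Definition cov (z : strip) : annulus := (\pi_circle z.1, z.2).

Definition C0 : set annulus := [set z | ucoord z.2 = 0].
Definition C1 : set annulus := [set z | ucoord z.2 = 1].
Definition int_annulus : set annulus := [set z | 0 < ucoord z.2 < 1].

Definition homeomorphism (X Y : topologicalType) (f : X -> Y) : Prop :=
  exists g : Y -> X,
    [/\ continuous f, continuous g, cancel f g & cancel g f].

Definition isotopic_to_id (f : annulus -> annulus) : Prop :=
  exists H : unit_itv * annulus -> annulus,
    [/\ continuous H,
        forall t, homeomorphism (fun z => H (t, z)),
        forall z, H (unit0, z) = z
      & forall z, H (unit1, z) = f z].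

(* The C^0 topology is the compact-open topology, the annulus being compact
   metrizable. *)
Definition Homeo_star : Type :=
  set_type [set f : {compact-open, annulus -> annulus} | isotopic_to_id f].
HB.instance Definition _ := Topological.on Homeo_star.

Definition homeo_fun (h : Homeo_star) : annulus -> annulus := set_val h.

(* A leaf system is the set of leaves of a possible foliation.  The leaves of a
   radial foliation are oriented from C0 to C1, so that the orientation is
   determined by the set of leaves. *)
Definition leaf_system : Type := set (set annulus).
HB.instance Definition _ := Choice.on leaf_system.

Definition push (h : annulus -> annulus) (F : leaf_system) : leaf_system :=
  [set h @` phi | phi in F].

(* Image under the inverse of a bijection f. *)
Definition push_inv (f : annulus -> annulus) (F : leaf_system) : leaf_system :=
  [set f @^-1` phi | phi in F].

Definition leaf_param (g : unit_itv -> annulus) (phi : set annulus) : Prop :=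
  [/\ [/\ continuous g, injective g & range g = phi],
      C0 (g unit0), C1 (g unit1)
    & forall t, 0 < ucoord t < 1 -> int_annulus (g t)].

Definition leaf (F : leaf_system) (z : annulus) : set annulus :=
  \bigcup_(phi in [set phi | F phi /\ phi z]) phi.

Definition precedes (F : leaf_system) (z z' : annulus) : Prop :=
  exists phi g s t,
    [/\ F phi, leaf_param g phi, g s = z, g t = z' & ucoord s < ucoord t].

Definition homeo_between (X Y : topologicalType) (U : set X) (V : set Y)
    (h : X -> Y) : Prop :=
  exists g : Y -> X,
    [/\ {within U, continuous h} /\ {within V, continuous g},
        forall x, U x -> V (h x), forall y, V y -> U (g y),
        forall x, U x -> g (h x) = x & forall y, V y -> h (g y) = y].

(* The model is an open box, or a half-open one at a boundary point (leaves are
   transverse to the boundary).  The plaques, i.e. the connected components of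
   the traces of the leaves on U, are the vertical segments, oriented upwards. *)
Definition foliated_chart (F : leaf_system) (U : set annulus)
    (h : annulus -> R * R) : Prop :=
  [/\ exists2 K : set R,
        [\/ K = `]0 : R, 1[%classic, K = `[0 : R, 1[%classic
          | K = `]0 : R, 1]%classic]
        & homeo_between U (`]-1 : R, 1[%classic `*` K) h,
      forall z, U z -> connected_component (leaf F z `&` U) z =
                       [set z' | U z' /\ (h z').1 = (h z).1]
    & forall z z', U z -> U z' -> (h z).1 = (h z').1 ->
        (h z).2 < (h z').2 -> precedes F z z'].

Definition radial_foliation : set leaf_system := [set F |
  [/\ forall z, exists! phi, F phi /\ phi z,
      forall phi, F phi -> exists g, leaf_param g phi
    & forall z, exists U h, [/\ open U, U z & foliated_chart F U h]]].

(* Final topology of the orbit maps h |-> h(F), F radial.  Radial foliations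
   form a single orbit, on which this induces the quotient topology. *)
Definition leaf_system_open (U : set leaf_system) : Prop :=
  forall F, radial_foliation F ->
    open [set h : Homeo_star | U (push (homeo_fun h) F)].

Lemma leaf_system_openT : leaf_system_open setT.
Proof. by move=> F _; exact: openT. Qed.

Lemma leaf_system_openI : setI_closed leaf_system_open.
Proof.
move=> U V oU oV F rF; exact: openI (oU F rF) (oV F rF).
Qed.

Lemma leaf_system_open_bigU (I : Type) (f : I -> set leaf_system) :
  (forall i, leaf_system_open (f i)) -> leaf_system_open (\bigcup_i f i).
Proof.
move=> of_ F rF; apply: (@bigcup_open Homeo_star I setT
  (fun i => [set h | f i (push (homeo_fun h) F)])) => i _.
exact: of_.
Qed.

HB.instance Definition _ := isOpenTopological.Build leaf_system
  leaf_system_openT leaf_system_openI leaf_system_open_bigU.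

(* Leaf through z of the lifted foliation. *)
Definition lifted_leaf (F : leaf_system) (z : strip) : set strip :=
  connected_component (cov @^-1` leaf F (cov z)) z.

(* A lifted leaf goes upwards from R x {0} to R x {1}, so its left side is the
   component of its complement that contains the far left of the strip. *)
Definition left_side (phi : set strip) : set strip :=
  [set z | exists M : R, forall z' : strip, z'.1 < M ->
     connected_component (~` phi) z z'].

Definition leaf_le (phi phi' : set strip) : Prop :=
  left_side phi `<=` left_side phi'.
Definition leaf_lt (phi phi' : set strip) : Prop :=
  leaf_le phi phi' /\ phi <> phi'.

Definition lifted_precedes (F : leaf_system) (z z' : strip) : Prop :=
  exists phi (g : unit_itv -> strip) s t,
    [/\ F phi, continuous g /\ leaf_param (cov \o g) phi,
        g s = z, g t = z' & ucoord s < ucoord t].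

(* For z <> z' and F radial exactly one of the four cases of the definition
   holds; the last one is lifted_precedes F z' z. *)
Definition dtheta (z z' : strip) (F : leaf_system) : 'Z_4 :=
  if `[< leaf_lt (lifted_leaf F z) (lifted_leaf F z') >] then -1
  else if `[< lifted_precedes F z z' >] then 0
  else if `[< leaf_lt (lifted_leaf F z') (lifted_leaf F z) >] then 1
  else 2.

End Annulus.

Definition digital_line : Type := int.
HB.instance Definition _ := Choice.on digital_line.

Definition digital_subbase : set (set digital_line) := [set A |
  exists k : int, A = [set 2 * k + 1] \/
                  A = [set 2 * k + 1] `|` [set 2 * k] `|` [set 2 * k - 1]].

HB.instance Definition _ :=
  isSubBaseTopological.Build digital_line digital_subbase id.

Section Monotone.
Context (R : realType).

Definition is_angle_lift (z z' : strip R)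
    (theta : leaf_system R -> digital_line) : Prop :=
  {within @radial_foliation R, continuous theta} /\
  forall F, radial_foliation F -> (theta F : int)%:~R = dtheta z z' F.

(* A lift exists since radial foliations form a simply connected space; tau does
   not depend on the lift chosen. *)
Definition angle_lift (z z' : strip R) : leaf_system R -> digital_line :=
  xget (fun=> (0 : int)) [set theta | is_angle_lift z z' theta].

Definition tau (z z' : strip R) (F F' : leaf_system R) : int :=
  (angle_lift z z' F' : int) - (angle_lift z z' F : int).

Definition increasing (F : leaf_system R) (f : annulus R -> annulus R) : Prop :=
  isotopic_to_id f /\
  forall z z' : strip R, z <> z' ->
    0 <= tau z z' F (push_inv f F) /\
    (tau z z' F (push_inv f F) = 0 ->
       dtheta z z' F = dtheta z z' (push_inv f F) /\
       (dtheta z z' F = -1 \/ dtheta z z' F = 1)).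

Definition iterz_image (f : annulus R -> annulus R) (k : int)
    (O : set (annulus R)) : set (annulus R) :=
  match k with
  | Posz n => iter n f @` O
  | Negz n => iter n.+1 f @^-1` O
  end.

Definition non_wandering (f : annulus R -> annulus R) : Prop :=
  forall O : set (annulus R), open O ->
    trivIset setT (fun k : int => iterz_image f k O) -> O = set0.

Definition is_lift (ft : strip R -> strip R) (f : annulus R -> annulus R) :
    Prop :=
  continuous ft /\ forall z, cov (ft z) = f (cov z).

End Monotone.

(* Main.v *)
Require Import Defs.
From HB Require Import structures.
From mathcomp Require Import all_boot all_order all_algebra finmap.
From mathcomp Require Import all_classical all_reals all_analysis.
From mathcomp Require Import ring lra zify.
Set Implicit Arguments.
Unset Strict Implicit.
Unset Printing Implicit Defensive.
Import Order.TTheory GRing.Theory Num.Theory.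
Import numFieldNormedType.Exports.
Local Open Scope classical_set_scope.
Local Open Scope ring_scope.

(* Suppose that the fixed points of the lift [ft] project to at most one point,
   and remove them from the strip.  Lifting along vertical segments, from the
   bottom and from the top, the angle of the pair (z, ft z) becomes a continuous
   integer [th z], equal to -1 on the bottom line, invariant under deck
   transformations and congruent to 1 modulo 4 on the top line.  Lifting an
   isotopy from the identity to f shows that th (ft z) = th z + tau, so that, f being
   increasing, 2k <= th z implies 2k + 1 <= th (ft z).  By the non wandering
   hypothesis the image of {th >= 2k} is then all of {th >= 2k + 1}, hence this set is
   open and closed.  Taking k = 0 or k = -1, exactly one of the bottom and the top
   of a vertical segment without fixed points belongs to it, a contradiction.

   Foliations are handled through a coordinate: the bottom end point of a leaf
   depends continuously on the leaf, and lifts to a real function that orders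
   the lifted leaves.  A digital angle is thus determined by two real numbers and,
   when these agree, by the order along the leaf, which is a closed relation. *)

(** Parity carries the topology: odd integers are open points of the digital line and even ones
    closed points. Away from the fixed points {th >= 2k + 1} is therefore open and {th >= 2k}
    closed, and so is the image of the latter by the homeomorphism [ft]. A point where the two sets
    fail to match has a whole neighbourhood of such points, which cannot return because th does not
    decrease along orbits.

    The obstacle is that the strip without the fixed points is not simply connected, so that th
    could have monodromy around a removed point. A lift from the bottom is constant on each interval
    of the top line between two columns of removed points. When there is a single orbit these
    intervals are deck translates of each other, so the constants agree and the monodromy vanishes;
    this is where a second orbit of fixed points would matter.

    Two topological facts are also reduced to lifted angles. Invariance of the interior of the
    annulus under isotopies follows from the angles along two arcs around a point. Simple
    connectivity of the space of foliations is replaced by a path from the given pair to a pair of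
    bottom points, whose angle is the same for all foliations. *)

Lemma connected_locally_constant (T : topologicalType) (A P : set T) (a b : T) :
  connected A -> A a -> A b ->
  (forall t, A t -> exists Q : Prop, \forall u \near t, A u -> (P u <-> Q)) ->
  P a <-> P b.
Proof.
move=> cA Aa Ab; wlog suff impl : P / 
  (forall t, A t -> exists Q : Prop, \forall u \near t, A u -> (P u <-> Q)) ->
  P a -> P b.
  move=> loc; split; first exact: impl.
  move=> Pb; apply: contrapT => nPa; suff: (~` P) b by [].
  apply: (impl (~` P)) => // t At; have [Q PQ] := loc t At; exists (~ Q).
  by apply: filterS PQ => u + Au => /(_ Au) /= ->.
move=> loc Pa.
suff: (A `&` P) b by case.
have -> // : A `&` P = A; apply: cA; first by exists a.
- exists ((~` A `|` P)°); first exact: open_interior.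
  rewrite eqEsubset; split => t [At].
    move=> Pt; split => //; have [Q PQ] := loc t At.
    have /(_ At) tQ := nbhs_singleton PQ.
    near=> u; have [Au|] := pselect (A u); last by left.
    by right; apply/(near PQ u) => //; apply/tQ.
  by move=> /interior_subset [].
- exists (~` ((~` A `|` ~` P)°)); first exact/open_closedC/open_interior.
  rewrite eqEsubset; split => t [At].
    by move=> Pt; split => // /interior_subset [].
  move=> nit; split => //; apply: contrapT => nPt; apply: nit.
  have [Q PQ] := loc t At; have /(_ At) tQ := nbhs_singleton PQ.
  near=> u; have [Au|] := pselect (A u); last by left.
  by right => Pu; apply/nPt/tQ/(near PQ u).
Unshelve. all: by end_near. Qed.

Lemma segment_locally_constant (R : realType) (a b : R) (P : R -> Prop) :
  a <= b ->
  (forall t, a <= t <= b ->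
     exists Q : Prop, \forall u \near t, a <= u <= b -> (P u <-> Q)) ->
  P a <-> P b.
Proof.
move=> ab loc.
apply: (connected_locally_constant (@segment_connected R a b)).
- by rewrite /= in_itv /= lexx.
- by rewrite /= in_itv /= lexx andbT.
move=> t; rewrite /= in_itv /= => /loc [Q PQ].
by exists Q; apply: filterS PQ => u; rewrite /= in_itv.
Qed.

(** Propagation is only required upwards, as it is available for partial lifts and along an oriented
    leaf. To obtain a locally constant property, [P] is replaced by its validity on the whole
    segment from [a]. *)
Lemma segment_up_induction (R : realType) (a b : R) (P : R -> Prop) :
  a <= b -> P a ->
  (forall s, a <= s <= b -> exists2 e, 0 < e & forall t u,
     s - e < t -> t <= u -> u < s + e -> a <= t -> u <= b -> P t -> P u) ->
  P b.
Proof.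
move=> ab Pa up.
pose E t := forall u, a <= u <= t -> P u.
suff: E b by apply; rewrite ab lexx.
rewrite -(@segment_locally_constant R a b E ab).
  by move=> u; rewrite -eq_le => /eqP <-.
move=> s sab; have [e e0 {}up] := up s sab.
(* The common truth value near [s]: if [P] holds up to some point of the window, it spreads from
   there to the rest of the window. *)
exists (exists2 t, s - e < t < s + e & a <= t <= b /\ E t).
have : \forall u \near s, s - e < u < s + e.
  near=> u; apply/andP; split; near: u.
    by apply: lt_nbhsr; rewrite ltrBlDr ltrDl.
  by apply: lt_nbhsl; rewrite ltrDl.
apply: filterS => u use uab; split=> [Eu|[t tse [tab Et]] v /andP[av vu]].
  by exists u.
have [vt|tv] := leP v t; first by apply: Et; rewrite av.
apply: (up t) => //; last by apply: Et; rewrite lexx andbT; case/andP: tab.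
- by case/andP: tse.
- exact: ltW.
- by apply: le_lt_trans vu _; case/andP: use.
- by case/andP: tab.
- by apply: le_trans vu _; case/andP: uab.
Unshelve. all: by end_near. Qed.

(** * Pointwise continuity of pairs, projections and composites *)

Lemma continuous_at_pair (T U V : topologicalType) (f : T -> U) (g : T -> V) p :
  {for p, continuous f} -> {for p, continuous g} ->
  {for p, continuous (fun q => (f q, g q))}.
Proof. by move=> fp gp; exact: cvg_pair. Qed.

Lemma continuous_at_fst (T U V : topologicalType) (f : T -> U * V) p :
  {for p, continuous f} -> {for p, continuous (fun q => (f q).1)}.
Proof. by move=> fp; apply: (continuous_comp fp); exact: cvg_fst. Qed.

Lemma continuous_at_snd (T U V : topologicalType) (f : T -> U * V) p :
  {for p, continuous f} -> {for p, continuous (fun q => (f q).2)}.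
Proof. by move=> fp; apply: (continuous_comp fp); exact: cvg_snd. Qed.

Lemma continuous_at_comp (T U V : topologicalType) (f : T -> U) (g : U -> V) p :
  {for p, continuous f} -> {for f p, continuous g} ->
  {for p, continuous (fun q => g (f q))}.
Proof. exact: continuous_comp. Qed.

Lemma continuous_at_pairr (T U : topologicalType) (x : T) (y : U) :
  {for y, continuous (fun z : U => (x, z) : T * U)}.
Proof. by apply: continuous_at_pair; [exact: cvg_cst|exact: cvg_id]. Qed.

Lemma continuous_at_pairl (T U : topologicalType) (x : T) (y : U) :
  {for x, continuous (fun z : T => (z, y) : T * U)}.
Proof. by apply: continuous_at_pair; [exact: cvg_id|exact: cvg_cst]. Qed.

Lemma continuous_at_near (T U : topologicalType) (f : T -> U) (p : T) (A : set U) :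
  {for p, continuous f} -> nbhs (f p) A -> \forall q \near p, A (f q).
Proof. by move=> fp /fp. Qed.

(** * Lifting through a free and discontinuous action of the integers *)

Section CoveringAction.
Context (Y : topologicalType) (act : int -> Y -> Y).
Hypothesis act0 : forall y, act 0 y = y.
Hypothesis actD : forall m n y, act (m + n) y = act m (act n y).
Hypothesis act_continuous : forall n, continuous (act n).
Hypothesis act_disc : forall y : Y, exists2 U, nbhs y U &
  forall n y', U y' -> U (act n y') -> n = 0.

Definition same_orbit (y y' : Y) := exists n, y' = act n y.

Lemma actK n y : act (- n) (act n y) = y.
Proof. by rewrite -actD addNr act0. Qed.

Lemma act_free n y : act n y = y -> n = 0.
Proof.
have [U Uy disc] := act_disc y; have Uyy := nbhs_singleton Uy.
by move=> ny; apply: (disc n y) => //; rewrite ny.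
Qed.

Lemma same_orbit_sym y y' : same_orbit y y' -> same_orbit y' y.
Proof. by move=> [n ->]; exists (- n); rewrite actK. Qed.

Lemma same_orbit_trans y y' y'' :
  same_orbit y y' -> same_orbit y' y'' -> same_orbit y y''.
Proof. by move=> [n ->] [m ->]; exists (m + n); rewrite actD. Qed.

Lemma same_orbit_act n y y' : same_orbit y y' -> same_orbit y (act n y').
Proof. by move=> [m ->]; exists (n + m); rewrite actD. Qed.

(** Near [p] the points [act n (f q)] and [g q] share an orbit and lie in a neighbourhood disjoint
    from its nontrivial translates, so they coincide. *)
Lemma near_same_orbit (T : topologicalType) (f g : T -> Y) (p : T) :
  {for p, continuous f} -> {for p, continuous g} ->
  (\forall q \near p, same_orbit (f q) (g q)) ->
  exists n, \forall q \near p, g q = act n (f q).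
Proof.
move=> fp gp fg; have [n gfn] := nbhs_singleton fg; exists n.
have [U Uy disc] := act_disc (g p).
have afp : {for p, continuous (act n \o f)}.
  by apply: continuous_comp => //; exact: act_continuous.
near=> q; have [m gm] : same_orbit (f q) (g q) by near: q.
have Ug : U (g q) by near: q; exact: gp.
have Uf : U (act n (f q)).
  by near: q; apply: (afp U); rewrite /= -gfn.
rewrite gm; congr (act _ _); apply/eqP; rewrite -subr_eq0; apply/eqP.
by apply: (disc (m - n) (act n (f q))) => //; rewrite actD actK -gm.
Unshelve. all: by end_near. Qed.

Lemma near_same_orbit_eq (T : topologicalType) (f g : T -> Y) (p : T) :
  {for p, continuous f} -> {for p, continuous g} ->
  (\forall q \near p, same_orbit (f q) (g q)) -> f p = g p ->
  \forall q \near p, f q = g q.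
Proof.
move=> fp gp fg fgp; have [n nfg] := near_same_orbit fp gp fg.
have := nbhs_singleton nfg; rewrite -fgp => /esym/act_free n0.
by apply: filterS nfg => q ->; rewrite n0 act0.
Qed.

(** Near each point [g] is [act n] of [f] for a constant [n], and by freeness equality holds exactly
    when [n = 0]. *)
Lemma connected_lift_unique (T : topologicalType) (A : set T) (f g : T -> Y) a b :
  connected A -> A a -> A b ->
  (forall t, A t -> [/\ {for t, continuous f}, {for t, continuous g} &
     \forall u \near t, same_orbit (f u) (g u)]) ->
  f a = g a -> f b = g b.
Proof.
move=> cA Aa Ab H fga.
apply/(connected_locally_constant (P := fun t => f t = g t) cA Ab Aa) => //.
move=> t At; have [ft gt fg] := H t At.
have [n nfg] := near_same_orbit ft gt fg; exists (n = 0).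
apply: filterS nfg => q -> _; split=> [/esym/act_free//|->].
by rewrite act0.
Qed.

Lemma segment_lift_unique (R : realType) (f g : R -> Y) a b :
  (forall t, Num.min a b <= t <= Num.max a b ->
    [/\ {for t, continuous f}, {for t, continuous g} &
     \forall u \near t, same_orbit (f u) (g u)]) ->
  f a = g a -> f b = g b.
Proof.
move=> H; apply: (@connected_lift_unique _ `[Num.min a b, Num.max a b]).
- exact: segment_connected.
- by rewrite /= in_itv /= ge_min le_max lexx.
- by rewrite /= in_itv /= ge_min le_max lexx !orbT.
by move=> t; rewrite /= in_itv /= => /H.
Qed.

Lemma near_eq_continuous_at (T : topologicalType) (f g : T -> Y) (p : T) :
  (\forall q \near p, f q = g q) -> {for p, continuous f} ->
  {for p, continuous g}.
Proof.
move=> fg fp A /=; rewrite -(nbhs_singleton fg) => /fp fA.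
by apply: filterS2 fg fA => q /= ->.
Qed.

Section Lifting.
(** The quotient by the action is not formed: [c] may be discontinuous and stands for its orbit, and
    [c_local] expresses the continuity of the orbit through local continuous representatives. *)
Context (R : realType) (X : topologicalType) (c : X -> R -> Y) (a0 : X -> Y).
Hypothesis c_le0 : forall x t, t <= 0 -> c x t = c x 0.
Hypothesis c_ge1 : forall x t, 1 <= t -> c x t = c x 1.
Hypothesis c_local : forall x t, exists rho : X * R -> Y,
  \forall p \near ((x, t) : X * R),
    {for p, continuous rho} /\ same_orbit (c p.1 p.2) (rho p).
Hypothesis a0_continuous : continuous a0.
Hypothesis a0_orbit : forall x, same_orbit (c x 0) (a0 x).

(** Continuity is asked strictly before [s] only, so that the lift can be prolonged through a chart
    by gluing on an overlap; the condition on all [u <= 0] fixes the initial value. *)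
Let partial_lift x s := exists l : R -> Y, (forall u, u <= 0 -> l u = a0 x) /\
  (forall u, u < s -> {for u, continuous l} /\ same_orbit (c x u) (l u)).

Lemma near_slice (x : X) (t : R) (P : X * R -> Prop) :
  (\forall p \near ((x, t) : X * R), P p) ->
  exists2 e, 0 < e & \forall x' \near x, forall u, t - e < u < t + e -> P (x', u).
Proof.
move=> [[A B] /= [Ax Bt] AB]; have [e /= e0 eB] := Bt.
exists e => //; apply: filterS Ax => x' Ax' u /andP[u1 u2].
apply: AB; split => //=; apply: eB => /=.
by rewrite /ball_ /= ltr_norml; apply/andP; split; lra.
Qed.

Lemma slice_continuous (x : X) (t : R) (f : X * R -> Y) :
  {for (x, t), continuous f} -> {for t, continuous (fun u => f (x, u))}.
Proof.
by move=> fc; apply: (continuous_at_comp _ fc); exact: continuous_at_pairr.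
Qed.

Let local_lift (x : X) (t : R) : exists rho : X * R -> Y, exists2 e, 0 < e &
  \forall x' \near x, forall u, t - e < u < t + e ->
    [/\ {for (x', u), continuous rho},
        {for u, continuous (fun v => rho (x', v))} &
        same_orbit (c x' u) (rho (x', u))].
Proof.
have [rho /near_slice [e e0 H]] := c_local x t; exists rho; exists e => //.
apply: filterS H => x' H u /H [rc cr]; split => //.
exact: (slice_continuous rc).
Qed.

Lemma near_itv_open (t s e : R) : s - e < t -> t < s + e ->
  \forall u \near t, s - e < u < s + e.
Proof.
move=> t1 t2; near=> u; apply/andP; split; near: u.
  exact: lt_nbhsr.
exact: lt_nbhsl.
Unshelve. all: by end_near. Qed.

(** A bound beyond 1 makes the lift continuous at 1 as well. *)
Let partial_lift2 x : partial_lift x 2.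
Proof.
apply: (@segment_up_induction R 0) => //.
  exists (fun=> a0 x); split => // u u0; split; first exact: cst_continuous.
  by rewrite c_le0 ?ltW.
move=> s _; have [rho [e e0 /nbhs_singleton H]] := local_lift x s.
exists e => // t t' st tt' t's t0 _ [l [la lc]].
(* The old lift and the local one overlap between [s - e] and [t]; some [act n] matches them at the
   midpoint. *)
pose u0 := (s - e + t) / 2.
have [su0 u0t] : s - e < u0 /\ u0 < t by rewrite /u0; split; lra.
have [|rc0 rc0' rl0] := H u0; first by apply/andP; split; lra.
have [n ln] : same_orbit (rho (x, u0)) (l u0).
  by apply: same_orbit_trans (same_orbit_sym rl0) _; case: (lc u0).
pose r u := act n (rho (x, u)).
have rP u : s - e < u < s + e -> {for u, continuous r} /\ same_orbit (c x u) (r u).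
  move=> /H [_ rcu cru]; split; last exact: same_orbit_act.
  by apply: continuous_comp => //; exact: act_continuous.
have lr v : s - e < v -> v < t -> l v = r v.
  move=> sv vt; apply: (@segment_lift_unique R _ _ u0) => // w /andP[w1 w2].
  have sw : s - e < w by apply: lt_le_trans w1; rewrite lt_min su0.
  have wt : w < t by apply: le_lt_trans w2 _; rewrite gt_max u0t.
  have [|rw _] := rP w; first by apply/andP; split; lra.
  have [lw _] := lc w wt; split => //; near=> z.
  apply: same_orbit_trans (same_orbit_sym (lc z _).2) (rP z _).2.
    by near: z; exact: lt_nbhsl.
  by near: z; apply: near_itv_open => //; lra.
pose l' u := if u < u0 then l u else r u.
have l'l u : u < t -> l' u = l u.
  by move=> ut; rewrite /l'; case: ltP => // u0u; rewrite lr //; lra.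
have l'r u : s - e < u -> l' u = r u.
  by move=> su; rewrite /l'; case: ltP => // u0u; rewrite lr //; lra.
exists l'; split => [u u0'|u ut'].
  have [ut|tu] := ltP u t; first by rewrite l'l // la.
  (* When the junction is 0, the old lift is not known to be continuous there. The local lift has
     the value [a0 x] just before 0, hence also at 0, by continuity and discreteness of orbits. *)
  have E : t = 0 /\ u = 0 by lra.
  case: E => t_0 u_0; subst t u; rewrite l'r //.
  have [U Ur disc] := act_disc (r 0).
  have [|rc cr] := rP 0; first by apply/andP; split; lra.
  have [k ak] : same_orbit (r 0) (a0 x) by apply: same_orbit_trans (same_orbit_sym cr) _.
  have [d /= d0 dU] := rc _ Ur.
  pose w := Num.max (u0 / 2) (- d / 2).
  have w0 : w < 0 by rewrite /w gt_max; apply/andP; split; lra.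
  have Uw : U (a0 x).
    rewrite -(la w) ?ltW // lr //; last by rewrite /w lt_max; apply/orP; left; lra.
    apply: dU; rewrite /= sub0r normrN ltr0_norm // ltrNl /w lt_max.
    by apply/orP; right; lra.
  rewrite ak (_ : k = 0) ?act0 //; apply: (disc k (r 0)); first exact: nbhs_singleton Ur.
  by rewrite -ak.
have [ut|tu] := ltP u t.
  have [lu cl] := lc u ut; split; last by rewrite l'l.
  apply: near_eq_continuous_at lu; near=> z; rewrite l'l //.
  by near: z; exact: lt_nbhsl.
have [|ru cr] := rP u; first by apply/andP; split; lra.
split; last by rewrite l'r //; lra.
apply: near_eq_continuous_at ru; near=> z; rewrite l'r //.
by near: z; apply: lt_nbhsr; lra.
Unshelve. all: by end_near. Qed.

Let path_lift x : exists l : R -> Y, [/\ continuous l,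
  forall u, u <= 0 -> l u = a0 x & forall u, same_orbit (c x u) (l u)].
Proof.
have [l [la lc]] := partial_lift2 x; exists (fun u => l (Num.min u 1)).
split=> [u|u u0|u].
- apply: (@continuous_at_comp R R Y (fun u : R => Num.min u 1) l).
    by apply: (@continuous_min R R id (fun=> 1)); [exact: cvg_id|exact: cvg_cst].
  by have [] := lc (Num.min u 1); rewrite // gt_min; apply/orP; right; lra.
- by rewrite la // ge_min u0.
have u2 : Num.min u 1 < 2 by rewrite gt_min; apply/orP; right; lra.
have [_] := lc _ u2.
by rewrite minEle; case: ifPn => //; rewrite -ltNge => /ltW /c_ge1 ->.
Qed.

(** Each path is lifted on its own; the content is joint continuity. It holds at negative times
    through [a0] and is carried along [t]: in a chart the lift and a translate of the local lift
    agree on a whole slice as soon as they agree at one time. *)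
Theorem lift_exists : exists L : X * R -> Y, [/\ continuous L,
  forall x t, t <= 0 -> L (x, t) = a0 x &
  forall x t, same_orbit (c x t) (L (x, t))].
Proof.
have [l lP] := choice path_lift; pose L p := l p.1 p.2.
have La x t : t <= 0 -> L (x, t) = a0 x by case: (lP x) => _ + _; exact.
have Lc x t : same_orbit (c x t) (L (x, t)) by case: (lP x) => _ _; exact.
exists L; split=> //.
suff main x t : {for (x, t), continuous L} by move=> [x t]; exact: main.
have base u : u < 0 -> {for (x, u), continuous L}.
  move=> u0; apply: (@near_eq_continuous_at _ (a0 \o fst)).
    near=> p; rewrite /= (surjective_pairing p) La //; apply: ltW.
    near: p; exists (setT, [set v | v < 0]) => /=.
      by split; [exact: filterT|exact: lt_nbhsl].
    by move=> [y v] /= [].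
  by apply: continuous_comp; [exact: cvg_fst|exact: a0_continuous].
have [t0|t0] := ltP t 0; first exact: base.
apply/(@segment_locally_constant R (-1) t (fun t => {for (x, t), continuous L})).
- by lra.
- move=> s _; have [rho0 [e e0 H]] := local_lift x s.
  have [|_ _ cr] := nbhs_singleton H s; first by apply/andP; split; lra.
  have [n Ln] := same_orbit_trans (same_orbit_sym cr) (Lc x s).
  pose rho p := act n (rho0 p).
  have {}H : \forall x' \near x, forall u, s - e < u < s + e ->
    [/\ {for (x', u), continuous rho},
        {for u, continuous (fun v => rho (x', v))} &
        same_orbit (c x' u) (rho (x', u))].
    apply: filterS H => x' H u /H [r1 r2 r3]; split.
    - by apply: continuous_comp => //; exact: act_continuous.
    - by apply: (@continuous_comp _ _ _ (fun v => rho0 (x', v)) (act n)) => //;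
        exact: act_continuous.
    - exact: same_orbit_act.
  have agree x' u v : (forall u, s - e < u < s + e ->
    [/\ {for (x', u), continuous rho},
        {for u, continuous (fun v => rho (x', v))} &
        same_orbit (c x' u) (rho (x', u))]) ->
    s - e < u < s + e -> s - e < v < s + e ->
    L (x', u) = rho (x', u) -> L (x', v) = rho (x', v).
    move=> Hx /andP[u1 u2] /andP[v1 v2].
    apply: (@segment_lift_unique R (fun u => L (x', u)) (fun u => rho (x', u))).
    move=> w /andP[w1 w2].
    have sw : s - e < w by apply: lt_le_trans w1; rewrite lt_min u1.
    have ws : w < s + e by apply: le_lt_trans w2 _; rewrite gt_max u2.
    split; [by case: (lP x') => + _ _; exact| by case: (Hx w); rewrite ?sw|].
    near=> z; apply: same_orbit_trans (same_orbit_sym (Lc x' z)) _.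
    by case: (Hx z) => //; near: z; exact: near_itv_open.
  have ses : s - e < s < s + e by apply/andP; split; lra.
  have Hx := nbhs_singleton H.
  (* Continuity at any time of the chart amounts to agreement with [rho] at time [s] on all nearby
     slices, a condition independent of that time. *)
  exists (\forall x' \near x, L (x', s) = rho (x', s)).
  have : \forall u \near s, s - e < u < s + e by apply: near_itv_open; lra.
  apply: filterS => u use _.
  have near_orbit : \forall p \near ((x, u) : X * R),
      (forall v, s - e < v < s + e -> [/\ {for (p.1, v), continuous rho},
        {for v, continuous (fun v => rho (p.1, v))} &
        same_orbit (c p.1 v) (rho (p.1, v))]) /\ s - e < p.2 < s + e.
    exists ([set x' | forall v, s - e < v < s + e -> [/\ {for (x', v), continuous rho},
        {for v, continuous (fun v => rho (x', v))} &
        same_orbit (c x' v) (rho (x', v))]], [set v | s - e < v < s + e]) => /=.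
      by split => //; apply: near_itv_open; case/andP: use.
    by move=> [y v].
  split=> [Lu|Ls].
    have [ru _ _] := Hx u use.
    have Lr : \forall q \near ((x, u) : X * R), L q = rho q.
      apply: near_same_orbit_eq Lu ru _ _.
        apply: filterS near_orbit => -[y v] /= [Hy yv].
        by apply: same_orbit_trans (same_orbit_sym (Lc y v)) _; case: (Hy v yv).
      exact: agree Hx ses use Ln.
    have [d d0 Hd] := near_slice Lr.
    near=> x'; apply: (agree x' u) => //.
      by near: x'.
    by apply: (near Hd x') => //; apply/andP; split; lra.
  apply: (@near_eq_continuous_at _ rho); last by case: (Hx u use).
  have : \forall p \near ((x, u) : X * R), L (p.1, s) = rho (p.1, s).
    by exists ([set x' | L (x', s) = rho (x', s)], setT); [split => //;
      exact: filterT|case=> ? ? []].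
  apply: filterS2 near_orbit => -[y v] /= [Hy yv] Lys; symmetry.
  exact: agree Hy ses yv Lys.
by apply: base; lra.
Unshelve. all: by end_near. Qed.

End Lifting.
End CoveringAction.

(** * Hausdorff spaces and implicit functions with compact range *)

Definition separating (T : topologicalType) :=
  forall x y : T, x <> y -> \forall p \near ((x, y) : T * T), p.1 <> p.2.

Lemma separating_hausdorff (T : topologicalType) :
  separating T <-> hausdorff_space T.
Proof.
split=> [sepT p q pq|hT x y /eqP xy].
  apply: contrapT => /sepT [[A B] /= [pA qB] AB].
  by have [z [Az Bz]] := pq A B pA qB; apply: (AB (z, z)).
move: hT; rewrite open_hausdorff => /(_ x y xy) [[A B] /= []].
rewrite !inE => Ax By [oA oB AB0]; exists (A, B) => /=.
  by split; exact: open_nbhs_nbhs.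
move=> [u v] /= [Au Bv] uv; suff : (set0 : set T) u by [].
rewrite -AB0; split => //=; rewrite uv //.
Qed.

Lemma separating_prod (T U : topologicalType) :
  separating T -> separating U -> separating (T * U)%type.
Proof.
move=> sT sU [x y] [x' y'] ne.
have [xx'|xx'] := pselect (x = x').
  have yy' : y <> y' by move=> yy'; apply: ne; rewrite xx' yy'.
  have [[A B] /= [yA yB] AB] := sU _ _ yy'.
  exists (snd @^-1` A, snd @^-1` B) => /=.
    by split; [exact: (@cvg_snd _ _ (nbhs x) (nbhs y))|exact: (@cvg_snd _ _ (nbhs x') (nbhs y'))].
  move=> [[a b] [a' b']] /= [Ab Bb'] [_ bb']; exact: (AB (b, b')).
have [[A B] /= [xA xB] AB] := sT _ _ xx'.
exists (fst @^-1` A, fst @^-1` B) => /=.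
  by split; [exact: (@cvg_fst _ _ (nbhs x) (nbhs y))|exact: (@cvg_fst _ _ (nbhs x') (nbhs y'))].
move=> [[a b] [a' b']] /= [Ab Bb'] [aa' _]; exact: (AB (a, a')).
Qed.

Lemma separating_injective (T U : topologicalType) (f : T -> U) :
  continuous f -> injective f -> separating U -> separating T.
Proof.
move=> cf injf sU x y xy; have : f x <> f y by move/injf.
move=> /sU [[A B] /= [fxA fyB] AB].
exists (f @^-1` A, f @^-1` B); first by split; exact: cf.
by move=> [u v] /= [Au Bv] uv; apply: (AB (f u, f v)) => //=; rewrite uv.
Qed.

Lemma separating_real (R : realType) : separating R.
Proof. exact/separating_hausdorff/Rhausdorff. Qed.

(** Compactness replaces differentiability: a value outside [U] does not solve the equation at [p0],
    so no nearby value solves it for nearby parameters, and finitely many such neighbourhoods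
    suffice. This gives the continuity of inverses and of changes of parameter. *)
Lemma implicit_continuous (P K Y : topologicalType) (E : P * K -> Y) (e : P -> Y)
    (s : P -> K) (p0 : P) :
  compact [set: K] -> separating Y ->
  (forall z, {for (p0, z), continuous E}) -> {for p0, continuous e} ->
  (forall z, E (p0, z) = e p0 -> z = s p0) ->
  (\forall p \near p0, E (p, s p) = e p) -> {for p0, continuous s}.
Proof.
move=> cK sY cE ce uniq Es U Us.
have H : \near p0, [set: K] `<=` (fun z => E (p0, z) = e p0 -> U z).
  move/compact_near_coveringP : cK; apply => z _.
  have [Ez|Ez] := pselect (E (p0, z) = e p0).
    rewrite (uniq z Ez); exists (U, setT); first by split => //; exact: filterT.
    by move=> [? ?] [].
  have [[A B] /= [EA eB] AB] := sY _ _ Ez.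
  have cEz : {for (z, p0), continuous (fun q : K * P => (E (q.2, q.1)))}.
    apply: (@continuous_at_comp _ _ _ (fun q : K * P => (q.2, q.1)) E); last exact: cE.
    by apply: continuous_at_pair; [exact: cvg_snd|exact: cvg_fst].
  have ceq : {for (z, p0), continuous (fun q : K * P => (e q.2))}.
    by apply: (@continuous_at_comp _ _ _ (fun q : K * P => q.2) e) => //; exact: cvg_snd.
  suff : \forall q \near ((z, p0) : K * P), E (q.2, q.1) = e q.2 -> U q.1 by [].
  apply: filterS2 (continuous_at_near cEz EA) (continuous_at_near ceq eB).
  by move=> [z' p] /= Ap Bp Ee; case: (AB (E (p, z'), e p)).
rewrite /= nbhs_simpl /=.
by apply: filterS2 H Es => p H; exact: H.
Qed.

(** * The unit interval and truncation to it *)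

Section Interval.
Context (R : realType).

(** Composition with [clamp] turns paths and homotopies over [0, 1] into maps on all reals, constant
    on either side. *)
Definition clamp (t : R) : R := Num.max 0 (Num.min t 1).

Lemma clamp01 t : 0 <= clamp t <= 1.
Proof.
rewrite /clamp le_max lexx /= ge_max ler01 ge_min lexx orbT //.
Qed.

Lemma clamp_id t : 0 <= t <= 1 -> clamp t = t.
Proof. by move=> /andP[t0 t1]; rewrite /clamp min_l // max_r. Qed.

Lemma clamp_le0 t : t <= 0 -> clamp t = 0.
Proof. by move=> t0; rewrite /clamp max_l // ge_min t0. Qed.

Lemma clamp_ge1 t : 1 <= t -> clamp t = 1.
Proof. by move=> t1; rewrite /clamp min_r // max_r. Qed.

Lemma clamp_continuous : continuous clamp.
Proof.
move=> t; apply: (@continuous_max R R (fun=> 0) (fun t => Num.min t 1)).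
  exact: cvg_cst.
by apply: (@continuous_min R R id (fun=> 1)); [exact: cvg_id|exact: cvg_cst].
Qed.

Lemma ucoord01 (s : unit_itv R) : 0 <= ucoord s <= 1.
Proof. by have := set_valP s; rewrite /= in_itv. Qed.

Lemma ucoord_inj : injective (@ucoord R).
Proof. exact: val_inj. Qed.

Lemma ucoord_continuous : continuous (@ucoord R).
Proof. exact: initial_continuous. Qed.

Lemma clamp_in t : clamp t \in `[0 : R, 1]%classic.
Proof. by apply/mem_set; rewrite /= in_itv /= clamp01. Qed.

Definition uclamp t : unit_itv R := exist _ (clamp t) (clamp_in t).

Lemma ucoord_uclamp t : ucoord (uclamp t) = clamp t.
Proof. by []. Qed.

Lemma ucoordK : cancel (@ucoord R) uclamp.
Proof. by move=> s; apply: ucoord_inj; rewrite ucoord_uclamp clamp_id ?ucoord01. Qed.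

Lemma uclamp_continuous : continuous uclamp.
Proof.
move=> t A [_ [[B oB <-]] Bt BA]; rewrite /= nbhs_simpl /=.
have : \forall u \near t, B (clamp u).
  by apply: clamp_continuous; exact: open_nbhs_nbhs.
by apply: filterS => u Bu; exact: BA.
Qed.

Lemma uclamp0 : uclamp 0 = unit0 R.
Proof. by apply: ucoord_inj; rewrite ucoord_uclamp clamp_le0. Qed.

Lemma uclamp1 : uclamp 1 = unit1 R.
Proof. by apply: ucoord_inj; rewrite ucoord_uclamp clamp_ge1. Qed.

Lemma ucoord0 : ucoord (unit0 R) = 0. Proof. by []. Qed.
Lemma ucoord1 : ucoord (unit1 R) = 1. Proof. by []. Qed.

Lemma unit_compact : compact [set: unit_itv R].
Proof.
have -> : [set: unit_itv R] = uclamp @` `[0, 1]%classic.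
  rewrite eqEsubset; split => // s _; exists (ucoord s); last exact: ucoordK.
  by rewrite /= in_itv /= ucoord01.
apply: continuous_compact; last exact: segment_compact.
exact/continuous_subspaceT/uclamp_continuous.
Qed.

Lemma unit_separating : separating (unit_itv R).
Proof.
exact: (separating_injective ucoord_continuous ucoord_inj (@separating_real R)).
Qed.

End Interval.

(** * The covering of the annulus by the strip *)

Section Covering.
Context (R : realType).
Local Notation S := (strip R).
Local Notation A := (annulus R).
Local Open Scope quotient_scope.

Definition picircle (x : R) : circle R := \pi_(circle R) x.

Lemma picircleP (x y : R) : picircle x = picircle y <-> exists n : int, y = x + n%:~R.
Proof.
rewrite /picircle; split=> [/eqmodP|[n ->]].
  rewrite /= /int_congr => /intrP [n xyn]; exists (- n).
  by rewrite mulrNz -xyn; ring.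
by apply/eqmodP; rewrite /= /int_congr; apply/intrP; exists (- n); rewrite mulrNz; ring.
Qed.

Lemma picircle_surj (b : circle R) : exists x, picircle x = b.
Proof. by exists (repr b); rewrite /picircle reprK. Qed.

Definition circle_rep (b : circle R) : R := repr b.

Lemma circle_repK b : picircle (circle_rep b) = b.
Proof. exact: reprK. Qed.

Lemma picircle_continuous : continuous picircle.
Proof. exact: pi_continuous. Qed.

(** The saturation of an open set is the union of its integer translates, hence open. *)
Lemma picircle_open (x : R) (U : set R) :
  nbhs x U -> nbhs (picircle x) (picircle @` U).
Proof.
rewrite nbhsE => -[V [oV Vx] VU].
apply: (@filterS _ _ _ (picircle @` V)); first exact: image_subset.
apply: open_nbhs_nbhs; split; last by exists x.
rewrite /open /= /quotient_open.
have -> : \pi_(circle R) @^-1` (picircle @` V) =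
    \bigcup_(n : int) ((fun y : R => y + n%:~R) @^-1` V).
  rewrite eqEsubset; split => [y /= [z Vz] /esym/picircleP [n zy]|y [n _ /= Vn]].
    by exists n => //=; rewrite -zy.
  by exists (y + n%:~R) => //; apply/esym/picircleP; exists n.
apply: bigcup_open => n _; apply: open_comp => // y _.
by apply: cvgD; [exact: cvg_id|exact: cvg_cst].
Qed.

Lemma circle_local_lift (T : topologicalType) (b : T -> circle R) (p : T) (r0 : R) :
  continuous b -> picircle r0 = b p ->
  exists2 rho : T -> R, rho p = r0 &
    \forall q \near p, {for q, continuous rho} /\ picircle (rho q) = b q.
Proof.
move=> cb r0p.
(* Two representatives at distance less than 1/3 from [r0] differ by less than 1, so at most one
   qualifies; 0 is a default where there is none. *)
have ex q : exists r, (exists2 r', `|r' - r0| < 1/3 & picircle r' = b q) ->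
    `|r - r0| < 1/3 /\ picircle r = b q.
  have [[r ? ?]|] := pselect (exists2 r', `|r' - r0| < 1/3 & picircle r' = b q).
    by exists r.
  by exists 0.
have [rho rhoP] := choice ex.
have near_ok q r : `|r - r0| < 1/3 -> picircle r = b q ->
    \forall q' \near q, `|rho q' - r0| < 1/3 /\ picircle (rho q') = b q'.
  move=> rr0 rq.
  have U : nbhs r [set r' : R | `|r' - r0| < 1/3].
    apply: (@open_nbhs_nbhs _ r); split => //.
    rewrite (_ : [set _ | _] = ball r0 (1/3)); first exact: ball_open.
    by rewrite eqEsubset; split=> z; rewrite /ball /= distrC.
  have := picircle_open U; rewrite rq => /(continuous_at_near (cb q)).
  by apply: filterS => q' [r' rr' r'q]; apply: rhoP; exists r'.
have inj3 r r' : `|r - r0| < 1/3 -> `|r' - r0| < 1/3 -> picircle r = picircle r' -> r = r'.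
  move=> h h' /picircleP [n r'r]; suff n0 : n = 0 by rewrite r'r n0 addr0.
  have : `|n%:~R : R| < 1.
    have -> : n%:~R = (r' - r0) - (r - r0) by rewrite r'r; ring.
    by apply: le_lt_trans (ler_normB _ _) _; lra.
  by rewrite -intr_norm -[1]/(1%:~R) ltr_int => h1; lia.
have [rp1 rp2] : `|rho p - r0| < 1/3 /\ picircle (rho p) = b p.
  by apply: rhoP; exists r0 => //; rewrite subrr normr0; lra.
exists rho; first by apply: inj3; rewrite ?subrr ?normr0 // ?rp2 //; lra.
apply: filterS (near_ok p _ rp1 rp2) => q [rq1 rq2]; split => // V [e /= e0 eV].
have U : nbhs (rho q) (ball (rho q) e `&` [set r' : R | `|r' - r0| < 1/3]).
  apply: filterI; first exact: nbhsx_ballx.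
  apply: (@open_nbhs_nbhs _ (rho q)); split => //.
  rewrite (_ : [set _ | _] = ball r0 (1/3)); first exact: ball_open.
  by rewrite eqEsubset; split=> z; rewrite /ball /= distrC.
have := picircle_open U; rewrite rq2 => /(continuous_at_near (cb q)) H.
rewrite /= nbhs_simpl /=.
apply: filterS2 H (near_ok q _ rq1 rq2) => q' [r' [/eV Vr' r'2] r'3] [h1 h2] /=.
by have -> : rho q' = r' by apply: inj3; rewrite // h2.
Qed.

Lemma circle_separating : separating (circle R).
Proof.
move=> b b'; have [x <-] := picircle_surj b; have [y <-] := picircle_surj b'.
move=> xy.
have /andP[f1 f2] := floor_itv (x - y).
set f := Num.floor (x - y) in f1 f2; pose d := x - y - f%:~R.
have d0 : 0 < d.
  rewrite lt_neqAle subr_ge0 f1 andbT; apply/eqP => d0; apply: xy.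
  apply/picircleP; exists (- f); rewrite mulrNz; move: d0; rewrite /d; lra.
have d1 : d < 1 by move: f2; rewrite intrD /d; lra.
(* [d] is the fractional part of [x - y], so [Num.min d (1 - d)] is the distance of [x - y] to the
   integers; each point gets half of it. *)
pose e := Num.min d (1 - d) / 2.
have [ed ed1] : e + e <= d /\ e + e <= 1 - d.
  have -> : e + e = Num.min d (1 - d) by rewrite /e; field.
  by rewrite !ge_min !lexx orbT.
have e0 : 0 < e by rewrite divr_gt0 // lt_min d0 /=; lra.
exists (picircle @` ball x e, picircle @` ball y e) => /=.
  by split; apply: picircle_open; exact: nbhsx_ballx.
move=> [_ _] [/= [x' xx' <-] [y' yy' <-]] /picircleP [n y'n].
have {xx' yy' y'n} : `|(- n - f)%:~R - d| < e + e.
  rewrite intrD !mulrNz (_ : _ - d = (y - y') - (x - x')).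
    by apply: le_lt_trans (ler_normB _ _) _; rewrite addrC ltrD.
  by rewrite /d y'n; ring.
set m := - n - f; rewrite ltr_norml => /andP[m1 m2].
have [m0|m0] := leP m 0.
  have : m%:~R <= (0 : R) by rewrite -[0]/(0%:~R) ler_int.
  by lra.
have : 1 <= m%:~R :> R by rewrite -[1]/(1%:~R) ler_int; lia.
by lra.
Qed.

Lemma annulus_separating : separating A.
Proof. exact: separating_prod circle_separating (@unit_separating R). Qed.

Lemma annulus_hausdorff : hausdorff_space A.
Proof. exact/separating_hausdorff/annulus_separating. Qed.

Lemma annulus_compact : compact [set: A].
Proof.
have -> : [set: A] = [set: circle R] `*` [set: unit_itv R] by rewrite setXTT.
apply: compact_setX; last exact: unit_compact.
have -> : [set: circle R] = picircle @` `[0, 1]%classic.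
  rewrite eqEsubset; split => // b _; have [x <-] := picircle_surj b.
  have /andP[f1 f2] := floor_itv x; rewrite intrD in f2.
  exists (x - (Num.floor x)%:~R); first by rewrite /= in_itv /=; apply/andP; split; lra.
  by apply/picircleP; exists (Num.floor x); ring.
apply: continuous_compact; last exact: segment_compact.
exact/continuous_subspaceT/picircle_continuous.
Qed.

Lemma annulus_locally_compact : locally_compact [set: A].
Proof.
move=> z _; exists setT; first exact: filterT.
by split; [exact: annulus_compact|exact: closedT].
Qed.

Definition deck (n : int) (z : S) : S := (z.1 + n%:~R, z.2).

Lemma deck0 z : deck 0 z = z.
Proof. by rewrite /deck addr0 -surjective_pairing. Qed.

Lemma deckD m n z : deck (m + n) z = deck m (deck n z).
Proof. by rewrite /deck /= intrD -addrA [n%:~R + _]addrC. Qed.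

Lemma deckK n z : deck (- n) (deck n z) = z.
Proof. by rewrite -deckD addNr deck0. Qed.

Lemma deckNK n z : deck n (deck (- n) z) = z.
Proof. by rewrite -deckD subrr deck0. Qed.

Lemma deck_continuous n : continuous (deck n).
Proof.
move=> z.
apply: (@continuous_at_pair S R (unit_itv R) (fun z : S => z.1 + n%:~R) snd).
  by apply: (@cvgD _ R^o); [exact: cvg_fst|exact: cvg_cst].
exact: cvg_snd.
Qed.

Lemma covE (z : S) : cov z = (picircle z.1, z.2).
Proof. by []. Qed.

Lemma cov_eqP (z z' : S) : cov z = cov z' <-> exists n, z' = deck n z.
Proof.
split=> [|[n ->]]; rewrite !covE.
  by case=> /picircleP [n zz'] e; exists n; rewrite /deck -zz' e -surjective_pairing.
by congr (_, _); apply/picircleP; exists n.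
Qed.

Lemma cov_deck n z : cov (deck n z) = cov z.
Proof. by apply/esym/cov_eqP; exists n. Qed.

Lemma cov_surj (w : A) : exists z, cov z = w.
Proof.
have [x xw] := picircle_surj w.1; exists (x, w.2).
by rewrite covE /= xw -surjective_pairing.
Qed.

Lemma cov_continuous : continuous (@cov R).
Proof.
move=> z; apply: (@continuous_at_pair S (circle R) (unit_itv R)
  (fun z : S => picircle z.1) snd); last exact: cvg_snd.
apply: (@continuous_at_comp S R (circle R) fst); first exact: cvg_fst.
exact: picircle_continuous.
Qed.

Lemma cov_open (z : S) (U : set S) : nbhs z U -> nbhs (cov z) (@cov R @` U).
Proof.
move=> [[V W] /= [zV zW] VW].
exists (picircle @` V, W) => /=; first by split => //; exact: picircle_open.
move=> [b s] [/= [x Vx xb] Ws]; exists (x, s); first exact: VW.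
by rewrite covE /= xb.
Qed.

Lemma cov_open_image (U : set S) : open U -> open (@cov R @` U).
Proof.
move=> oU; rewrite openE => _ [z Uz <-]; apply: cov_open.
exact: open_nbhs_nbhs.
Qed.

End Covering.

(** * The digital line *)

(* [dig k] is the smallest neighbourhood of [k] in the digital line. *)
Definition dig (k : int) : set int :=
  [set j | j = k \/ ((exists m, k = 2 * m) /\ `|j - k| <= 1)].

Lemma dig_dist (k j : int) : dig k j -> `|j - k| <= 1.
Proof. by case=> [->|[_ //]]; rewrite subrr normr0. Qed.

Lemma dig_refl (k : int) : dig k k.
Proof. by left. Qed.

Lemma dig_add4 (n k j : int) : dig k j -> dig (4 * n + k) (4 * n + j).
Proof.
case=> [->|[[m ->] jk]]; first by left.
by right; split; [exists (2 * n + m); lia|lia].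
Qed.

Lemma dig_odd (k j : int) : (exists m, k = 2 * m + 1) -> dig k j -> j = k.
Proof. by move=> [m ->] [//|[[m' H] _]]; lia. Qed.

Lemma parity (k : int) : (exists m, k = 2 * m) \/ (exists m, k = 2 * m + 1).
Proof.
have [/eqP k0|/eqP k1] := boolP ((k %% 2)%Z == 0).
  by left; exists (k %/ 2)%Z; rewrite {1}(divz_eq k 2) k0; lia.
right; exists (k %/ 2)%Z; rewrite {1}(divz_eq k 2).
have : (k %% 2)%Z < 2 by apply: ltz_pmod.
have : 0 <= (k %% 2)%Z by apply: modz_ge0.
by lia.
Qed.

(** [dig k] is itself a subbasic set, and every subbasic set that contains [k] contains it. *)
Lemma nbhs_digital (k : digital_line) (A : set digital_line) :
  nbhs k A <-> (dig k : set int) `<=` A.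
Proof.
split=> [|kA].
  rewrite nbhsE => -[B [[D' D'sub <-]] [C D'C Ck] BA].
  apply: subset_trans BA => j kj; exists C => //.
  have [E Esub CE] := D'sub _ D'C; rewrite -CE in Ck *.
  move=> i iE; have /set_mem iS := Esub i iE; have ik := Ck i iE.
  move: iS ik => [m [->|->]] /=; first by move=> km; rewrite -km; apply: dig_odd kj; exists m.
  move=> H; have Hd := dig_dist kj.
  have [[l kl]|[l kl]] := parity k.
    have {}H : k = 2 * m by case: H => [[]|]; lia.
    have : j = 2 * m + 1 \/ j = 2 * m \/ j = 2 * m - 1 by lia.
    by move=> [->|[->|->]]; [left; left|left; right|right].
  by rewrite (dig_odd (ex_intro _ l kl) kj).
rewrite nbhsE /=.
have sub (U : set digital_line) : digital_subbase U -> open U.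
  move=> dU; exists [set U] => [_ ->|]; last by rewrite bigcup_set1.
  exists [fset U]%fset; first by move=> V /fset1P ->; exact/mem_set.
  by rewrite set_fset1 bigcap_set1.
have [[m km]|[m km]] := parity k.
  exists ([set 2 * m + 1] `|` [set 2 * m] `|` [set 2 * m - 1]); first split.
  - by apply: sub; exists m; right.
  - by left; right.
  apply: subset_trans kA => j H; right; split; first by exists m.
  by case: H => [[]|] /= ->; lia.
exists [set 2 * m + 1]; first by split => //; apply: sub; exists m; left.
by apply: subset_trans kA => j /= ->; left.
Qed.

Definition eqmod4 (a b : int) : Prop := exists n : int, b = 4 * n + a.

Lemma eqmod4_refl a : eqmod4 a a. Proof. by exists 0; rewrite mulr0 add0r. Qed.

Lemma eqmod4_sym a b : eqmod4 a b -> eqmod4 b a.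
Proof. by move=> [n ->]; exists (- n); lia. Qed.

Lemma eqmod4_trans a b c : eqmod4 a b -> eqmod4 b c -> eqmod4 a c.
Proof. by move=> [n ->] [m ->]; exists (n + m); lia. Qed.

Lemma eqmod4_Z4 (a b : int) : (a%:~R = b%:~R :> 'Z_4) <-> eqmod4 a b.
Proof.
split=> [ab|[n ->]]; last first.
  rewrite intrD intrM.
  have -> : (4 : int)%:~R = 0 :> 'Z_4 by apply/val_inj.
  by rewrite mul0r add0r.
have : (b - a)%:~R = 0 :> 'Z_4 by rewrite intrB ab subrr.
suff Z4 (k : int) : k%:~R = 0 :> 'Z_4 -> exists n, k = 4 * n.
  by move=> /Z4 [n ban]; exists n; lia.
wlog [n ->] : k / exists n : nat, k = n.
  move=> W; case: k => n; first by apply: W; exists n.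
  rewrite NegzE mulrNz => /eqP; rewrite oppr_eq0 => /eqP n0.
  by have [|m nm] := W n.+1 _ n0; [exists n.+1|exists (- m); lia].
move=> /(congr1 val); rewrite /= -pmulrn Zp_nat /= => n4.
by exists (n %/ 4)%N; rewrite {1}(divn_eq n 4) n4; lia.
Qed.

Definition dact (n : int) (k : digital_line) : digital_line := 4 * n + (k : int).

Lemma dact0 k : dact 0 k = k.
Proof. by rewrite /dact mulr0 add0r. Qed.

Lemma dactD m n k : dact (m + n) k = dact m (dact n k).
Proof. by rewrite /dact; ring. Qed.

Lemma continuous_digital (T : topologicalType) (f : T -> digital_line) (p : T) :
  {for p, continuous f} <-> \forall q \near p, dig (f p) (f q).
Proof.
split=> [fp|H B /nbhs_digital fB].
  by apply: (continuous_at_near fp); apply/nbhs_digital.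
by rewrite /= nbhs_simpl /=; apply: filterS H => q /fB.
Qed.

Lemma dact_continuous n : continuous (dact n).
Proof.
move=> k; apply/continuous_digital.
have kk : @nbhs _ digital_line k (dig k) by apply/nbhs_digital.
by apply: (@filterS digital_line _ _ _ _ _ kk) => j; exact: dig_add4.
Qed.

Lemma dact_disc (k : digital_line) : exists2 U, nbhs k U &
  forall n k', U k' -> U (dact n k') -> n = 0.
Proof.
exists (dig k); first exact/nbhs_digital.
by move=> n k' /dig_dist h1 /dig_dist; rewrite /dact => h2; lia.
Qed.

(** Continuity at [p] of the class of [c] in the quotient topology of Z/4Z, written on integer
    representatives that need not be continuous themselves. *)
Definition digital_at (T : topologicalType) (c : T -> int) (p : T) : Prop :=
  \forall q \near p, exists2 k, dig (c p) k & eqmod4 k (c q).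

(** * Lifting classes modulo 4 to the digital line *)

Section DigitalLift.

Lemma digital_local_lift (T : topologicalType) (c : T -> int) (p : T) :
  (\forall q \near p, digital_at c q) -> exists rho : T -> digital_line,
    \forall q \near p, {for q, continuous rho} /\ eqmod4 (c q) (rho q).
Proof.
move=> cp.
have ex q : exists k : int, digital_at c p -> 
    (exists2 k, dig (c p) k & eqmod4 k (c q)) -> dig (c p) k /\ eqmod4 k (c q).
  have [[k ? ?]|] := pselect (exists2 k, dig (c p) k & eqmod4 k (c q)).
    by exists k.
  by exists 0.
have [rho rhoP] := choice ex; have cpp := nbhs_singleton cp.
have {}rhoP : \forall q \near p, dig (c p) (rho q) /\ eqmod4 (rho q) (c q).
  by apply: filterS (cpp) => q /(rhoP q cpp).
exists rho; apply: filterS3 cp (near_join rhoP) rhoP => q cq rq [r1 r2].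
split; last exact: eqmod4_sym.
apply/continuous_digital; apply: filterS2 cq rq => q' [k ck kq'] [r1' r2'].
have [n rqn] := eqmod4_sym r2.
(* [rho q] and [rho q'] differ by at most 2, and [c q] and [k] by at most 1, so the same multiple of
   4 relates both pairs. *)
suff -> : rho q' = 4 * n + k by rewrite rqn; exact: dig_add4.
have [l rl] := eqmod4_trans kq' (eqmod4_sym r2').
have := dig_dist r1; have := dig_dist r1'; have := dig_dist ck.
by rewrite rqn rl; lia.
Qed.

Theorem digital_lift_exists (R : realType) (X : topologicalType)
    (c : X * R -> int) (a0 : X -> digital_line) :
  (forall x t, t <= 0 -> c (x, t) = c (x, 0)) ->
  (forall x t, 1 <= t -> c (x, t) = c (x, 1)) ->
  (forall p, digital_at c p) ->
  continuous a0 -> (forall x, eqmod4 (c (x, 0)) (a0 x)) ->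
  exists L : X * R -> digital_line, [/\ continuous L,
    forall x t, t <= 0 -> L (x, t) = a0 x & forall p, eqmod4 (c p) (L p)].
Proof.
move=> c0 c1 cc ca0 ac.
have loc x t : exists rho : X * R -> digital_line,
    \forall p \near ((x, t) : X * R),
      {for p, continuous rho} /\ same_orbit dact (c (p.1, p.2)) (rho p).
  have [|rho H] := @digital_local_lift _ c (x, t); first by near=> p.
  by exists rho; apply: filterS H => -[x' t'].
have [L [cL La Lc]] := @lift_exists _ _ dact0 dactD dact_continuous dact_disc R X
  (fun x t => c (x, t)) a0 c0 c1 loc ca0 ac.
by exists L; split=> // -[x t]; exact: Lc.
Unshelve. all: by end_near. Qed.

Lemma digital_segment_unique (R : realType) (f g : R -> digital_line) a b :
  (forall t, Num.min a b <= t <= Num.max a b ->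
    [/\ {for t, continuous f}, {for t, continuous g} &
     \forall u \near t, eqmod4 (f u) (g u)]) ->
  f a = g a -> f b = g b.
Proof. exact: (@segment_lift_unique _ _ dact0 dactD dact_continuous dact_disc R f g a b). Qed.

(** Two lifts of the same classes differ by a constant multiple of 4, so their variations agree even
    when their initial values do not. *)
Lemma digital_segment_diff (R : realType) (f g : R -> digital_line) (a b : R) :
  a <= b -> (forall t, a <= t <= b ->
    [/\ {for t, continuous f}, {for t, continuous g} &
     \forall u \near t, eqmod4 (f u) (g u)]) ->
  (f b : int) - f a = (g b : int) - g a.
Proof.
move=> ab H.
have [|_ _ /nbhs_singleton [n gfn]] := H a; first by rewrite lexx.
have : dact n (f b) = g b.
  apply: (@digital_segment_unique R (fun t => dact n (f t)) g a b); last first.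
    by rewrite /dact -gfn.
  move=> t; rewrite min_l // max_r // => /H [ft gt fg]; split => //.
    by apply: (continuous_at_comp ft); exact: dact_continuous.
  apply: filterS fg => u; apply: eqmod4_trans; exists (- n).
  by rewrite /dact; lia.
by rewrite /dact => <-; rewrite gfn; lia.
Qed.

End DigitalLift.

(** * Lifting circle-valued maps to the reals *)

Section RealLift.
Context (R : realType).

Definition ract (n : int) (x : R) : R := x + n%:~R.

Lemma ract0 x : ract 0 x = x. Proof. exact: addr0. Qed.

Lemma ractD m n x : ract (m + n) x = ract m (ract n x).
Proof. by rewrite /ract intrD; ring. Qed.

Lemma ract_continuous n : continuous (ract n).
Proof. by move=> x; apply: (@cvgD _ R^o); [exact: cvg_id|exact: cvg_cst]. Qed.

Lemma ract_disc (x : R) : exists2 U, nbhs x U &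
  forall n x', U x' -> U (ract n x') -> n = 0.
Proof.
exists (ball x (1/2)); first by apply: nbhsx_ballx; lra.
move=> n x'; rewrite /ball /= /ract => h1 h2.
have : `|n%:~R : R| < 1.
  have -> : n%:~R = (x - x') - (x - (x' + n%:~R)) by ring.
  by apply: le_lt_trans (ler_normB _ _) _; lra.
by rewrite -intr_norm -[1]/(1%:~R) ltr_int => h; lia.
Qed.

Definition eqmod1 (x y : R) : Prop := exists n : int, y = x + n%:~R.

(** The representatives [circle_rep] are discontinuous, but only the class of their difference
    modulo 1 matters. A difference can start from 0 where [b] and [b'] agree, even if neither of
    them lifts over [X]. *)
Theorem circle_difference_lift_exists (X : topologicalType)
    (b b' : X * R -> circle R) (a0 : X -> R) (c : X * R -> R) :
  c = (fun p => circle_rep (b p) - circle_rep (b' p)) ->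
  (forall x t, t <= 0 -> c (x, t) = c (x, 0)) ->
  (forall x t, 1 <= t -> c (x, t) = c (x, 1)) ->
  continuous b -> continuous b' -> continuous a0 ->
  (forall x, eqmod1 (c (x, 0)) (a0 x)) ->
  exists L : X * R -> R, [/\ continuous L,
    forall x t, t <= 0 -> L (x, t) = a0 x & forall p, eqmod1 (c p) (L p)].
Proof.
move=> cE c0 c1 cb cb' ca0 ac.
have loc x t : exists rho : X * R -> R, \forall p \near ((x, t) : X * R),
      {for p, continuous rho} /\ same_orbit ract (c (p.1, p.2)) (rho p).
  have [rho _ H] := circle_local_lift cb (circle_repK (b (x, t))).
  have [rho' _ H'] := circle_local_lift cb' (circle_repK (b' (x, t))).
  exists (fun p => rho p - rho' p).
  apply: filterS2 H H' => -[x' t'] [h1 h2] [h1' h2']; split.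
    exact: (@cvgB _ R^o).
  have := circle_repK (b (x', t')); rewrite -{2}h2 => /picircleP [n rE].
  have := circle_repK (b' (x', t')); rewrite -{2}h2' => /picircleP [m rE'].
  by exists (n - m); rewrite cE /ract intrB /= rE rE'; ring.
have [L [cL La Lc]] := @lift_exists _ _ ract0 ractD ract_continuous ract_disc R X
  (fun x t => c (x, t)) a0 c0 c1 loc ca0 ac.
by exists L; split=> // -[x t]; exact: Lc.
Qed.

Theorem circle_lift_exists (X : topologicalType) (b : X * R -> circle R) (a0 : X -> R) :
  (forall x t, t <= 0 -> b (x, t) = b (x, 0)) ->
  (forall x t, 1 <= t -> b (x, t) = b (x, 1)) ->
  continuous b -> continuous a0 -> (forall x, picircle (a0 x) = b (x, 0)) ->
  exists L : X * R -> R, [/\ continuous L,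
    forall x t, t <= 0 -> L (x, t) = a0 x & forall p, picircle (L p) = b p].
Proof.
move=> b0 b1 cb ca0 ab.
have [n nE] : eqmod1 (0 : R) (circle_rep (picircle 0)).
  by apply/picircleP; rewrite circle_repK.
have [|||||x|L [cL L0 Lc]] := @circle_difference_lift_exists X b (fun=> picircle 0) a0 _ erefl.
- by move=> x t t0; rewrite b0.
- by move=> x t t1; rewrite b1.
- exact: cb.
- by move=> p; exact: cvg_cst.
- exact: ca0.
- have /picircleP [m ->] : picircle (circle_rep (b (x, 0))) = picircle (a0 x).
    by rewrite circle_repK ab.
  by exists (m + n); rewrite nE intrD; ring.
exists L; split => // p; have [m ->] := Lc p.
rewrite -[RHS]circle_repK; apply/esym/picircleP; exists (m - n).
by rewrite nE intrB; ring.
Qed.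

Lemma real_segment_unique (f g : R -> R) a b :
  (forall t, Num.min a b <= t <= Num.max a b ->
    [/\ {for t, continuous f}, {for t, continuous g} &
     \forall u \near t, eqmod1 (f u) (g u)]) ->
  f a = g a -> f b = g b.
Proof. exact: (@segment_lift_unique _ _ ract0 ractD ract_continuous ract_disc R f g a b). Qed.

End RealLift.

(** * Lifts to the strip and isotopies *)

Section Lifts.
Context (R : realType).
Local Notation S := (strip R).
Local Notation A := (annulus R).
Local Notation U := (unit_itv R).

(** The contraction of the strip to [strip_base] along straight segments; lifts to the strip are
    constructed and compared along it. *)
Definition segment_from_base (p : S * R) : S :=
  (clamp p.2 * p.1.1, uclamp (clamp p.2 * ucoord p.1.2)).

Lemma continuous_at_mul (T : topologicalType) (f g : T -> R) (p : T) :
  {for p, continuous f} -> {for p, continuous g} ->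
  {for p, continuous (fun q => f q * g q)}.
Proof. by move=> fp gp; exact: (@cvgM _ _ _ _ f g). Qed.

Lemma continuous_at_add (T : topologicalType) (f g : T -> R) (p : T) :
  {for p, continuous f} -> {for p, continuous g} ->
  {for p, continuous (fun q => f q + g q)}.
Proof. by move=> fp gp; exact: (@cvgD _ R^o _ _ _ f g). Qed.

Lemma continuous_at_sub (T : topologicalType) (f g : T -> R) (p : T) :
  {for p, continuous f} -> {for p, continuous g} ->
  {for p, continuous (fun q => f q - g q)}.
Proof. by move=> fp gp; exact: (@cvgB _ R^o _ _ _ f g). Qed.

Lemma continuous_at_cst (T V : topologicalType) (v : V) (p : T) :
  {for p, continuous (fun _ : T => v)}.
Proof. exact: cvg_cst. Qed.

Lemma continuous_at_id (T : topologicalType) (p : T) :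
  {for p, continuous (fun q : T => q)}.
Proof. exact: cvg_id. Qed.

Lemma continuous_at_clamp (T : topologicalType) (f : T -> R) (p : T) :
  {for p, continuous f} -> {for p, continuous (fun q => clamp (f q))}.
Proof. by move=> fp; apply: (continuous_at_comp fp); exact: clamp_continuous. Qed.

Lemma continuous_at_uclamp (T : topologicalType) (f : T -> R) (p : T) :
  {for p, continuous f} -> {for p, continuous (fun q => uclamp (f q))}.
Proof. by move=> fp; apply: (continuous_at_comp fp); exact: uclamp_continuous. Qed.

Lemma continuous_at_ucoord (T : topologicalType) (f : T -> U) (p : T) :
  {for p, continuous f} -> {for p, continuous (fun q => ucoord (f q))}.
Proof. by move=> fp; apply: (continuous_at_comp fp); exact: ucoord_continuous. Qed.

Lemma continuous_at_cov (T : topologicalType) (f : T -> S) (p : T) :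
  {for p, continuous f} -> {for p, continuous (fun q => cov (f q))}.
Proof. by move=> fp; apply: (continuous_at_comp fp); exact: cov_continuous. Qed.

Lemma segment_from_base_continuous : continuous segment_from_base.
Proof.
move=> p; have h1 : {for p, continuous (fun q : S * R => q.2)} by exact: cvg_snd.
have h2 : {for p, continuous (fun q : S * R => q.1)} by exact: cvg_fst.
apply: (@continuous_at_pair (S * R)%type R U
  (fun p => clamp p.2 * p.1.1) (fun p => uclamp (clamp p.2 * ucoord p.1.2))).
  apply: continuous_at_mul; first exact: continuous_at_clamp.
  exact: (continuous_at_fst h2).
apply/continuous_at_uclamp/continuous_at_mul; first exact: continuous_at_clamp.
exact/continuous_at_ucoord/(continuous_at_snd h2).
Qed.

Definition strip_base : S := (0, unit0 R).

Lemma segment_from_base_le0 z t : t <= 0 -> segment_from_base (z, t) = strip_base.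
Proof. by move=> t0; rewrite /segment_from_base /= clamp_le0 // !mul0r uclamp0. Qed.

Lemma segment_from_base_ge1 z t : 1 <= t -> segment_from_base (z, t) = z.
Proof.
move=> t1; rewrite /segment_from_base /= clamp_ge1 // !mul1r ucoordK.
by rewrite -surjective_pairing.
Qed.

Lemma lifts_differ (k k' : S -> S) : continuous k -> continuous k' ->
  (forall z, cov (k z) = cov (k' z)) -> exists n, forall z, k' z = deck n (k z).
Proof.
move=> ck ck' kk'; have [n nb] := (cov_eqP _ _).1 (kk' strip_base).
exists n => z; have [m zm] := (cov_eqP _ _).1 (kk' z).
suff E : (k' z).1 = (deck n (k z)).1.
  by rewrite zm in E *; rewrite /deck /= in E *; congr (_, _).
rewrite -[z](@segment_from_base_ge1 z 1) //.
apply: (@real_segment_unique R (fun t => (k' (segment_from_base (z, t))).1)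
  (fun t => (deck n (k (segment_from_base (z, t)))).1) 0); last first.
  by rewrite segment_from_base_le0 // nb.
have cs t : {for t, continuous (fun t => segment_from_base (z, t))}.
  apply: (@continuous_at_comp R (S * R)%type S (fun t => (z, t)));
    first exact: continuous_at_pairr.
  exact: segment_from_base_continuous.
move=> t _; split.
- by apply: continuous_at_fst; apply: (continuous_at_comp (cs t)); exact: ck'.
- apply: (@continuous_at_fst R R U (fun t => deck n (k (segment_from_base (z, t))))).
  apply: (@continuous_at_comp R S S (fun t => k (segment_from_base (z, t))));
    last exact: deck_continuous.
  by apply: (continuous_at_comp (cs t)); exact: ck.
near=> u; have [l ->] := (cov_eqP _ _).1 (kk' (segment_from_base (z, u))).
by exists (n - l); rewrite /deck /= intrB; ring.
Unshelve. all: by end_near. Qed.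

(** The displacement of [E (p, cov z)] relative to the image of the base point lifts globally, since
    it starts from 0. The image of the base point is a circle-valued function of [p], lifted only
    near [p0]; hence the local conclusion. *)
Lemma family_lift (P : topologicalType) (E : P * A -> A) (p0 : P) :
  continuous E -> exists k : P * S -> S, \forall p \near p0, forall z,
    {for (p, z), continuous k} /\ cov (k (p, z)) = E (p, cov z).
Proof.
move=> cE.
have cEz (T : topologicalType) (f : T -> P) (g : T -> S) t :
    {for t, continuous f} -> {for t, continuous g} ->
    {for t, continuous (fun t => E (f t, cov (g t)))}.
  move=> cf cg.
  apply: (@continuous_at_comp T (P * A)%type A (fun t => (f t, cov (g t)))); last exact: cE.
  by apply: continuous_at_pair => //; exact: continuous_at_cov.
pose b (q : (P * S) * R) := (E (q.1.1, cov (segment_from_base (q.1.2, q.2)))).1.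
pose b0 (p : P) := (E (p, cov strip_base)).1.
pose b' (q : (P * S) * R) := b0 q.1.1.
have cq1 (q : (P * S) * R) : {for q, continuous (fun q : (P * S) * R => q.1)}.
  exact: cvg_fst.
have cq11 (q : (P * S) * R) : {for q, continuous (fun q : (P * S) * R => q.1.1)}.
  exact: (continuous_at_fst (cq1 q)).
have cb : continuous b.
  move=> q; apply: (@continuous_at_fst _ (circle R) U); apply: cEz => //.
  apply: (@continuous_at_comp _ (S * R)%type S
    (fun q : (P * S) * R => (q.1.2, q.2))); last exact: segment_from_base_continuous.
  apply: continuous_at_pair; last exact: cvg_snd.
  exact: (continuous_at_snd (cq1 q)).
have cb0 : continuous b0.
  move=> p; apply: (@continuous_at_fst _ (circle R) U); apply: (cEz P id (fun=> strip_base)).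
    exact: cvg_id.
  exact: cvg_cst.
have cb' : continuous b'.
  by move=> q; exact: (continuous_at_comp (cq11 q) (cb0 _)).
have [|||||q|L [cL L0 Lc]] := @circle_difference_lift_exists R
    (P * S)%type b b' (fun=> 0) _ erefl.
- by move=> q t t0; rewrite /b /b' /= !segment_from_base_le0.
- by move=> q t t0; rewrite /b /b' /= !segment_from_base_ge1.
- exact: cb.
- exact: cb'.
- by move=> x; exact: cvg_cst.
- by exists 0; rewrite /b /b' /= segment_from_base_le0 // /b0 subrr addr0.
have [rho _ rhoP] := @circle_local_lift R P b0 p0 (circle_rep (b0 p0)) cb0 (circle_repK _).
exists (fun q => (rho q.1 + L (q, 1), (E (q.1, cov q.2)).2)).
apply: filterS rhoP => p [crho prho] z; split.
  have c1 : {for (p, z), continuous (fun q : P * S => q.1)} by exact: cvg_fst.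
  have c2 : {for (p, z), continuous (fun q : P * S => q.2)} by exact: cvg_snd.
  apply: (@continuous_at_pair _ R U); last exact: (continuous_at_snd (cEz _ _ _ _ c1 c2)).
  apply: continuous_at_add; first exact: (continuous_at_comp c1).
  apply: (@continuous_at_comp _ ((P * S) * R)%type R (fun q : P * S => (q, 1))); last exact: cL.
  exact: continuous_at_pairl.
rewrite covE /= [RHS]surjective_pairing; congr (_, _).
have [n Ln] := Lc ((p, z), 1); rewrite Ln.
have -> : E (p, cov z) = E (p, cov (segment_from_base (z, 1))) by rewrite segment_from_base_ge1.
rewrite -[RHS]/(b ((p, z), 1)) -[RHS]circle_repK.
have [m ->] : exists m : int, circle_rep (b0 p) = rho p + m%:~R by apply/picircleP;
  rewrite circle_repK.
by apply/picircleP; exists (m - n); rewrite /b' /= intrB; ring.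
Qed.

Lemma map_lift (u : A -> A) : continuous u ->
  exists2 k : S -> S, continuous k & forall z, cov (k z) = u (cov z).
Proof.
move=> cu; have [z|k /nbhs_singleton H] := @family_lift U (fun q => u q.2) (unit0 R).
  by apply: (continuous_at_comp _ (cu _)); exact: cvg_snd.
exists (fun z => k (unit0 R, z)) => z; last by case: (H z).
have [kz _] := H z.
by apply: (@continuous_at_comp _ (U * S)%type S (fun z => (unit0 R, z))) => //;
  exact: continuous_at_pairr.
Qed.

End Lifts.

(** * Paths in the digital line and angle classes *)

(** Neighbouring values of [f] differ by at most 1, so [f] could leave the window between two
    consecutive integers congruent to [e] only by taking one of them as a value. *)
Lemma digital_avoid (R : realType) (f : R -> digital_line) (e m : int) (a b : R) :
  a <= b ->
  (forall t, a <= t <= b -> {for t, continuous f}) ->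
  (forall t, a <= t <= b -> ~ eqmod4 e (f t)) ->
  4 * m + e < (f a : int) < 4 * m + e + 4 -> 4 * m + e < (f b : int) < 4 * m + e + 4.
Proof.
move=> ab cf fe.
pose P t := 4 * m + e < (f t : int) < 4 * m + e + 4.
suff loc t : a <= t <= b -> exists Q : Prop, \forall u \near t, a <= u <= b -> (P u <-> Q).
  by case: (@segment_locally_constant R a b P ab loc).
move=> tab; exists (P t); rewrite /P.
move/continuous_digital: (cf t tab); apply: filterS => u ftu uab.
have := fe t tab; have := fe u uab; have := dig_dist ftu.
move: (f t : int) (f u : int) => x y xy ye xe.
have not_e k : y <> 4 * k + e /\ x <> 4 * k + e.
  by split => H; [apply: ye|apply: xe]; exists k.
have [? ?] := not_e m; have [? ?] := not_e (m + 1).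
by split=> H; lia.
Qed.

Lemma near_lt (R : realType) (T : topologicalType) (x x' : T -> R) (p : T) :
  {for p, continuous x} -> {for p, continuous x'} -> x p < x' p ->
  \forall q \near p, x q < x' q.
Proof.
move=> cx cx' xx'; have cd := continuous_at_sub cx' cx.
have : nbhs (x' p - x p) [set r : R | 0 < r] by apply: lt_nbhsr; rewrite subr_gt0.
by move/(continuous_at_near cd); apply: filterS => q /=; rewrite subr_gt0.
Qed.

(** The common form of all angles: [x] and [x'] locate the leaves, and [up] orders two points of one
    leaf, so that it counts only when [x = x']. The value 2 stands for the opposite order. *)
Definition aclass (R : realType) (x x' : R) (up : Prop) : int :=
  if x < x' then -1 else if x' < x then 1 else if `[<up>] then 0 else 2.

(** A strict inequality persists. On a common leaf the class is 0 or 2, whose neighbourhoods contain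
    both odd classes, so it only remains to exclude a flip between 0 and 2 nearby. *)
Lemma digital_at_aclass (R : realType) (T : topologicalType) (x x' : T -> R)
    (up : T -> Prop) (p : T) :
  {for p, continuous x} -> {for p, continuous x'} ->
  (x p = x' p -> exists Q : Prop,
     \forall q \near p, x q = x' q -> (up q <-> Q)) ->
  digital_at (fun q => aclass (x q) (x' q) (up q)) p.
Proof.
move=> cx cx' H; rewrite /digital_at.
have [xx'|x'x|xx'] := ltgtP (x p) (x' p).
- apply: filterS (near_lt cx cx' xx') => q xq.
  by exists (-1); rewrite /aclass ?xx' ?xq; [exact: dig_refl|exact: eqmod4_refl].
- apply: filterS (near_lt cx' cx x'x) => q xq.
  by exists 1; rewrite /aclass ?x'x ?xq ?(lt_gtF x'x) ?(lt_gtF xq);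
    [exact: dig_refl|exact: eqmod4_refl].
have [Q nQ] := H xx'.
have upQ := nbhs_singleton nQ xx'.
apply: filterS nQ => q qQ; rewrite /aclass xx' ltxx.
have two : (exists m, 2 = 2 * m :> int) by exists 1.
have zero : (exists m, 0 = 2 * m :> int) by exists 0.
have [xq|xq|/qQ {}qQ] := ltgtP (x q) (x' q).
(* Next to 2, the class of -1 is represented by 3. *)
- case: asboolP => _; [exists (-1)|exists 3]; try by right.
    exact: eqmod4_refl.
  by exists (-1).
- by case: asboolP => _; exists 1; try exact: eqmod4_refl; right.
have -> : up p = up q by apply/propext; rewrite upQ qQ.
by case: asboolP => _; [exists 0|exists 2]; try exact: eqmod4_refl; left.
Qed.

Lemma aclass_eqmod4 (R : realType) (x x' : R) (up : Prop) (k : int) :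
  -1 <= k <= 2 -> eqmod4 k (aclass x x' up) -> aclass x x' up = k.
Proof.
move=> kb [n]; rewrite /aclass; case: ifP => _; first by lia.
by case: ifP => _; first lia; case: asboolP => _; lia.
Qed.

(** * Isotopies of the annulus and their lifts *)

Section Isotopies.
Context (R : realType).
Local Notation S := (strip R).
Local Notation A := (annulus R).
Local Notation U := (unit_itv R).

Definition isotopy (H : U * A -> A) : Prop :=
  [/\ continuous H, forall t, homeomorphism (fun z => H (t, z)) &
      forall z, H (unit0 R, z) = z].

Definition isotopy_lift (H : U * A -> A) (G : S * R -> S) : Prop :=
  [/\ continuous G, forall z t, t <= 0 -> G (z, t) = z &
      forall z t, cov (G (z, t)) = H (uclamp t, cov z)].

Lemma isotopy_lift_exists H : isotopy H -> exists G, isotopy_lift H G.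
Proof.
move=> [cH _ H0].
pose h (q : S * R) := H (uclamp q.2, cov q.1).
have ch : continuous h.
  move=> q; apply: (@continuous_at_comp _ (U * A)%type A (fun q : S * R => (uclamp q.2,
    cov q.1)));
    last exact: cH.
  by apply: continuous_at_pair;
    [apply: continuous_at_uclamp; exact: cvg_snd|apply: continuous_at_cov; exact: cvg_fst].
pose b q := (h q).1.
have uclamp_le0 t : t <= 0 -> uclamp t = uclamp (0 : R).
  by move=> t0; apply: ucoord_inj; rewrite !ucoord_uclamp !clamp_le0.
have uclamp_ge1 t : 1 <= t -> uclamp t = uclamp (1 : R).
  by move=> t0; apply: ucoord_inj; rewrite !ucoord_uclamp !clamp_ge1.
have [|||||L [cL L0 Lc]] := @circle_lift_exists R S b fst.
- by move=> z t t0; rewrite /b /h /= uclamp_le0.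
- by move=> z t t0; rewrite /b /h /= uclamp_ge1.
- by move=> q; apply: (continuous_at_fst (ch q)).
- by move=> z; exact: cvg_fst.
- by move=> z; rewrite /b /h /= uclamp0 H0 covE.
exists (fun q => (L q, (h q).2)); split.
- move=> q; apply: (@continuous_at_pair (S * R)%type R U L (fun q => (h q).2)); first exact: cL.
  exact: (continuous_at_snd (ch q)).
- move=> z t t0; rewrite L0 // /h /= uclamp_le0 // uclamp0 H0 covE.
  by rewrite -surjective_pairing.
by move=> z t; rewrite covE /= Lc -[RHS]/(h (z, t)) [RHS]surjective_pairing.
Qed.

Lemma isotopy_lift_at H G t : isotopy_lift H G -> continuous (fun z => G (z, t)).
Proof.
move=> [cG _ _] z; apply: (@continuous_at_comp _ (S * R)%type S (fun z => (z, t)));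
  last exact: cG.
exact: continuous_at_pairl.
Qed.

Lemma isotopy_lift_path H G z : isotopy_lift H G -> continuous (fun t => G (z, t)).
Proof.
move=> [cG _ _] t; apply: (@continuous_at_comp _ (S * R)%type S (fun t => (z, t)));
  last exact: cG.
exact: continuous_at_pairr.
Qed.

Lemma isotopy_lift_deck H G n z t : isotopy_lift H G ->
  G (deck n z, t) = deck n (G (z, t)).
Proof.
move=> GP; have [cG G0 GH] := GP.
have e t' : exists m, deck n (G (z, t')) = deck m (G (deck n z, t')).
  by apply/cov_eqP; rewrite cov_deck !GH cov_deck.
suff E : (G (deck n z, t)).1 = (deck n (G (z, t))).1.
  have [m Em] := e t; rewrite Em in E *; rewrite /deck /= in E *.
  by rewrite [LHS]surjective_pairing; congr (_, _).
apply: (@real_segment_unique R (fun t => (G (deck n z, t)).1)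
  (fun t => (deck n (G (z, t))).1) 0); last by rewrite !G0.
move=> u _; split.
- by apply: continuous_at_fst; exact: isotopy_lift_path GP _.
- apply: (@continuous_at_fst _ R U (fun t => deck n (G (z, t)))).
  apply: (@continuous_at_comp R S S (fun t => G (z, t)) (deck n) u).
    exact: isotopy_lift_path GP _.
  exact: deck_continuous.
near=> v; have [m ->] := e v.
by exists m.
Unshelve. all: by end_near. Qed.

Lemma isotopy_lift_inj H G t : isotopy H -> isotopy_lift H G ->
  injective (fun z => G (z, t)).
Proof.
move=> [_ hH _] GP z z' /= Gz; have [_ _ GH] := GP.
have [g [_ _ /can_inj Hinj _]] := hH (uclamp t).
have : cov z = cov z' by apply: Hinj; rewrite -!GH Gz.
move=> /cov_eqP [n zn]; move: Gz; rewrite zn (isotopy_lift_deck _ _ _ GP).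
set w := G (z, t) => /(congr1 fst) /= wn.
have n0 : n = 0.
  have : n%:~R = 0 :> R by move: wn; lra.
  by move/eqP; rewrite intr_eq0 => /eqP.
by rewrite n0 deck0.
Qed.

(** Up to a deck transformation the lift is the end of a lifted isotopy, which commutes with deck
    transformations because it starts at the identity. *)
Lemma isotopic_lift_deck (u : A -> A) (k : S -> S) : isotopic_to_id u ->
  continuous k -> (forall z, cov (k z) = u (cov z)) ->
  forall n z, k (deck n z) = deck n (k z).
Proof.
move=> [H [cH hH H0 H1]] ck ku n z.
have [G GP] : exists G, isotopy_lift H G by apply: isotopy_lift_exists.
have [_ _ GH] := GP.
have [||w|m mP] := @lifts_differ R (fun z => G (z, 1)) k.
- exact: isotopy_lift_at GP.
- exact: ck.
- by rewrite ku GH uclamp1 H1.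
by rewrite !mP (isotopy_lift_deck _ _ _ GP) -!deckD addrC.
Qed.

(** The inverses are given time by time; their joint continuity follows from the compactness of the
    annulus. *)
Lemma isotopy_inverse H : isotopy H -> exists Hi, [/\ isotopy Hi,
  forall t z, Hi (t, H (t, z)) = z & forall t z, H (t, Hi (t, z)) = z].
Proof.
move=> [cH hH H0]; have [g gP] := choice hH.
pose Hi (q : U * A) := g q.1 q.2.
have HiK t z : Hi (t, H (t, z)) = z by have [_ _ K _] := gP t; exact: K.
have HKi t z : H (t, Hi (t, z)) = z by have [_ _ _ K] := gP t; exact: K.
exists Hi; split => //; split.
- move=> q0; apply: (@implicit_continuous (U * A)%type A A
    (fun q => H (q.1.1, q.2)) snd Hi q0).
  + exact: annulus_compact.
  + exact: annulus_separating.
  + move=> z; apply: (@continuous_at_comp _ (U * A)%type A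
      (fun q : (U * A) * A => (q.1.1, q.2))); last exact: cH.
    apply: continuous_at_pair; last exact: cvg_snd.
    by apply: (@continuous_at_fst _ U A (fun q : (U * A) * A => q.1)); exact: cvg_fst.
  + exact: cvg_snd.
  + by move=> z /= Hz; rewrite [q0]surjective_pairing -Hz HiK.
  + by near=> q; rewrite /= [X in Hi X]surjective_pairing HKi.
- by move=> t; exists (fun z => H (t, z)); have [c1 c2 k1 k2] := gP t; split.
by move=> z; rewrite -{1}[z]H0 HiK.
Unshelve. all: by end_near. Qed.

Lemma isotopy_at H t : isotopy H -> isotopic_to_id (fun z => H (t, z)).
Proof.
move=> [cH hH H0].
exists (fun q => H (uclamp (ucoord q.1 * ucoord t), q.2)); split.
- move=> q; apply: (@continuous_at_comp _ (U * A)%type A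
    (fun q : U * A => (uclamp (ucoord q.1 * ucoord t), q.2))); last exact: cH.
  apply: continuous_at_pair; last exact: cvg_snd.
  apply/continuous_at_uclamp/continuous_at_mul; last exact: cvg_cst.
  by apply: continuous_at_ucoord; exact: cvg_fst.
- by move=> s; exact: (hH (uclamp (ucoord s * ucoord t))).
- by move=> z /=; rewrite mul0r uclamp0.
by move=> z /=; rewrite mul1r ucoordK.
Qed.

Lemma isotopic_isotopy u : isotopic_to_id u ->
  exists2 H, isotopy H & forall z, H (unit1 R, z) = u z.
Proof. by move=> [H [cH hH H0 H1]]; exists H. Qed.

End Isotopies.

(** * Isotopies preserve the boundary circles *)

Section Boundary.
Context (R : realType).
Local Notation S := (strip R).
Local Notation A := (annulus R).
Local Notation U := (unit_itv R).

(** The angle class for the foliation of the strip by vertical segments. *)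
Definition vclass (z z' : S) : int := aclass z.1 z'.1 (ucoord z.2 < ucoord z'.2).

Lemma digital_at_vclass (T : topologicalType) (f g : T -> S) (p : T) :
  {for p, continuous f} -> {for p, continuous g} -> f p <> g p ->
  digital_at (fun q => vclass (f q) (g q)) p.
Proof.
move=> cf cg fg; apply: digital_at_aclass; [exact: continuous_at_fst|exact: continuous_at_fst|].
move=> fg1; have cf2 := continuous_at_ucoord (continuous_at_snd cf).
have cg2 := continuous_at_ucoord (continuous_at_snd cg).
have [lt|lt|E] := ltgtP (ucoord (f p).2) (ucoord (g p).2).
- by exists True; apply: filterS (near_lt cf2 cg2 lt) => q ->.
- exists False; apply: filterS (near_lt cg2 cf2 lt) => q qlt _.
  by rewrite lt_gtF.
case: fg; rewrite [LHS]surjective_pairing [RHS]surjective_pairing.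
by congr (_, _) => //; exact: ucoord_inj.
Qed.

(* The two arcs [arc 1] and [arc (-1)] go around [q], one above and one below. *)
Definition arc (q : S) (r : R) (eps : int) (s : R) : S :=
  (q.1 + r * (1 - 2 * clamp s),
   uclamp (ucoord q.2 + eps%:~R * (r * (clamp s * (1 - clamp s))))).

(** An explicit lift of the direction from [q] to the arc: -1 on the right of [q], then 0 above or
    -2 below, and finally 1 or -3 on the left. The two final values differ by a full turn. *)
Definition arc_angle (eps : int) (s : R) : int :=
  if clamp s < 1 / 2 then -1 else if 1 / 2 < clamp s then -1 + 2 * eps else -1 + eps.

Lemma arc_angle0 eps : arc_angle eps 0 = -1.
Proof. by rewrite /arc_angle clamp_le0 // ifT // divr_gt0. Qed.

Lemma arc_angle1 eps : arc_angle eps 1 = -1 + 2 * eps.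
Proof. by rewrite /arc_angle clamp_ge1 // ifF ?ifT //; lra. Qed.

Lemma arc_continuous q r eps : continuous (arc q r eps).
Proof.
move=> s; have cs : {for s, continuous (fun s : R => clamp s)} by exact: clamp_continuous.
apply: (@continuous_at_pair R R U (fun s => q.1 + r * (1 - 2 * clamp s))
  (fun s => uclamp (ucoord q.2 + eps%:~R * (r * (clamp s * (1 - clamp s)))))).
  apply: continuous_at_add; first exact: cvg_cst.
  apply: continuous_at_mul; first exact: cvg_cst.
  apply: continuous_at_sub; first exact: cvg_cst.
  by apply: continuous_at_mul => //; exact: cvg_cst.
apply: continuous_at_uclamp; apply: continuous_at_add; first exact: cvg_cst.
apply: continuous_at_mul; first exact: cvg_cst.
apply: continuous_at_mul; first exact: cvg_cst.
apply: continuous_at_mul => //.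
by apply: continuous_at_sub => //; exact: cvg_cst.
Qed.

Lemma arc_angle_continuous eps : eps = 1 \/ eps = -1 -> continuous (arc_angle eps :
  R -> digital_line).
Proof.
move=> epsP s; apply/continuous_digital.
have cs : {for s, continuous (fun s : R => clamp s)} by exact: clamp_continuous.
have cc : {for s, continuous (fun _ : R => 1 / 2 : R)} by exact: cvg_cst.
rewrite /arc_angle; have [lt|lt|E] := ltgtP (clamp s) (1 / 2).
- by apply: filterS (near_lt cs cc lt) => u ->; exact: dig_refl.
- apply: filterS (near_lt cc cs lt) => u ult; rewrite ult lt_gtF //; exact: dig_refl.
near=> u; have even : exists m, -1 + eps = 2 * m.
  by case: epsP => ->; [exists 0|exists (-1)].
by case: ltgtP => _; [right|right|left] => //; split => //; case: epsP => ->.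
Unshelve. all: by end_near. Qed.

Section Arcs.
Context (q : S) (r : R).
Hypotheses (r0 : 0 < r) (rq : r <= ucoord q.2) (rq1 : ucoord q.2 <= 1 - r).

Lemma arc_height eps s : eps = 1 \/ eps = -1 ->
  ucoord (arc q r eps s).2 = ucoord q.2 + eps%:~R * (r * (clamp s * (1 - clamp s))).
Proof.
move=> epsP; rewrite ucoord_uclamp clamp_id //.
have /andP[c0 c1] := clamp01 s; set c := clamp s in c0 c1 *.
have h0 : 0 <= r * (c * (1 - c)).
  by apply: mulr_ge0; [exact: ltW|apply: mulr_ge0 => //; rewrite subr_ge0].
have h1 : r * (c * (1 - c)) <= r.
  have h2 : c * (1 - c) <= 1 by apply: mulr_ile1 => //; lra.
  by rewrite -[leRHS]mulr1 ler_pM2l.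
move: (r * _) h0 h1 (ucoord q.2) rq rq1 => X h0 h1 y yr yr1.
by case: epsP => ->; rewrite ?mulrNz ?mulr1z ?mulN1r ?mul1r; apply/andP; split; lra.
Qed.

Lemma arc_vclass eps s : eps = 1 \/ eps = -1 ->
  q <> arc q r eps s /\ eqmod4 (vclass q (arc q r eps s)) (arc_angle eps s).
Proof.
move=> epsP; rewrite /vclass /aclass /arc_angle arc_height // [(arc _ _ _ _).1]/=.
have /andP[c0 c1] := clamp01 s.
have E1 : (q.1 < q.1 + r * (1 - 2 * clamp s)) = (clamp s < 1 / 2).
  by rewrite ltrDl pmulr_rgt0 // subr_gt0; apply/idP/idP => ?; lra.
have E2 : (q.1 + r * (1 - 2 * clamp s) < q.1) = (1 / 2 < clamp s).
  by rewrite gtrDl pmulr_rlt0 // subr_lt0; apply/idP/idP => ?; lra.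
split.
  move=> qa; move: (arc_height s epsP) E1 E2; rewrite -qa.
  have -> : q.1 + r * (1 - 2 * clamp s) = q.1 by rewrite [in RHS]qa.
  rewrite ltxx => H /esym /negbT + /esym /negbT; rewrite -!leNgt => l1 l2.
  have cE : clamp s = 1 / 2 by lra.
  move: H; rewrite cE => /eqP; rewrite -subr_eq0 opprD addNKr oppr_eq0 mulf_eq0 intr_eq0.
  case/orP; first by case: epsP => ->.
  have : 0 < r * (1 / 2 * (1 - 1 / 2)) by rewrite !mulr_gt0 //; lra.
  by move=> /[swap] /eqP ->; rewrite ltxx.
rewrite E1 E2; have [_|_|cE] := ltgtP (clamp s) (1 / 2).
- exact: eqmod4_refl.
- by case: epsP => ->; [exact: eqmod4_refl|exists (-1)].
have X0 : 0 < r * (1 / 2 * (1 - 1 / 2)) by rewrite !mulr_gt0 //; lra.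
rewrite cE; case: epsP => ->; case: asboolP.
- by move=> _; exact: eqmod4_refl.
- by case; rewrite mulr1z mul1r ltrDl.
- by rewrite mulrNz mulN1r ltrDl oppr_gt0 (lt_gtF X0).
by move=> _; exists (-1).
Qed.

End Arcs.

(* If [G (q, 1)] were on the boundary, one of the classes 0 and 2 would be avoided by
   the direction from [G (q, 1)] to the images of the two arcs at time 1, and the
   angles at the common end of the arcs would agree; at every time they differ by
   a full turn. *)
Lemma interior_preserved (G : S * R -> S) (q : S) :
  continuous G -> (forall z, G (z, 0) = z) ->
  (forall t, 0 <= t <= 1 -> injective (fun z => G (z, t))) ->
  0 < ucoord q.2 < 1 -> 0 < ucoord (G (q, 1)).2 < 1.
Proof.
move=> cG G0 Ginj /andP[q0 q1].
pose r := Num.min (ucoord q.2) (1 - ucoord q.2).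
have r0 : 0 < r by rewrite lt_min q0 subr_gt0.
have rq : r <= ucoord q.2 by rewrite ge_min lexx.
have rq1 : ucoord q.2 <= 1 - r by rewrite lerBrDl addrC -lerBrDl ge_min lexx orbT.
have lift eps : eps = 1 \/ eps = -1 -> exists L : R * R -> digital_line,
    [/\ continuous L, forall s, L (s, 0) = arc_angle eps s &
        forall p, eqmod4 (vclass (G (q, clamp p.2)) (G (arc q r eps p.1, clamp p.2))) (L p)].
  move=> epsP.
  have [||p||s|L [cL L0 Lc]] := @digital_lift_exists R R
      (fun p => vclass (G (q, clamp p.2)) (G (arc q r eps p.1, clamp p.2)))
      (arc_angle eps).
  - by move=> s t t0; rewrite /= !clamp_le0.
  - by move=> s t t0; rewrite /= !clamp_ge1.
  - have c2 : {for p, continuous (fun p : R * R => clamp p.2)}.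
      by apply: continuous_at_clamp; exact: cvg_snd.
    apply: digital_at_vclass.
    + apply: (@continuous_at_comp _ (S * R)%type S (fun p : R * R => (q, clamp p.2)));
      last exact: cG.
      by apply: continuous_at_pair => //; exact: cvg_cst.
    + apply: (@continuous_at_comp _ (S * R)%type S
        (fun p : R * R => (arc q r eps p.1, clamp p.2))); last exact: cG.
      apply: continuous_at_pair => //.
      apply: (@continuous_at_comp _ R S fst); first exact: cvg_fst.
      exact: arc_continuous.
    by move/(Ginj _ (clamp01 _)); case: (@arc_vclass q r r0 rq rq1 eps p.1 epsP).
  - exact: arc_angle_continuous.
  - by rewrite /= clamp_le0 // !G0; case: (@arc_vclass q r r0 rq rq1 eps s epsP).
  by exists L; split => // s; rewrite L0.
have [Lp [cLp Lp0 Lpc]] := lift 1 (or_introl erefl).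
have [Lm [cLm Lm0 Lmc]] := lift (-1) (or_intror erefl).
have slice1 (L : R * R -> digital_line) s : continuous L -> continuous (fun t => L (s, t)).
  by move=> cL t; apply: slice_continuous; exact: cL.
have slice2 (L : R * R -> digital_line) t : continuous L -> continuous (fun s => L (s, t)).
  move=> cL s; apply: (@continuous_at_comp R (R * R)%type digital_line (fun s => (s, t)));
    last exact: cL.
  exact: continuous_at_pairl.
(* Where the arcs meet, both lifts follow the same pair of moving points, so they vary by the same
   amount. *)
have diff s : arc q r 1 s = arc q r (-1) s ->
    (Lp (s, 1) : int) - Lp (s, 0) = (Lm (s, 1) : int) - Lm (s, 0).
  move=> E; apply: (@digital_segment_diff R (fun t => Lp (s, t)) (fun t => Lm (s, t)));
    first by [].
  move=> t _; split; [exact: slice1|exact: slice1|near=> u].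
  apply: eqmod4_trans (eqmod4_sym (Lpc (s, u))) _.
  by rewrite /= E; exact: (Lmc (s, u)).
have d0 : (Lp (0, 1) : int) = Lm (0, 1).
  have : arc q r 1 0 = arc q r (-1) 0 by rewrite /arc clamp_le0 // !mul0r !mulr0.
  move/diff; rewrite Lp0 Lm0 !arc_angle0.
  have aux (x y : int) : x - -1 = y - -1 -> x = y by lia.
  exact: aux.
have d1 : (Lp (1, 1) : int) = Lm (1, 1) + 4.
  have : arc q r 1 1 = arc q r (-1) 1 by rewrite /arc clamp_ge1 // subrr !mulr0.
  move/diff; rewrite Lp0 Lm0 !arc_angle1.
  have aux (x y : int) : x - (-1 + 2 * 1) = y - (-1 + 2 * -1) -> x = y + 4 by lia.
  exact: aux.
(* A missing direction [e] confines both lifts at time 1 to the same window of length 4, since they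
   start together; yet their end values differ by 4. *)
have avoid e : (forall z, z <> G (q, 1) -> vclass (G (q, 1)) z <> e) -> -1 <= e <= 2 -> False.
  move=> He e4.
  have nL eps L t : eps = 1 \/ eps = -1 ->
      (forall p, eqmod4 (vclass (G (q, clamp p.2)) (G (arc q r eps p.1, clamp p.2))) (L p)) ->
      ~ eqmod4 e (L (t, 1)).
    move=> epsP Lc eL; have := Lc (t, 1); rewrite /= clamp_ge1 // => vL.
    have vE := aclass_eqmod4 e4 (eqmod4_trans eL (eqmod4_sym vL)).
    apply: (He (G (arc q r eps t, 1))) vE => /(Ginj 1).
    rewrite lexx ler01 => /(_ isT); apply/nesym.
    by case: (@arc_vclass q r r0 rq rq1 eps t epsP).
  have neL := nL 1 Lp 0 (or_introl erefl) Lpc.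
  have [m mP] : exists m : int, 4 * m + e < (Lp (0, 1) : int) < 4 * m + e + 4.
    move: neL; move: (Lp (0, 1)) => y; rewrite /digital_line in y * => neL.
    exists ((y - e) %/ 4)%Z; have := divz_eq (y - e) 4.
    set d := (_ %/ _)%Z; set x := (_ %% _)%Z => dx.
    have x4 : x < 4 by apply: ltz_pmod.
    have x0 : 0 <= x by apply: modz_ge0.
    have : x <> 0 by move=> x00; apply: neL; exists d; lia.
    by lia.
  have H1 := digital_avoid ler01 (fun t _ => slice2 Lp 1 cLp t)
    (fun t _ => nL 1 Lp t (or_introl erefl) Lpc) mP.
  rewrite d0 in mP.
  have H2 := digital_avoid ler01 (fun t _ => slice2 Lm 1 cLm t)
    (fun t _ => nL (-1) Lm t (or_intror erefl) Lmc) mP.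
  have aux (x y k : int) : x = y + 4 -> k < x < k + 4 -> k < y < k + 4 -> False by lia.
  exact: aux d1 H1 H2.
have /andP[z0 z1] := ucoord01 (G (q, 1)).2.
rewrite !lt_neqAle z0 z1 !andbT; apply/andP; split; apply/eqP => zE.
  (* From height 0 no point is seen below, and from height 1 none above: the missing directions are
     2 and 0. *)
  apply: (avoid 2) => // z zG; rewrite /vclass /aclass -zE.
  case: ltgtP => // z1E; case: asboolP => // nz _; apply: zG.
  rewrite [LHS]surjective_pairing [RHS]surjective_pairing z1E; congr (_, _).
  apply: ucoord_inj; rewrite -zE; apply/eqP; rewrite eq_le; move/negP: nz.
  by rewrite -leNgt => ->; case/andP: (ucoord01 z.2).
apply: (avoid 0) => // z zG; rewrite /vclass /aclass zE.
case: ltgtP => // z1E; case: asboolP => // nz _.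
by case/andP: (ucoord01 z.2) => _; rewrite leNgt nz.
Unshelve. all: by end_near. Qed.

Lemma isotopy_int H t w : isotopy H -> @int_annulus R w -> @int_annulus R (H (t, w)).
Proof.
move=> iH; have [z <-] := cov_surj w.
have [H' iH' E] := isotopic_isotopy (isotopy_at t iH).
rewrite -E => zi; have [G GP] := isotopy_lift_exists iH'; have [cG G0 GH] := GP.
rewrite -uclamp1 -GH; apply: interior_preserved => //.
- by move=> ?; exact: G0.
- by move=> u _; exact: isotopy_lift_inj iH' GP.
Qed.

Lemma isotopic_int u w : isotopic_to_id u -> @int_annulus R (u w) <-> @int_annulus R w.
Proof.
move=> /isotopic_isotopy [H iH <-]; split; last exact: isotopy_int.
have [Hi [iHi HiK _]] := isotopy_inverse iH.
by move/(isotopy_int (unit1 R) iHi); rewrite HiK.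
Qed.

Lemma boundary_cases (w : A) : [\/ @C0 R w, @C1 R w | @int_annulus R w].
Proof.
have /andP[] := ucoord01 w.2; rewrite le_eqVlt => /orP[/eqP w0 _|w0]; first exact: Or31.
rewrite le_eqVlt => /orP[/eqP w1|w1]; first exact: Or32.
by apply: Or33; rewrite /int_annulus /= w0.
Qed.

(** The point never enters the interior, so its height is 0 or 1 throughout the isotopy, and by
    continuity it does not jump. *)
Lemma isotopic_boundary u w (y : R) : y = 0 \/ y = 1 -> isotopic_to_id u ->
  ucoord w.2 = y -> ucoord (u w).2 = y.
Proof.
move=> y01 /isotopic_isotopy [H iH <-] wy; have [cH _ H0] := iH.
have nint t : ~ @int_annulus R (H (t, w)).
  move/(isotopic_int w (isotopy_at t iH)).1.
  by rewrite /int_annulus /= wy; case: y01 => ->; rewrite ltxx ?andbF.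
have cP : continuous (fun t => ucoord (H (uclamp t, w)).2).
  move=> t; apply: (@continuous_at_ucoord R R (fun t => (H (uclamp t, w)).2)).
  apply: (@continuous_at_snd R (circle R) U (fun t => H (uclamp t, w))).
  apply: (@continuous_at_comp _ (U * A)%type A (fun t => (uclamp t, w))); last exact: cH.
  apply: continuous_at_pair; last exact: cvg_cst.
  exact: uclamp_continuous.
have two t : ucoord (H (uclamp t, w)).2 = 0 \/ ucoord (H (uclamp t, w)).2 = 1.
  by case: (boundary_cases (H (uclamp t, w))) => [h|h|/nint//]; [left|right].
have := @segment_locally_constant R 0 1 (fun t => ucoord (H (uclamp t, w)).2 = y) ler01.
rewrite uclamp0 uclamp1 H0; case => [t _|+ _]; last by apply.
exists (ucoord (H (uclamp t, w)).2 = y).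
have : nbhs (ucoord (H (uclamp t, w)).2) (ball (ucoord (H (uclamp t, w)).2) (1 / 2)).
  by apply: nbhsx_ballx; lra.
move/(continuous_at_near (cP t)); apply: filterS => s st _.
have -> // : ucoord (H (uclamp s, w)).2 = ucoord (H (uclamp t, w)).2.
move: st; rewrite /ball /=; case: (two t) => ->; case: (two s) => -> //.
  by rewrite sub0r normrN normr1; lra.
by rewrite subr0 normr1; lra.
Qed.

Lemma isotopic_C0 u w : isotopic_to_id u -> @C0 R w -> @C0 R (u w).
Proof. by move=> iu; apply: isotopic_boundary iu; left. Qed.

Lemma isotopic_C1 u w : isotopic_to_id u -> @C1 R w -> @C1 R (u w).
Proof. by move=> iu; apply: isotopic_boundary iu; right. Qed.

End Boundary.

(** * Radial foliations *)

Section Leaves.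
Context (R : realType).
Local Notation S := (strip R).
Local Notation A := (annulus R).
Local Notation U := (unit_itv R).
Implicit Types (F : leaf_system R) (phi : set A) (z w : A) (s t : U).

Lemma leaf_eq F phi z : radial_foliation F -> F phi -> phi z -> leaf F z = phi.
Proof.
move=> [uniq _ _] Fphi phiz; have [psi [[Fpsi psiz] psi_uniq]] := uniq z.
have E chi : F chi /\ chi z -> chi = phi.
  by move=> H; rewrite -(psi_uniq _ H) -(psi_uniq phi).
rewrite eqEsubset; split=> [w [chi /= /E -> //]|w phiw].
by exists phi.
Qed.

Lemma leaf_in F z : radial_foliation F -> F (leaf F z) /\ leaf F z z.
Proof.
move=> rF; have [uniq _ _] := rF; have [psi [[Fpsi psiz] _]] := uniq z.
by rewrite (leaf_eq rF Fpsi psiz).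
Qed.

Lemma leaf_same F z w : radial_foliation F -> leaf F z w -> leaf F w = leaf F z.
Proof. by move=> rF zw; apply: leaf_eq zw => //; case: (leaf_in z rF). Qed.

Lemma leaf_param_exists F z : radial_foliation F ->
  exists2 g, leaf_param g (leaf F z) & exists s, g s = z.
Proof.
move=> rF; have [Fz zz] := leaf_in z rF; have [_ par _] := rF.
have [g gP] := par _ Fz; exists g => //; have [[_ _ gr] _ _ _] := gP.
by move: zz; rewrite -gr => -[s _ sz]; exists s.
Qed.

Lemma param_C0 g phi s : leaf_param g phi -> C0 (g s) <-> s = unit0 R.
Proof.
move=> [_ g0 g1 gi]; split=> [gs|->//]; apply: ucoord_inj; rewrite ucoord0.
have /andP[] := ucoord01 s; rewrite le_eqVlt => /orP[/eqP//|s0].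
rewrite le_eqVlt => /orP[/eqP s1|s1].
  by move: g1; rewrite /C1 /= (_ : unit1 R = s) ?gs ?[_ = 1]/= => [/eqP|];
    [rewrite eq_sym oner_eq0|exact: ucoord_inj].
by have := gi s; rewrite s0 s1 => /(_ isT); rewrite /int_annulus /= gs ltxx.
Qed.

Lemma param_C1 g phi s : leaf_param g phi -> C1 (g s) <-> s = unit1 R.
Proof.
move=> [_ g0 g1 gi]; split=> [gs|->//]; apply: ucoord_inj; rewrite ucoord1.
have /andP[+ s1] := ucoord01 s; rewrite le_eqVlt => /orP[/eqP s0|s0].
  by move: g0; rewrite /C0 /= (_ : unit0 R = s) ?gs => [/eqP|];
    [rewrite oner_eq0|exact: ucoord_inj].
move: s1; rewrite le_eqVlt => /orP[/eqP//|s1].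
by have := gi s; rewrite s0 s1 => /(_ isT); rewrite /int_annulus /= gs ltxx andbF.
Qed.

(** The change of parameter is continuous by compactness, injective, and fixes both ends, hence
    increasing. So [precedes] can be tested in any one parametrisation. *)
Lemma param_compare g g' phi s t s' t' :
  leaf_param g phi -> leaf_param g' phi -> g s = g' s' -> g t = g' t' ->
  ucoord s < ucoord t -> ucoord s' < ucoord t'.
Proof.
move=> gP gP'; have [[cg ig rg] g0 g1 _] := gP; have [[cg' ig' rg'] _ _ _] := gP'.
have ex r : exists r', g' r' = g r.
  have : phi (g r) by rewrite -rg; exists r.
  by rewrite -rg' => -[r' _ E]; exists r'.
have [sg sgP] := choice ex.
have csg : continuous sg.
  move=> r; apply: (@implicit_continuous U U A (fun p => g' p.2) g sg r).
  - exact: unit_compact.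
  - exact: annulus_separating.
  - by move=> z; apply: (@continuous_at_comp _ U A snd); [exact: cvg_snd|exact: cg'].
  - exact: cg.
  - by move=> z /= zr; apply: ig'; rewrite zr sgP.
  - by near=> p; exact: sgP.
have isg : injective sg by move=> r r' E; apply: ig; rewrite -!sgP E.
have sg0 : sg (unit0 R) = unit0 R by apply/(param_C0 _ gP'); rewrite sgP.
have sg1 : sg (unit1 R) = unit1 R by apply/(param_C1 _ gP'); rewrite sgP.
pose f x := ucoord (sg (uclamp x)).
have cf : continuous f.
  move=> x; apply: (@continuous_at_ucoord R R (fun x => sg (uclamp x))).
  by apply: (@continuous_at_comp R U U (@uclamp R) sg); [exact: uclamp_continuous|exact: csg].
have mono : {in `[0, 1] &, {mono f : x y / x <= y}}.
  apply: itv_continuous_inj_le.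
  - exists 0, 1; rewrite !in_itv /= !lexx ler01 ltr01 /f uclamp0 uclamp1 sg0 sg1.
    by split => //; exact: ler01.
  - exact: continuous_subspaceT.
  move=> x y; rewrite !in_itv /= => x01 y01 /ucoord_inj/isg/(congr1 (@ucoord R)).
  by rewrite !ucoord_uclamp !clamp_id.
move=> ss' tt' st.
have -> : s' = sg s by apply: ig'; rewrite sgP.
have -> : t' = sg t by apply: ig'; rewrite sgP.
have := mono (ucoord t) (ucoord s); rewrite /f !ucoordK !in_itv /= !ucoord01.
by move=> /(_ isT isT) E; rewrite ltNge E -ltNge.
Unshelve. all: by end_near. Qed.

Lemma precedes_param F phi g s t : radial_foliation F -> F phi ->
  leaf_param g phi -> precedes F (g s) (g t) <-> ucoord s < ucoord t.
Proof.
move=> rF Fphi gP; split=> [[psi [g' [s' [t' [Fpsi gP' ss' tt' st']]]]]|st].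
  have psiE : psi = phi.
    have [[_ _ rg'] _ _ _] := gP'; have [[_ _ rg] _ _ _] := gP.
    have psis : psi (g s) by rewrite -rg'; exists s'.
    have phis : phi (g s) by rewrite -rg; exists s.
    by rewrite -(leaf_eq rF Fpsi psis) -(leaf_eq rF Fphi phis).
  subst psi; exact: param_compare gP' gP ss' tt' st'.
by exists phi, g, s, t.
Qed.

(** Equality is included because the strict order along leaves is not closed. *)
Definition weakly_precedes F w z := w = z \/ precedes F w z.

Lemma weakly_precedes_param F phi g w t : radial_foliation F -> F phi ->
  leaf_param g phi ->
  weakly_precedes F w (g t) <-> exists2 s, w = g s & ucoord s <= ucoord t.
Proof.
move=> rF Fphi gP; have [[_ ig rg] _ _ _] := gP; split.
  case=> [->|wt]; first by exists t.
  have [psi [g' [s' [t' [Fpsi gP' ss' tt' st']]]]] := wt.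
  have [[_ _ rg'] _ _ _] := gP'.
  have psis : psi (g t) by rewrite -rg'; exists t'.
  have phis : phi (g t) by rewrite -rg; exists t.
  have : psi w by rewrite -rg'; exists s'.
  rewrite -(leaf_eq rF Fpsi psis) (leaf_eq rF Fphi phis) -rg => -[s _ sw].
  by exists s => //; apply/ltW/(precedes_param _ _ rF Fphi gP); rewrite sw.
move=> [s -> ]; rewrite le_eqVlt => /orP[/eqP/ucoord_inj ->|st]; first by left.
by right; apply/(precedes_param _ _ rF Fphi gP).
Qed.

Lemma weakly_precedes_trans F w z v : radial_foliation F ->
  weakly_precedes F w z -> weakly_precedes F z v -> weakly_precedes F w v.
Proof.
move=> rF; have [Fv _] := leaf_in v rF; have [g gP [t <-]] := leaf_param_exists v rF.
move=> wz /(weakly_precedes_param _ _ rF Fv gP) [s zs st].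
move: wz; rewrite zs => /(weakly_precedes_param _ _ rF Fv gP) [r -> rs].
by apply/(weakly_precedes_param _ _ rF Fv gP); exists r => //; exact: le_trans rs st.
Qed.

Lemma precedes_leaf F w z : radial_foliation F -> precedes F w z -> leaf F z w.
Proof.
move=> rF [psi [g [s [t [Fpsi [[_ _ rg] _ _ _] <- <- _]]]]].
by rewrite (leaf_eq rF Fpsi); rewrite -rg; [exists s|exists t].
Qed.

Lemma precedes_asym F w z : radial_foliation F -> precedes F w z -> ~ precedes F z w.
Proof.
move=> rF [psi [g [s [t [Fpsi gP <- <- st]]]]].
by move/(precedes_param _ _ rF Fpsi gP); rewrite ltNge ltW.
Qed.

Lemma precedes_irrefl F z : radial_foliation F -> ~ precedes F z z.
Proof. by move=> rF zz; exact: (precedes_asym rF zz zz). Qed.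

Lemma precedes_total F w z : radial_foliation F -> leaf F z w ->
  [\/ w = z, precedes F w z | precedes F z w].
Proof.
move=> rF zw; have [Fz _] := leaf_in z rF.
have [g gP [t tz]] := leaf_param_exists z rF; have [[_ _ rg] _ _ _] := gP.
move: zw; rewrite -rg => -[s _ sw]; rewrite -tz -sw.
have [st|st|/ucoord_inj ->] := ltgtP (ucoord s) (ucoord t).
- by apply: Or32; apply/(precedes_param _ _ rF Fz gP).
- by apply: Or33; apply/(precedes_param _ _ rF Fz gP).
by apply: Or31.
Qed.

Lemma continuous_at_within (T X Y : topologicalType) (V : set X) (f : T -> X)
    (h : X -> Y) (p : T) :
  {within V, continuous h} -> V (f p) -> {for p, continuous f} ->
  (\forall q \near p, V (f q)) -> {for p, continuous (fun q => h (f q))}.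
Proof.
move=> /subspace_continuousP ch Vp cf Vf B /(ch _ Vp) hB.
rewrite /= nbhs_simpl /=.
have : \forall x \near f p, V x -> B (h x) by exact: hB.
by move/(continuous_at_near cf); apply: filterS2 Vf => q Vq /(_ Vq).
Qed.

(* A point of a compact arc divides the other points into two relatively open
   parts. *)
Lemma arc_between (g : U -> A) (C : set A) s s0 s1 : continuous g -> injective g ->
  connected C -> C `<=` range g -> C (g s0) -> C (g s1) ->
  ucoord s0 < ucoord s < ucoord s1 -> C (g s).
Proof.
move=> cg ig cC Cg Cs0 Cs1 /andP[s0s ss1]; apply: contrapT => nCs.
have closed_part (B : set U) : closed B -> closed (g @` B).
  move=> clB; apply: compact_closed; first exact: annulus_hausdorff.
  apply: continuous_compact; first exact: continuous_subspaceT.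
  exact: (subclosed_compact clB (@unit_compact R)).
have closed_u (P : set R) : closed P -> closed (@ucoord R @^-1` P).
  by move=> clP; apply: preimage_closed clP => ? _; exact: ucoord_continuous.
pose below w := exists2 r, w = g r & ucoord r < ucoord s.
have b0 : below (g s0) by exists s0.
have b1 : ~ below (g s1) by move=> [r /ig <-]; rewrite ltNge ltW.
apply/b1/(@connected_locally_constant A C below (g s0) (g s1) cC Cs0 Cs1) => // w Cw.
have [r _ rw] := Cg w Cw; have [rs|sr|/ucoord_inj E] := ltgtP (ucoord r) (ucoord s).
- exists True; have : nbhs w (~` (g @` (@ucoord R @^-1` [set x | ucoord s <= x]))).
    apply: open_nbhs_nbhs; split.
      by apply: closed_openC; apply: closed_part; apply: closed_u; exact: closed_ge.
    by move=> [r' /= sr' /esym]; rewrite -rw => /ig E; move: rs; rewrite E ltNge sr'.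
  apply: filterS => v nv Cv; split=> // _; have [r' _ r'v] := Cg v Cv.
  exists r'; first by rewrite r'v.
  by rewrite ltNge; apply/negP => sr'; apply: nv; exists r'.
- exists False; have : nbhs w (~` (g @` (@ucoord R @^-1` [set x | x <= ucoord s]))).
    apply: open_nbhs_nbhs; split.
      by apply: closed_openC; apply: closed_part; apply: closed_u; exact: closed_le.
    by move=> [r' /= sr' /esym]; rewrite -rw => /ig E; move: sr; rewrite E ltNge sr'.
  apply: filterS => v nv Cv; split=> // -[r' vr' r's].
  by apply: nv; exists r' => //=; exact: ltW.
by case: nCs; rewrite -E rw.
Qed.

End Leaves.

(** * The order along leaves is closed *)

Section Charts.
Context (R : realType).
Local Notation S := (strip R).
Local Notation A := (annulus R).
Local Notation U := (unit_itv R).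

(** Closedness of the order restricted to pairs with given upper point [z]: in this form it can be
    propagated along the leaf of [z]. *)
Definition order_closed_at (F : leaf_system R) (z : A) := forall w,
  ~ weakly_precedes F w z ->
  \forall p \near ((w, z) : A * A), ~ weakly_precedes F p.1 p.2.

Section Chart.
Context (F : leaf_system R) (W : set A) (h : A -> R * R) (K : set R)
  (hi : R * R -> A).
Local Notation V := (`]-1 : R, 1[%classic `*` K).
Hypotheses (rF : radial_foliation F) (oW : open W)
  (KP : [\/ K = `]0 : R, 1[%classic, K = `[0 : R, 1[%classic
          | K = `]0 : R, 1]%classic])
  (ch : {within W, continuous h}) (chi : {within V, continuous hi})
  (hV : forall z, W z -> V (h z)) (hiW : forall v, V v -> W (hi v))
  (hK : forall z, W z -> hi (h z) = z) (hiK : forall v, V v -> h (hi v) = v)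
  (plaque : forall z, W z -> connected_component (leaf F z `&` W) z =
                       [set z' | W z' /\ (h z').1 = (h z).1])
  (ordered : forall z z', W z -> W z' -> (h z).1 = (h z').1 ->
        (h z).2 < (h z').2 -> precedes F z z').

Lemma chart_convex (y0 y y1 : R) : K y0 -> K y1 -> y0 <= y <= y1 -> K y.
Proof.
by case: KP => ->; rewrite /= !in_itv /= => /andP[h1 h2] /andP[h3 h4] /andP[h5 h6];
  apply/andP; split; lra.
Qed.

Lemma chart_min (y : R) : K y -> (forall y', K y' -> y <= y') ->
  y = 0 /\ forall y', K y' -> 0 <= y'.
Proof.
case: KP => ->; rewrite /= !in_itv /= => /andP[h1 h2] ymin.
(* In a model open at the bottom, [y / 2] is a lower height. *)
- have := ymin (y / 2); rewrite /= !in_itv /= => /(_ _) H.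
  by have := H; lra.
- split; last by move=> y'; rewrite /= in_itv /= => /andP[].
  by apply/eqP; rewrite eq_le h1 andbT; apply: ymin; rewrite /= in_itv /= lexx ltr01.
- have := ymin (y / 2); rewrite /= !in_itv /= => H.
  by have := H; lra.
Qed.

Lemma chart_continuous z : W z -> {for z, continuous h}.
Proof.
move=> Wz; apply: (continuous_at_within ch Wz (@continuous_at_id A z)).
exact: open_nbhs_nbhs.
Qed.

Lemma chart_inv_continuous (T : topologicalType) (f : T -> R * R) (p : T) :
  {for p, continuous f} -> V (f p) -> (\forall q \near p, V (f q)) ->
  {for p, continuous (fun q => hi (f q))}.
Proof. by move=> cf Vp Vf; exact: continuous_at_within chi Vp cf Vf. Qed.

Lemma chart_snd z : W z -> K (h z).2.
Proof. by move/hV => []. Qed.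

Lemma chart_inj z z' : W z -> W z' -> h z = h z' -> z = z'.
Proof. by move=> Wz Wz' E; rewrite -(hK Wz) -(hK Wz') E. Qed.

Lemma plaque_leaf z z' : W z -> W z' -> (h z').1 = (h z).1 -> leaf F z z'.
Proof.
move=> Wz Wz' E.
have : connected_component (leaf F z `&` W) z z' by rewrite plaque.
by move/connected_component_sub => [].
Qed.

Lemma chart_weakly_precedes z z' : W z -> W z' -> (h z).1 = (h z').1 ->
  (h z).2 <= (h z').2 -> weakly_precedes F z z'.
Proof.
move=> Wz Wz' E1; rewrite le_eqVlt => /orP[/eqP E2|lt]; last by right; exact: ordered.
left; apply: chart_inj => //; rewrite [LHS]surjective_pairing [RHS]surjective_pairing.
by rewrite E1 E2.
Qed.

Lemma chart_precedes_snd z z' : W z -> W z' -> (h z).1 = (h z').1 ->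
  weakly_precedes F z z' -> (h z).2 <= (h z').2.
Proof.
move=> Wz Wz' E1 [->//|zz']; rewrite leNgt; apply/negP => lt.
exact: (precedes_asym rF zz' (ordered Wz' Wz (esym E1) lt)).
Qed.

(** A short piece of leaf is connected and stays in [W], so it stays in one plaque. *)
Lemma near_plaque phi g (t : R) : F phi -> leaf_param g phi -> W (g (uclamp t)) ->
  exists2 e, 0 < e & forall u, t - e < u < t + e ->
    W (g (uclamp u)) /\ (h (g (uclamp u))).1 = (h (g (uclamp t))).1.
Proof.
move=> Fphi gP Wt; have [[cg ig rg] _ _ _] := gP.
have cgu : continuous (fun u => g (uclamp u)).
  by move=> u; apply: (@continuous_at_comp R U A (@uclamp R) g);
    [exact: uclamp_continuous|exact: cg].
have [e /= e0 eW] : \forall u \near t, W (g (uclamp u)).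
  by apply: (continuous_at_near (cgu t)); exact: open_nbhs_nbhs.
exists e => // u /andP[u1 u2].
have eW' v : t - e < v < t + e -> W (g (uclamp v)).
  move=> /andP[v1 v2]; apply: eW; rewrite /= ltr_norml; apply/andP; split; lra.
split; first by apply: eW'; rewrite u1.
pose C := (fun v => g (uclamp v)) @` `[Num.min t u, Num.max t u]%classic.
have Ct : C (g (uclamp t)).
  by exists t => //; rewrite /= in_itv /= ge_min le_max lexx.
have Cu : C (g (uclamp u)).
  by exists u => //; rewrite /= in_itv /= ge_min le_max lexx !orbT.
have phit : phi (g (uclamp t)) by rewrite -rg; exists (uclamp t).
have : connected_component (leaf F (g (uclamp t)) `&` W) (g (uclamp t)) (g (uclamp u)).
  exists C => //; split => //.
    move=> _ [v + <-]; rewrite /= in_itv /= => /andP[v1 v2].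
    split; first by rewrite (leaf_eq rF Fphi phit) -rg; exists (uclamp v).
    apply: eW'; apply/andP; split.
      by apply: lt_le_trans v1; rewrite lt_min u1 andbT; lra.
    by apply: le_lt_trans v2 _; rewrite gt_max u2 andbT; lra.
  apply: connected_continuous_connected; first exact: segment_connected.
  exact: continuous_subspaceT.
by rewrite plaque // => -[].
Qed.

(** A point of [C0] comes first on its leaf, while a lower point of its plaque would precede it; so
    its height is least in the model. *)
Lemma chart_bottom z : W z -> C0 z -> (h z).2 = 0 /\ forall y, K y -> 0 <= y.
Proof.
move=> Wz z0; have [E Kmin] : (h z).2 = 0 /\ forall y, K y -> 0 <= y.
  apply: chart_min; first exact: chart_snd.
  move=> y Ky; rewrite leNgt; apply/negP => yz.
  have Vy : V ((h z).1, y) by split => //; have [] := hV Wz.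
  have := @ordered (hi ((h z).1, y)) z (hiW Vy) Wz.
  rewrite hiK //= => /(_ erefl yz) pz.
  have [Fz _] := leaf_in z rF; have [g gP [t tz]] := leaf_param_exists z rF.
  have t0 : t = unit0 R by apply/(param_C0 _ gP); rewrite tz.
  have := precedes_leaf rF pz; have [[_ _ rg] _ _ _] := gP; rewrite -rg => -[s _ sE].
  move: pz; rewrite -sE -tz => /(precedes_param _ _ rF Fz gP).
  by rewrite t0 ucoord0 ltNge; have /andP[->] := ucoord01 s.
by split.
Qed.

(** Otherwise the leaf would have points just before [z] in the same plaque; having height at least
    0, they would also come after [z]. *)
Lemma chart_zero z : W z -> (forall y, K y -> 0 <= y) -> (h z).2 = 0 -> C0 z.
Proof.
move=> Wz K0 hz.
have [Fz _] := leaf_in z rF; have [g gP [t tz]] := leaf_param_exists z rF.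
have [[_ ig _] _ _ _] := gP.
rewrite -tz; apply/(param_C0 _ gP)/ucoord_inj; rewrite ucoord0; apply/eqP.
have /andP[t0 t1] := ucoord01 t; rewrite eq_le t0 andbT leNgt; apply/negP => {}t0.
have Wt : W (g (uclamp (ucoord t))) by rewrite ucoordK tz.
have [e e0 eP] := near_plaque Fz gP Wt.
pose u := Num.max 0 (ucoord t - e / 2).
have ut : ucoord t - e < u < ucoord t + e.
  by rewrite /u lt_max gt_max; apply/andP; split; [apply/orP; right|apply/andP; split]; lra.
have ut' : u < ucoord t by rewrite /u gt_max t0 /=; lra.
have u01 : 0 <= u <= 1.
  by rewrite {1}/u le_max lexx /=; exact: le_trans (ltW ut') t1.
have [Wu] := eP u ut; rewrite ucoordK tz => E1.
have : weakly_precedes F z (g (uclamp u)).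
  by apply: chart_weakly_precedes => //; rewrite hz; apply/K0/chart_snd.
move/(weakly_precedes_param _ _ rF Fz gP) => [s]; rewrite -tz => /ig <-.
by rewrite ucoord_uclamp clamp_id // leNgt ut'.
Qed.

(** The piece of plaque from height [y0], at time 0, to [p.2], at time 1. It depends continuously on
    its end [p.2], which compares a leaf with nearby ones. *)
Definition plaque_point (y0 : R) (p : R * A) : A :=
  hi ((h p.2).1, y0 + clamp p.1 * ((h p.2).2 - y0)).

Lemma plaque_point_in y0 z r : K y0 -> W z ->
  V ((h z).1, y0 + clamp r * ((h z).2 - y0)).
Proof.
move=> K0 Wz; have [hz1 hz2] := hV Wz; split => //=.
have /andP[] := clamp01 r; move: (clamp r) (h z).2 hz2 => c y Ky c0 c1.
have [y0y|yy0] := leP y0 y.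
  apply: (chart_convex K0 Ky); apply/andP; split.
    by rewrite lerDl mulr_ge0 // subr_ge0.
  by rewrite -lerBrDl -[leRHS]mul1r ler_wpM2r // subr_ge0.
apply: (chart_convex Ky K0); apply/andP; split.
  have -> : c * (y - y0) = - (c * (y0 - y)) by ring.
  have : c * (y0 - y) <= y0 - y by rewrite -[leRHS]mul1r ler_wpM2r // subr_ge0 ltW.
  by move: (c * _) => d; lra.
by rewrite gerDl mulr_ge0_le0 // subr_le0 ltW.
Qed.

Lemma plaque_point_h y0 z r : K y0 -> W z ->
  W (plaque_point y0 (r, z)) /\
  h (plaque_point y0 (r, z)) = ((h z).1, y0 + clamp r * ((h z).2 - y0)).
Proof.
move=> K0 Wz; have Vz := plaque_point_in r K0 Wz.
by rewrite /plaque_point /= hiK //; split => //; exact: hiW.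
Qed.

Lemma plaque_point1 y0 z : K y0 -> W z -> plaque_point y0 (1, z) = z.
Proof.
move=> K0 Wz; rewrite /plaque_point /= clamp_ge1 // mul1r addrC subrK.
by rewrite -surjective_pairing hK.
Qed.

Lemma plaque_point_continuous y0 r z : K y0 -> W z ->
  {for (r, z), continuous (plaque_point y0)}.
Proof.
move=> K0 Wz.
have c2 : {for (r, z), continuous (fun q : R * A => h q.2)}.
  by apply: (@continuous_at_comp _ A _ snd h); [exact: cvg_snd|exact: chart_continuous].
apply: (@chart_inv_continuous _
  (fun q : R * A => ((h q.2).1, y0 + clamp q.1 * ((h q.2).2 - y0)))).
- apply: continuous_at_pair; first exact: continuous_at_fst.
  apply: continuous_at_add; first exact: cvg_cst.
  apply: continuous_at_mul; first by apply: continuous_at_clamp; exact: cvg_fst.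
  apply: continuous_at_sub; last exact: cvg_cst.
  exact: continuous_at_snd.
- exact: plaque_point_in.
have : \forall q \near ((r, z) : R * A), W q.2.
  by apply: (@continuous_at_near _ A snd); [exact: cvg_snd|exact: open_nbhs_nbhs].
by apply: filterS => q Wq; exact: plaque_point_in.
Qed.

(* Inside a chart, a segment that ends at height [y] is a segment that ends at the
   height of [p] followed by a piece of plaque, and plaques vary continuously. *)
Lemma chart_up p p1 : W p -> W p1 -> (h p).1 = (h p1).1 -> (h p).2 <= (h p1).2 ->
  order_closed_at F p \/ ((h p).2 = 0 /\ forall y, K y -> 0 <= y) ->
  order_closed_at F p1.
Proof.
move=> Wp Wp1 E1 le12 H w nw; pose y0 := (h p).2; have K0 : K y0 by exact: chart_snd.
pose Fn := plaque_point y0.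
(* [w] is off the piece of plaque that ends at [p1]; by compactness nearby points are off nearby
   pieces. *)
have S1 : \forall q \near ((w, p1) : A * A), forall r, 0 <= r <= 1 -> q.1 <> Fn (r, q.2).
  have cover : \forall q \near ((w, p1) : A * A),
      `[0, 1]%classic `<=` (fun r => q.1 <> Fn (r, q.2)).
    have /compact_near_coveringP near_cover := @segment_compact R 0 1.
    apply: (near_cover _ (nbhs ((w, p1) : A * A)) (fun q r => q.1 <> Fn (r, q.2))) => r _.
    have wF : w <> Fn (r, p1).
      move=> wE; apply: nw; have [Wf hf] := @plaque_point_h y0 p1 r K0 Wp1.
      rewrite wE; apply: chart_weakly_precedes => //; rewrite ?hf //=.
      have /andP[c0 c1] := clamp01 r.
      by rewrite -lerBrDl -[leRHS]mul1r ler_wpM2r // subr_ge0.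
    have [[B1 B2] /= [wB1 FB2] B12] := @annulus_separating R _ _ wF.
    have c1 : {for (r, (w, p1)), continuous (fun q : R * (A * A) => q.2.1)}.
      by apply: (@continuous_at_fst _ A A snd); exact: cvg_snd.
    have c2 : {for (r, (w, p1)), continuous (fun q : R * (A * A) => Fn (q.1, q.2.2))}.
      apply: (@continuous_at_comp _ (R * A)%type A (fun q : R * (A * A) => (q.1, q.2.2))).
        apply: continuous_at_pair; first exact: cvg_fst.
        by apply: (@continuous_at_snd _ A A snd); exact: cvg_snd.
      exact: plaque_point_continuous.
    suff : \forall q \near ((r, (w, p1)) : R * (A * A)), q.2.1 <> Fn (q.1, q.2.2) by [].
    apply: filterS2 (continuous_at_near c1 wB1) (continuous_at_near c2 FB2).
    by move=> q q1 q2 qE; exact: (B12 (q.2.1, Fn (q.1, q.2.2))).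
  apply: filterS cover => q qP r r01; apply: qP.
  by rewrite /= in_itv.
(* The foot of the piece tends to [p], where closedness is assumed; it remains a premise because
   nothing is assumed when [p] is at the bottom of a half-open model. *)
have S2 : \forall q \near ((w, p1) : A * A), order_closed_at F p ->
    ~ weakly_precedes F q.1 (Fn (0, q.2)).
  have [op|nop] := pselect (order_closed_at F p); last by near=> q.
  have Fp : Fn (0, p1) = p.
    by rewrite /Fn /plaque_point /= clamp_le0 // mul0r addr0 -E1 -surjective_pairing hK.
  have c2 : {for (w, p1), continuous (fun q : A * A => (q.1, Fn (0, q.2)))}.
    apply: continuous_at_pair; first exact: cvg_fst.
    apply: (@continuous_at_comp _ (R * A)%type A (fun q : A * A => (0, q.2))).
      by apply: continuous_at_pair; [exact: cvg_cst|exact: cvg_snd].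
    exact: plaque_point_continuous.
  have : \forall q \near ((w, Fn (0, p1)) : A * A), ~ weakly_precedes F q.1 q.2.
    rewrite Fp; apply: op => wp; apply: nw; apply: weakly_precedes_trans wp _ => //.
    exact: chart_weakly_precedes.
  by move/(continuous_at_near c2); apply: filterS.
have S3 : \forall q \near ((w, p1) : A * A), W q.2.
  by apply: (@continuous_at_near _ A snd); [exact: cvg_snd|exact: open_nbhs_nbhs].
apply: filterS3 S1 S2 S3 => -[w' z'] /= nF nq Wz' wz'.
have [Wq hq] := @plaque_point_h y0 z' 0 K0 Wz'; rewrite -/Fn in Wq hq.
rewrite clamp_le0 // mul0r addr0 in hq; set q := Fn (0, z') in Wq hq nq.
(* If [z'] is below the foot [q], whatever precedes [z'] precedes [q]; at the bottom of a half-open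
   model this cannot occur. *)
have [y0z|zy0] := leP y0 (h z').2; last first.
  case: H => [/nq|[hp K00]].
    apply; apply: weakly_precedes_trans wz' _ => //.
    by apply: chart_weakly_precedes => //; rewrite hq //= ltW.
  by move: zy0; rewrite /y0 hp ltNge K00 //; exact: chart_snd.
have qz : weakly_precedes F q z' by apply: chart_weakly_precedes => //; rewrite hq.
have [Fz _] := leaf_in z' rF; have [g gP [t tz]] := leaf_param_exists z' rF.
have [[cg ig rg] _ _ _] := gP.
move: qz wz'; rewrite -tz => /(weakly_precedes_param _ _ rF Fz gP) [s0 qs0 s0t].
move=> /(weakly_precedes_param _ _ rF Fz gP) [s ws st].
(* A point before [z'] comes either before the foot, or after it and then lies on the piece of
   plaque. If the foot is in [C0], only the foot itself weakly precedes it. *)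
have [ss0|s0s] := leP (ucoord s) (ucoord s0).
  case: H => [/nq|[hp K00]].
    apply; rewrite qs0; apply/(weakly_precedes_param _ _ rF Fz gP).
    by exists s.
  have : C0 q by apply: chart_zero => //; rewrite hq.
  rewrite qs0 => /(param_C0 _ gP) s0E; apply: (nF 0); first by rewrite lexx ler01.
  rewrite -/q qs0 ws; congr g; apply: ucoord_inj; apply/eqP; rewrite eq_le ss0 s0E.
  by rewrite ucoord0; case/andP: (ucoord01 s).
have : ((fun r => Fn (r, z')) @` `[0, 1]%classic) (g s).
  move: st; rewrite le_eqVlt => /orP[/eqP/ucoord_inj ->|st].
    exists 1; first by rewrite /= in_itv /= ler01 lexx.
    by rewrite /Fn plaque_point1 // tz.
  apply: (@arc_between _ g _ s s0 t) => //; last by rewrite s0s.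
  - apply: connected_continuous_connected; first exact: segment_connected.
    apply: continuous_subspaceT => r.
    apply: (@continuous_at_comp R (R * A)%type A (fun r => (r, z')));
      first exact: continuous_at_pairl.
    exact: plaque_point_continuous.
  - move=> _ [r _ <-]; rewrite rg.
    have [Wr hr] := @plaque_point_h y0 z' r K0 Wz'.
    by apply: plaque_leaf => //; rewrite hr.
  - by exists 0; [rewrite /= in_itv /= ler01 lexx|rewrite -/q qs0].
  - exists 1; first by rewrite /= in_itv /= ler01 lexx.
    by rewrite /Fn plaque_point1 // tz.
case=> r; rewrite /= in_itv /= => r01 rE.
by apply: (nF r r01); rewrite ws rE.
Unshelve. all: by end_near. Qed.

End Chart.

(** The leaf is climbed chart by chart, from its end on [C0] up to [z]. *)
Lemma order_closed F z : radial_foliation F -> order_closed_at F z.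
Proof.
move=> rF; have [_ _ charts] := rF.
have [Fz _] := leaf_in z rF; have [g gP [t tz]] := leaf_param_exists z rF.
have [_ g0 _ _] := gP.
have /andP[t0 t1] := ucoord01 t.
rewrite -tz -(ucoordK t).
apply: (@segment_up_induction R 0 (ucoord t) (fun u => order_closed_at F (g (uclamp u)))) => //.
  have [W [h [oW Ww [[K KP [hi [[ch chi] hV hiW hK hiK]]] pl od]]]] := charts (g (uclamp 0)).
  rewrite uclamp0 in Ww *.
  apply: (chart_up rF oW KP ch chi hV hiW hK hiK pl od Ww Ww) => //.
  right; apply: (chart_bottom rF KP hV hiW hiK od Ww g0).
move=> s s0t; have [W [h [oW Ww [[K KP [hi [[ch chi] hV hiW hK hiK]]] pl od]]]] := charts (g
  (uclamp s)).
have [e e0 eP] := near_plaque rF oW pl Fz gP Ww; exists e => //.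
move=> v u sv vu us v0 ut cv.
have [|Wv hv] := eP v; first by rewrite sv; exact: le_lt_trans vu us.
have [|Wu hu] := eP u; first by rewrite us andbT; exact: lt_le_trans sv vu.
have E : (h (g (uclamp v))).1 = (h (g (uclamp u))).1 by rewrite hv hu.
apply: (chart_up rF oW KP ch chi hV hiW hK hiK pl od Wv Wu E); last by left.
apply: (chart_precedes_snd rF od Wv Wu E).
apply/(weakly_precedes_param _ _ rF Fz gP); exists (uclamp v) => //.
rewrite !ucoord_uclamp !clamp_id //; apply/andP; split => //.
- exact: le_trans v0 vu.
- exact: le_trans ut t1.
- exact: le_trans vu (le_trans ut t1).
Qed.

End Charts.

(** * A real coordinate on the space of lifted leaves *)

Section LeafCoordinate.
Context (R : realType).
Local Notation S := (strip R).
Local Notation A := (annulus R).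
Local Notation U := (unit_itv R).

Lemma C0_closed : closed (@C0 R).
Proof.
have -> : @C0 R = (fun z : A => ucoord z.2) @^-1` [set 0].
  by rewrite eqEsubset; split.
apply: preimage_closed (@closed_eq R 0) => z _.
by apply: (@continuous_at_ucoord R A snd); exact: cvg_snd.
Qed.

Lemma C0_leaf_unique F (z w : A) : radial_foliation F -> leaf F z w ->
  @C0 R z -> @C0 R w -> z = w.
Proof.
move=> rF + z0 w0; have [g gP [t tz]] := leaf_param_exists z rF.
have [[_ _ rg] _ _ _] := gP; rewrite -rg => -[s _ sw].
have tE : t = unit0 R by apply/(param_C0 t gP); rewrite tz.
have sE : s = unit0 R by apply/(param_C0 s gP); rewrite sw.
by rewrite -tz -sw tE sE.
Qed.

(** The bottom of [z] is the only point of [C0] that weakly precedes [z]. This is a closed condition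
    on a compact space with a unique solution, so the solution is continuous in [z]. *)
Lemma bottom_exists F : radial_foliation F -> exists bot : A -> A,
  [/\ continuous bot, forall z, @C0 R (bot z) & forall z, leaf F z (bot z)].
Proof.
move=> rF.
have ex z : exists w, @C0 R w /\ weakly_precedes F w z.
  have [Fz _] := leaf_in z rF; have [g gP [t tz]] := leaf_param_exists z rF.
  have [_ g0 _ _] := gP; exists (g (unit0 R)); split => //.
  rewrite -tz; apply/(weakly_precedes_param _ _ rF Fz gP); exists (unit0 R) => //.
  by rewrite ucoord0; case/andP: (ucoord01 t).
have [bot botP] := choice ex; exists bot.
have bot_leaf z : leaf F z (bot z).
  have [_ [->|/(precedes_leaf rF)//]] := botP z.
  by case: (leaf_in z rF).
split=> [z0|z|//]; last by case: (botP z).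
move=> B Bz0.
have cover : \forall z \near z0,
    [set: A] `<=` (fun w => @C0 R w -> weakly_precedes F w z -> B w).
  have /compact_near_coveringP near_cover := @annulus_compact R.
  apply: (near_cover _ (nbhs z0) (fun z w => @C0 R w -> weakly_precedes F w z -> B w)) => w _.
  have [w0|nw0] := pselect (@C0 R w); last first.
    have : \forall v \near w, ~ @C0 R v.
      by apply: open_nbhs_nbhs; split => //; exact/closed_openC/C0_closed.
    move=> nw; exists (fun v => ~ @C0 R v, setT); first by split => //; exact: filterT.
    by move=> [v z] /= [].
  have [wz|nwz] := pselect (weakly_precedes F w z0); last first.
    have [[B1 B2] /= [wB1 zB2] B12] := order_closed rF nwz.
    exists (B1, B2) => // -[v z] /= [v1 z2] _ vz.
    by case: (B12 (v, z)); [split|].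
  have -> : w = bot z0.
    apply: (C0_leaf_unique rF _ w0); last by case: (botP z0).
    have zw : leaf F z0 w.
      case: wz => [->|/(precedes_leaf rF)//]; by case: (leaf_in z0 rF).
    by rewrite (leaf_same rF zw).
  exists (B, setT); first by split => //; exact: filterT.
  by move=> [v z] /= [].
rewrite /= nbhs_simpl /=; apply: filterS cover => z; apply => //.
  by case: (botP z).
by case: (botP z).
Qed.

(** A lift to the reals of the projection of the annulus to its space of leaves, a circle; the level
    sets of [a] are the lifted leaves. *)
Definition leaf_coord (F : leaf_system R) (a : S -> R) : Prop :=
  [/\ continuous a, forall n z, a (deck n z) = a z + n%:~R &
      forall z z', leaf F (cov z) (cov z') <-> eqmod1 (a z) (a z')].

Definition lower (p : S * R) : S := (p.1.1, uclamp (clamp p.2 * ucoord p.1.2)).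

Lemma lower_continuous : continuous lower.
Proof.
move=> p; have h1 : {for p, continuous (fun q : S * R => q.2)} by exact: cvg_snd.
have h2 : {for p, continuous (fun q : S * R => q.1)} by exact: cvg_fst.
apply: (@continuous_at_pair (S * R)%type R U
  (fun p => p.1.1) (fun p => uclamp (clamp p.2 * ucoord p.1.2))).
  exact: (continuous_at_fst h2).
apply: continuous_at_uclamp; apply: continuous_at_mul; first exact: continuous_at_clamp.
by apply: continuous_at_ucoord; exact: (continuous_at_snd h2).
Qed.

Lemma lower_le0 z t : t <= 0 -> lower (z, t) = (z.1, unit0 R).
Proof. by move=> t0; rewrite /lower /= clamp_le0 // mul0r uclamp0. Qed.

Lemma lower_ge1 z t : 1 <= t -> lower (z, t) = z.
Proof. by move=> t1; rewrite /lower /= clamp_ge1 // mul1r ucoordK -surjective_pairing. Qed.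

(** On the bottom line the projection along leaves is the identity and lifts to [fst]; the lift is
    extended along vertical segments. *)
Lemma leaf_coord_exists F : radial_foliation F -> exists a, leaf_coord F a.
Proof.
move=> rF; have [bot [cbot bot0 botl]] := bottom_exists rF.
pose b (p : S * R) := (bot (cov (lower p))).1.
have cb : continuous b.
  move=> p; apply: (@continuous_at_fst _ (circle R) U (fun p => bot (cov (lower p)))).
  apply: (@continuous_at_comp _ A A (fun p => cov (lower p))); last exact: cbot.
  by apply: continuous_at_cov; exact: lower_continuous.
have bot_id w : @C0 R w -> bot w = w.
  move=> w0; apply/esym/(C0_leaf_unique rF _ w0) => //.
have [|||||L [cL L0 Lb]] := @circle_lift_exists R S b fst.
- by move=> z t t0; rewrite /b !lower_le0.
- by move=> z t t0; rewrite /b !lower_ge1.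
- exact: cb.
- by move=> z; exact: cvg_fst.
- by move=> z; rewrite /b lower_le0 // bot_id.
have cLz : continuous (fun z => L (z, 1)).
  move=> z; apply: (@continuous_at_comp _ (S * R)%type R (fun z => (z, 1))); last exact: cL.
  exact: continuous_at_pairl.
have cLt z : continuous (fun t => L (z, t)).
  move=> t; apply: (@continuous_at_comp _ (S * R)%type R (fun t => (z, t))); last exact: cL.
  exact: continuous_at_pairr.
exists (fun z => L (z, 1)); split=> // [n z|z z'].
  apply: (@real_segment_unique R (fun t => L (deck n z, t)) (fun t => L (z, t) + n%:~R) 0).
    move=> t _; split; first exact: cLt.
      by apply: continuous_at_add; [exact: cLt|exact: cvg_cst].
    near=> u; have /picircleP [m E] : picircle (L (deck n z, u)) = picircle (L (z, u)).
      by rewrite !Lb /b /lower /= -[X in cov X]/(deck n (lower (z, u))) cov_deck.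
    by exists (m + n); rewrite E intrD; ring.
  by rewrite !L0.
have bE w : picircle (L (w, 1)) = (bot (cov w)).1 by rewrite Lb /b lower_ge1.
have bot2 w : (bot w).2 = unit0 R by apply: ucoord_inj; rewrite ucoord0; exact: bot0.
rewrite /eqmod1 -picircleP !bE; split=> [zz'|E].
  congr (_.1); apply: (C0_leaf_unique rF) => //.
  have -> // : leaf F (bot (cov z)) = leaf F (cov z')
    by rewrite (leaf_same rF (botl _)) (leaf_same rF zz').
have {}E : bot (cov z) = bot (cov z').
  by rewrite [LHS]surjective_pairing [RHS]surjective_pairing E !bot2.
rewrite -(leaf_same rF (botl (cov z))) E (leaf_same rF (botl (cov z'))).
by case: (leaf_in (cov z') rF).
Unshelve. all: by end_near. Qed.

End LeafCoordinate.

(** * Lifted leaves and angles in terms of the leaf coordinate *)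

Section LeafCoordinateTheory.
Context (R : realType) (F : leaf_system R) (a : strip R -> R).
Local Notation S := (strip R).
Local Notation A := (annulus R).
Local Notation U := (unit_itv R).
Hypotheses (rF : radial_foliation F) (aF : leaf_coord F a).

Lemma coord_continuous : continuous a. Proof. by case: aF. Qed.

Lemma coord_deck n z : a (deck n z) = a z + n%:~R. Proof. by case: aF. Qed.

Lemma coord_leaf z z' : leaf F (cov z) (cov z') <-> eqmod1 (a z) (a z').
Proof. by case: aF. Qed.

Lemma coord_cov_inj z z' : cov z = cov z' -> a z = a z' -> z = z'.
Proof.
move=> /cov_eqP [n ->]; rewrite coord_deck => /eqP.
rewrite -subr_eq0 opprD addNKr oppr_eq0 intr_eq0 => /eqP ->.
by rewrite deck0.
Qed.

Lemma coord_int_const (f : R -> S) (w : A) : continuous f ->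
  (forall t, leaf F w (cov (f t))) -> forall s t, a (f s) = a (f t).
Proof.
move=> cf fw s t.
apply/esym/(@real_segment_unique R (fun u => a (f u)) (fun=> a (f s)) s) => // u _.
split; last 2 first.
- exact: cvg_cst.
- near=> v; apply/coord_leaf; rewrite (leaf_same rF (fw v)); exact: fw.
by apply: (@continuous_at_comp R S R f a); [exact: cf|exact: coord_continuous].
Unshelve. all: by end_near. Qed.

Lemma leaf_lift (z : S) : exists g : U -> S,
  [/\ continuous g, leaf_param (@cov R \o g) (leaf F (cov z)) &
      range g = [set w | a w = a z]].
Proof.
have [g gP [s0 gs0]] := leaf_param_exists (cov z) rF.
have [[cg ig rg] g0 g1 gi] := gP.
pose b (p : U * R) := (g (uclamp p.2)).1.
have cb : continuous b.
  move=> p; apply: (@continuous_at_fst _ (circle R) U (fun p : U * R => g (uclamp p.2))).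
  apply: (@continuous_at_comp _ U A (fun p : U * R => uclamp p.2)); last exact: cg.
  by apply: continuous_at_uclamp; exact: cvg_snd.
have [|||||L [cL L0 Lc]] := @circle_lift_exists R U b (fun=> circle_rep (g (unit0 R)).1).
- move=> x t t0; rewrite /b /= (_ : uclamp t = uclamp 0) //.
  by apply: ucoord_inj; rewrite !ucoord_uclamp !clamp_le0.
- move=> x t t0; rewrite /b /= (_ : uclamp t = uclamp 1) //.
  by apply: ucoord_inj; rewrite !ucoord_uclamp !clamp_ge1.
- exact: cb.
- exact: (@cst_continuous U R).
- by move=> x; rewrite circle_repK /b /= uclamp0.
pose l (t : R) : S := (L (unit0 R, t), (g (uclamp t)).2).
have cl : continuous l.
  move=> t; apply: (@continuous_at_pair R R U (fun t => L (unit0 R,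
    t)) (fun t => (g (uclamp t)).2)).
    by apply: slice_continuous; exact: cL.
  apply: (@continuous_at_snd R (circle R) U (fun t => g (uclamp t))).
  by apply: (@continuous_at_comp R U A (@uclamp R) g); [exact: uclamp_continuous|exact: cg].
have lcov t : cov (l t) = g (uclamp t).
  by rewrite covE /= Lc [RHS]surjective_pairing.
have lleaf t : leaf F (cov z) (cov (l t)) by rewrite lcov -rg; exists (uclamp t).
(* The lifted path may run along a translate of the wanted leaf; [deck n] brings it to the level of
   [z]. *)
have [n nE] : eqmod1 (a (l 0)) (a z).
  apply/coord_leaf; rewrite (leaf_same rF (lleaf 0)).
  by case: (leaf_in (cov z) rF).
pose g' (s : U) := deck n (l (ucoord s)).
have ag' s : a (g' s) = a z.
  by rewrite coord_deck (coord_int_const cl lleaf _ 0) nE.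
have covg' s : cov (g' s) = g s by rewrite cov_deck lcov ucoordK.
exists g'; split.
- move=> s; apply: (@continuous_at_comp U S S (fun s => l (ucoord s)) (deck n));
    last exact: deck_continuous.
  by apply: (@continuous_at_comp U R S (@ucoord R) l); [exact: ucoord_continuous|exact: cl].
- by have -> : @cov R \o g' = g by apply/funext => s; exact: covg'.
rewrite eqEsubset; split => [_ [s _ <-]|w /= wz]; first exact: ag'.
have : leaf F (cov z) (cov w) by apply/coord_leaf; exists 0; rewrite addr0.
rewrite -rg => -[s _ sw]; exists s => //; apply: coord_cov_inj; first by rewrite covg'.
by rewrite ag'.
Qed.

Lemma level_connected x z : a z = x -> connected [set w | a w = x].
Proof.
move=> <-; have [g [cg _ <-]] := leaf_lift z.
have -> : [set: U] = @uclamp R @` `[0, 1]%classic.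
  rewrite eqEsubset; split => // s _; exists (ucoord s); last exact: ucoordK.
  by rewrite /= in_itv /= ucoord01.
apply: connected_continuous_connected; last exact: (continuous_subspaceT cg).
apply: connected_continuous_connected; first exact: segment_connected.
exact/continuous_subspaceT/uclamp_continuous.
Qed.

Lemma connected_coord_const (C : set S) z w : connected C ->
  C `<=` @cov R @^-1` leaf F (cov z) -> C z -> C w -> a w = a z.
Proof.
move=> cC CF Cz Cw.
apply/(@connected_locally_constant S C (fun v => a v = a z) w z cC Cw Cz) => // t Ct.
exists (a t = a z).
have : nbhs (a t) (ball (a t) (1 / 2)) by apply: nbhsx_ballx; lra.
move/(continuous_at_near (@coord_continuous t)); apply: filterS => u tu Cu.
suff -> : a u = a t by [].
have [n nE] : eqmod1 (a t) (a u).
  by apply/coord_leaf; rewrite (leaf_same rF (CF t Ct)); exact: CF.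
move: tu; rewrite /ball /= nE opprD addNKr normrN -intr_norm => n1.
suff -> : n = 0 by rewrite addr0.
have : `|n|%:~R < 1%:~R :> R by rewrite mulr1z; lra.
by rewrite ltr_int => ?; lia.
Qed.

Lemma lifted_leafE z : lifted_leaf F z = [set w | a w = a z].
Proof.
rewrite eqEsubset; split => w /=.
  by move=> [C [Cz CF cC] Cw]; exact: (connected_coord_const cC CF).
move=> wz; exists [set w | a w = a z] => //; split => //.
  by move=> v /= vz; apply/coord_leaf; exists 0; rewrite addr0.
exact: level_connected (erefl (a z)).
Qed.

Lemma coord_bottom_inj (x y : R) : a (x, unit0 R) = a (y, unit0 R) -> x = y.
Proof.
move=> xy; suff: (x, unit0 R) = (y, unit0 R) :> S by case.
apply: coord_cov_inj => //; apply: (C0_leaf_unique rF) => //.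
by apply/coord_leaf; exists 0; rewrite addr0.
Qed.

(** A continuous injective function on the line is monotone; this one increases because it grows by
    1 under [deck 1]. *)
Lemma coord_horizontal_mono (u : U) :
  (forall x y, a (x, u) = a (y, u) -> x = y) ->
  forall x y, (a (x, u) <= a (y, u)) = (x <= y).
Proof.
move=> inj x y.
have := @itv_continuous_inj_le R (fun x => a (x, u)) `]-oo, +oo[.
move=> /(_ _ _ _ x y); apply; rewrite ?in_itv //.
- exists 0, 1; rewrite !in_itv ltr01; split => //.
  have -> : (1, u) = deck 1 (0, u) by rewrite /deck /= add0r.
  by rewrite coord_deck lerDl ler01.
- apply: continuous_subspaceT => z.
  apply: (@continuous_at_comp R S R (fun x => (x, u)) a); last exact: coord_continuous.
  exact: continuous_at_pairl.
by move=> v w _ _; exact: inj.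
Qed.

Lemma coord_bottom_mono (x y : R) : (a (x, unit0 R) < a (y, unit0 R)) = (x < y).
Proof. by rewrite !ltNge coord_horizontal_mono //; exact: coord_bottom_inj. Qed.

(** The difference between [a] and the first coordinate is invariant under deck transformations, and
    a compact fundamental domain bounds it. *)
Lemma coord_bound : exists B, forall z, a z <= z.1 + B.
Proof.
have cK : compact (`[0, 1]%classic `*` [set: U] : set S).
  by apply: compact_setX; [exact: segment_compact|exact: unit_compact].
have /compact_near_coveringP near_cover := cK.
have : \forall B \near +oo, (`[0, 1]%classic `*` [set: U]) `<=` (fun z : S => a z <= B).
  apply: (near_cover _ +oo (fun B z => a z <= B)) => z _.
  exists ([set w | a w < a z + 1], [set B | a z + 1 < B]) => /=.
    split; last by exists (a z + 1); split => //; exact: num_real.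
    have : nbhs (a z) [set r | r < a z + 1] by apply: lt_nbhsl; rewrite ltrDl.
    exact: (continuous_at_near (@coord_continuous z)).
  by move=> [w B] /= [wz zB]; apply: ltW; exact: lt_trans wz zB.
case=> B [_ HB]; exists (B + 1) => z.
have /andP[f1 f2] := floor_itv z.1; rewrite intrD mulr1z in f2.
have zE : z = deck (Num.floor z.1) (z.1 - (Num.floor z.1)%:~R, z.2).
  by rewrite /deck /= subrK -surjective_pairing.
have : a (z.1 - (Num.floor z.1)%:~R, z.2) <= B + 1.
  apply: (HB (B + 1)); first by rewrite ltrDl.
  by split => //=; rewrite in_itv /= subr_ge0 f1 /= lerBlDr addrC ltW.
move=> h; have := coord_deck (Num.floor z.1) (z.1 - (Num.floor z.1)%:~R, z.2).
by rewrite -zE => ->; rewrite addrC lerD.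
Qed.

Lemma bottom_point z : exists x, a (x, unit0 R) = a z.
Proof.
have [g [cg [_ g0 _ _] gr]] := leaf_lift z.
exists (g (unit0 R)).1; have : [set w | a w = a z] (g (unit0 R)) by rewrite -gr; exists (unit0 R).
move=> /= <-; congr a; rewrite [RHS]surjective_pairing; congr (_, _).
by apply: ucoord_inj; rewrite ucoord0 -g0.
Qed.

(** By [coord_bound] the far left of the strip lies in the region [a w < x]. This region is
    connected, since all its levels meet one ray of the bottom line, and a connected set that avoids
    the level [x] cannot leave it. *)
Lemma left_sideE x : (exists z, a z = x) ->
  left_side [set w | a w = x] = [set w | a w < x].
Proof.
move=> [z0 z0x]; rewrite eqEsubset; split => z /=.
  move=> [M HM].
  (* The integer [n] exceeds both numbers, so that the translate of [z] by [- n] is to the left of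
     [M] and has coordinate less than [x]. *)
  pose N := Num.max (z.1 - M) (a z - x).
  have /andP[_ f2] := floor_itv N; pose n := Num.floor N + 1.
  have [n1 n2] : z.1 - M < n%:~R /\ a z - x < n%:~R.
    by split; apply: le_lt_trans f2; rewrite le_max lexx ?orbT.
  have [|C [Cz CF cC] Cw] := HM (deck (- n) z).
    by rewrite /deck /= mulrNz; lra.
  have wx : a (deck (- n) z) < x by rewrite coord_deck mulrNz; lra.
  apply/(@connected_locally_constant S C (fun v => a v < x) _ _ cC Cz Cw) => // t Ct.
  have [tx|xt|/CF] := ltgtP (a t) x; last by case.
    exists True; have : nbhs (a t) [set r | r < x] by exact: lt_nbhsl.
    by move/(continuous_at_near (@coord_continuous t)); apply: filterS => u /= ->.
  exists False; have : nbhs (a t) [set r | x < r] by exact: lt_nbhsr.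
  by move/(continuous_at_near (@coord_continuous t)); apply: filterS => u /= /lt_gtF ->.
move=> zx; have [B HB] := coord_bound; exists (x - B) => z' z'M.
have z'x : a z' < x by apply: le_lt_trans (HB z') _; rewrite -ltrBrDr.
have [y yz] := bottom_point z; have [y' yz'] := bottom_point z'.
pose ray := (fun y => (y, unit0 R) : S) @` [set y | a (y, unit0 R) < x].
have cray : connected ray.
  apply: connected_continuous_connected; last first.
    by apply: continuous_subspaceT => v; exact: continuous_at_pairl.
  apply/connected_intervalP => r s /= rx sx t /andP[rt ts].
  by apply: le_lt_trans sx; rewrite coord_horizontal_mono //; exact: coord_bottom_inj.
have ray_y v w : a (v, unit0 R) = a w -> a w < x -> (ray `&` [set u | a u = a w]) !=set0.
  move=> vw wx; exists (v, unit0 R); split => //; exists v => //=.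
  by rewrite vw.
exists ((ray `|` [set u | a u = a z]) `|` [set u | a u = a z']); last by right.
split; first by left; right.
  by move=> u [[[v /= vx <-]|/= ->]|/= ->] E; [move: vx|move: zx|move: z'x]; rewrite E ltxx.
apply: connectedU.
- have [u [u1 u2]] := ray_y _ _ yz' z'x; exists u; split => //.
  by left.
- by apply: connectedU cray (level_connected (erefl _)); exact: ray_y yz zx.
exact: level_connected (erefl (a z')).
Qed.

Lemma leaf_ltE z z' : leaf_lt (lifted_leaf F z) (lifted_leaf F z') <-> a z < a z'.
Proof.
rewrite /leaf_lt /leaf_le !lifted_leafE !left_sideE; [|by exists z'|by exists z].
split=> [[le ne]|lt].
  have [//|lt|E] := ltgtP (a z) (a z').
    by have := le z' lt; rewrite /= ltxx.
  by case: ne; rewrite E.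
split=> [w /= wz|E]; first exact: lt_trans wz lt.
have : [set w | a w = a z] z by [].
by rewrite E /= => E'; move: lt; rewrite E' ltxx.
Qed.

Lemma lifted_precedesE z z' : lifted_precedes F z z' <->
  a z = a z' /\ precedes F (cov z) (cov z').
Proof.
split=> [[phi [g [s [t [Fphi [cg gP] <- <- st]]]]]|[azz' pzz']].
  have [[_ _ rg] _ _ _] := gP.
  have phis r : phi (cov (g r)) by rewrite -rg; exists r.
  split; last by exists phi, (@cov R \o g), s, t.
  have := @coord_int_const (fun u => g (uclamp u)) (cov (g s)) _ _ (ucoord s) (ucoord t).
  rewrite !ucoordK; apply.
    by move=> u; apply: (@continuous_at_comp R U S (@uclamp R) g);
      [exact: uclamp_continuous|exact: cg].
  by move=> u; rewrite (leaf_eq rF Fphi (phis s)).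
have [Fz _] := leaf_in (cov z) rF; have [g [cg gP rg]] := leaf_lift z.
have : range g z by rewrite rg.
have : range g z' by rewrite rg /= azz'.
move=> [t _ tz'] [s _ sz]; exists (leaf F (cov z)), g, s, t; split => //.
by apply/(precedes_param _ _ rF Fz gP); rewrite /= sz tz'.
Qed.

Definition angle_class (z z' : S) : int :=
  aclass (a z) (a z') (precedes F (cov z) (cov z')).

Lemma dthetaE z z' : dtheta z z' F = (angle_class z z')%:~R.
Proof.
rewrite /dtheta /angle_class /aclass.
have -> : `[<leaf_lt (lifted_leaf F z) (lifted_leaf F z')>] = (a z < a z').
  by apply/asboolP/idP => /leaf_ltE.
have -> : `[<leaf_lt (lifted_leaf F z') (lifted_leaf F z)>] = (a z' < a z).
  by apply/asboolP/idP => /leaf_ltE.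
have [lt|lt|E] := ltgtP (a z) (a z').
- by rewrite mulrNz.
- by case: asboolP => // /lifted_precedesE [E]; rewrite E ltxx in lt.
have -> : `[<lifted_precedes F z z'>] = `[<precedes F (cov z) (cov z')>].
  apply/asboolP/asboolP => [/lifted_precedesE []//|h].
  exact/lifted_precedesE.
by case: asboolP.
Qed.

(** By closedness of the order, two distinct points of one leaf keep their order nearby as long as
    they share a leaf. *)
Lemma digital_at_angle (T : topologicalType) (f g : T -> S) (p : T) :
  {for p, continuous f} -> {for p, continuous g} -> f p <> g p ->
  digital_at (fun q => angle_class (f q) (g q)) p.
Proof.
move=> cf cg fg.
have ca (k : T -> S) : {for p, continuous k} -> {for p, continuous (fun q => a (k q))}.
  by move=> ck; apply: (continuous_at_comp ck); exact: coord_continuous.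
apply: digital_at_aclass; [exact: ca|exact: ca|] => afg.
have cov_ne z z' : a z = a z' -> z <> z' ->
    precedes F (cov z) (cov z') \/ precedes F (cov z') (cov z).
  move=> azz' ne; have : leaf F (cov z') (cov z).
    by apply/coord_leaf; exists 0; rewrite addr0.
  case/(precedes_total rF) => [E|?|?]; [|by left|by right].
  by case: ne; exact: coord_cov_inj.
have near_not (k k' : T -> S) : {for p, continuous k} -> {for p, continuous k'} ->
    precedes F (cov (k' p)) (cov (k p)) ->
    \forall q \near p, ~ weakly_precedes F (cov (k q)) (cov (k' q)).
  move=> ck ck' pk; have nw : ~ weakly_precedes F (cov (k p)) (cov (k' p)).
    case=> [E|]; last exact: precedes_asym pk.
    by rewrite E in pk; exact: precedes_irrefl pk.
  have cc : {for p, continuous (fun q => (cov (k q), cov (k' q)))}.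
    by apply: continuous_at_pair; exact: continuous_at_cov.
  by have := order_closed rF nw; move/(continuous_at_near cc).
have [pfg|pgf] := cov_ne _ _ afg fg.
  exists True; apply: filterS (near_not g f cg cf pfg) => q nw aq; split=> // _.
  have [E|//|pg] : [\/ cov (f q) = cov (g q), precedes F (cov (f q)) (cov (g q))
      | precedes F (cov (g q)) (cov (f q))].
    by apply: precedes_total => //; apply/coord_leaf; exists 0; rewrite addr0.
  - by case: nw; left.
  - by case: nw; right.
exists False; apply: filterS (near_not f g cf cg pgf) => q nw aq; split=> // pq.
by apply: nw; right.
Qed.

Lemma angle_class_deck n z z' : angle_class (deck n z) (deck n z') = angle_class z z'.
Proof. by rewrite /angle_class /aclass !coord_deck !cov_deck !ltrD2r. Qed.

Lemma angle_class_bottom (x y : R) : x <> y ->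
  angle_class (x, unit0 R) (y, unit0 R) = if x < y then -1 else 1.
Proof.
rewrite /angle_class /aclass !coord_bottom_mono.
by case: ltgtP.
Qed.

End LeafCoordinateTheory.

(** * Foliations transported by a homeomorphism *)

Section PushForward.
Context (R : realType).
Local Notation S := (strip R).
Local Notation A := (annulus R).
Local Notation U := (unit_itv R).

Implicit Types (u v : A -> A) (F : leaf_system R) (phi : set A) (g : U -> A).

Definition inverse_isotopic (u v : A -> A) : Prop :=
  [/\ isotopic_to_id u, isotopic_to_id v, cancel u v & cancel v u].

Lemma inverse_isotopic_exists u : isotopic_to_id u -> exists v, inverse_isotopic u v.
Proof.
move=> iu; have [H iH Hu] := isotopic_isotopy iu.
have [Hi [iHi HiK HKi]] := isotopy_inverse iH.
exists (fun z => Hi (unit1 R, z)); split => //; first exact: isotopy_at.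
- by move=> z; rewrite -Hu HiK.
- by move=> z; rewrite -Hu HKi.
Qed.

Lemma inverse_isotopic_sym u v : inverse_isotopic u v -> inverse_isotopic v u.
Proof. by move=> [? ? ? ?]; split. Qed.

Lemma isotopic_continuous u : isotopic_to_id u -> continuous u.
Proof.
move=> /isotopic_isotopy [H [_ hH _] Hu].
have -> : u = (fun z => H (unit1 R, z)) by apply/funext => z; rewrite Hu.
by have [g []] := hH (unit1 R).
Qed.

Lemma connected_component_preimage (T V : topologicalType) (u : T -> V)
    (v : V -> T) (B : set V) (z : T) :
  continuous u -> continuous v -> cancel u v -> cancel v u ->
  connected_component (u @^-1` B) z = u @^-1` connected_component B (u z).
Proof.
move=> cu cv uK vK; rewrite eqEsubset; split => w.
  move=> [C [Cz CB cC] Cw]; exists (u @` C); last by exists w.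
  split; [by exists z|by move=> _ [x /CB Bx <-]|].
  by apply: connected_continuous_connected cC _; exact: continuous_subspaceT.
move=> [C [Cz CB cC] Cw]; exists (v @` C); last by exists (u w).
split; first by exists (u z).
  by move=> _ [x /CB Bx <-]; rewrite /= vK.
by apply: connected_continuous_connected cC _; exact: continuous_subspaceT.
Qed.

Section PushInv.
Context (u v : A -> A) (F : leaf_system R) (uv : inverse_isotopic u v).

Let iu : isotopic_to_id u. Proof. by case: uv. Qed.
Let iv : isotopic_to_id v. Proof. by case: uv. Qed.
Let uK : cancel u v. Proof. by case: uv. Qed.
Let vK : cancel v u. Proof. by case: uv. Qed.
Let cu : continuous u. Proof. exact: isotopic_continuous. Qed.
Let cv : continuous v. Proof. exact: isotopic_continuous. Qed.

Lemma push_push_inv : push v F = push_inv u F.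
Proof.
rewrite /push /push_inv; apply: eq_imagel => phi _.
rewrite eqEsubset; split => w /=; first by move=> [x ? <-]; rewrite vK.
by move=> phiw; exists (u w).
Qed.

Lemma leaf_push_inv z : leaf (push_inv u F) z = u @^-1` leaf F (u z).
Proof.
rewrite eqEsubset; split => w /=.
  by move=> [_ [[phi Fphi <-] /= phiz] phiw]; exists phi.
by move=> [phi [Fphi phiz] phiw]; exists (u @^-1` phi) => //; split => //; exists phi.
Qed.

Lemma leaf_param_push g phi : leaf_param g phi -> leaf_param (v \o g) (u @^-1` phi).
Proof.
move=> [[cg ig rg] g0 g1 gi]; split.
- split.
  + by move=> s; apply: (@continuous_at_comp U A A g v); [exact: cg|exact: cv].
  + by move=> s t /(can_inj vK)/ig.
  + rewrite eqEsubset; split => [_ [s _ <-]|w /=]; first by rewrite /= vK -rg; exists s.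
    by rewrite -rg => -[s _ sw]; exists s => //=; rewrite sw.
- exact: isotopic_C0.
- exact: isotopic_C1.
by move=> t /gi; exact: (isotopic_int _ iv).2.
Qed.

End PushInv.

Lemma precedes_push_inv u v F (z w : A) : inverse_isotopic u v ->
  precedes (push_inv u F) z w <-> precedes F (u z) (u w).
Proof.
move=> uv; have [_ _ uK vK] := uv; split.
  move=> [_ [g [s [t [[phi Fphi <-] gP <- <- st]]]]].
  exists phi, (u \o g), s, t; split => //.
  have := leaf_param_push (inverse_isotopic_sym uv) gP.
  congr leaf_param; rewrite eqEsubset; split => x /=; by rewrite vK.
move=> [phi [g [s [t [Fphi gP gs gt st]]]]].
exists (u @^-1` phi), (v \o g), s, t; split => //=.
- by exists phi.
- exact: leaf_param_push.
- by rewrite gs uK.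
- by rewrite gt uK.
Qed.

Lemma radial_push_inv u v F : inverse_isotopic u v ->
  radial_foliation F -> radial_foliation (push_inv u F).
Proof.
move=> uv [uniq par charts]; have [iu iv uK vK] := uv.
have cu := isotopic_continuous iu; have cv := isotopic_continuous iv.
split.
- move=> z; have [phi [[Fphi phiz] phi_uniq]] := uniq (u z).
  exists (u @^-1` phi); split; first by split => //; exists phi.
  by move=> _ [[psi Fpsi <-] /= psiz]; rewrite (phi_uniq psi).
- by move=> _ [phi /par [g gP] <-]; exists (v \o g); exact: leaf_param_push.
move=> z; have [W [h [oW Ww [[K KP [hi [[ch chi] hV hiW hK hiK]]] pl od]]]] := charts (u z).
exists (u @^-1` W), (h \o u); split => //.
  by apply: open_comp => // ? _; exact: cu.
split.
- exists K => //; exists (v \o hi); split.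
  + split; last by move=> x; apply: (continuous_comp (chi x)); exact: cv.
    apply: continuous_in_subspaceT => x /set_mem Wx.
    apply: (@continuous_at_comp A A _ u h); first exact: cu.
    exact: (chart_continuous oW ch Wx).
  + by move=> x /hV.
  + by move=> y /hiW; rewrite /= vK.
  + by move=> x Wx; rewrite /= hK // uK.
  + by move=> y Vy; rewrite /= vK hiK.
- move=> x Wx; rewrite leaf_push_inv.
  rewrite -[_ `&` _]/(u @^-1` (leaf F (u x) `&` W)).
  by rewrite (connected_component_preimage _ _ cu cv uK vK) pl.
by move=> x y Wx Wy E lt; apply/(precedes_push_inv _ _ _ uv)/od.
Qed.

Lemma leaf_coord_push_inv u v F (a : S -> R) (k : S -> S) :
  inverse_isotopic u v -> leaf_coord F a ->
  continuous k -> (forall n z, k (deck n z) = deck n (k z)) ->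
  (forall z, cov (k z) = u (cov z)) -> leaf_coord (push_inv u F) (a \o k).
Proof.
move=> uv [ca ad al] ck kd kc; split.
- by move=> z; apply: (@continuous_at_comp S S R k a); [exact: ck|exact: ca].
- by move=> n z; rewrite /= kd ad.
by move=> z z'; rewrite leaf_push_inv /= -!kc; exact: al.
Qed.

Lemma dtheta_push_inv u v F (a : S -> R) (k : S -> S) z z' : inverse_isotopic u v ->
  radial_foliation F -> leaf_coord F a ->
  continuous k -> (forall z, cov (k z) = u (cov z)) ->
  dtheta z z' (push_inv u F) = (angle_class F a (k z) (k z'))%:~R.
Proof.
move=> uv rF aF ck kc; have [iu _ _ _] := uv.
have kd := isotopic_lift_deck iu ck kc.
rewrite (dthetaE (radial_push_inv uv rF) (leaf_coord_push_inv uv aF ck kd kc)).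
congr (_%:~R); rewrite /angle_class /aclass; do 2 case: ifP => _ //.
by congr (if _ then _ else _); apply: asbool_equiv_eq; rewrite (precedes_push_inv _ _ _ uv) !kc.
Qed.

End PushForward.

(** * Existence of the angle lift *)

Section HomeoStar.
Context (R : realType).
Local Notation S := (strip R).
Local Notation A := (annulus R).
Local Notation U := (unit_itv R).
Local Notation HS := (Homeo_star R).

Lemma homeo_fun_isotopic (h : HS) : isotopic_to_id (homeo_fun h).
Proof. exact: (set_valP h). Qed.

Lemma eval_homeo_continuous : continuous (fun p : HS * A => homeo_fun p.1 p.2).
Proof.
have -> : (fun p : HS * A => homeo_fun p.1 p.2) = uncurry (fun h : HS => homeo_fun h).
  by apply/funext => -[].
apply: continuous_uncurry.
- exact: annulus_locally_compact.
- exact: annulus_hausdorff.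
- exact: initial_continuous.
- by move=> h; exact/isotopic_continuous/homeo_fun_isotopic.
Qed.

Definition homeo_inv (h : HS) : A -> A := projT1 (cid (inverse_isotopic_exists
  (homeo_fun_isotopic h))).

Lemma homeo_invP h : inverse_isotopic (homeo_fun h) (homeo_inv h).
Proof. exact: (projT2 (cid (inverse_isotopic_exists (homeo_fun_isotopic h)))). Qed.

Lemma homeo_inv_continuous : continuous (fun p : HS * A => homeo_inv p.1 p.2).
Proof.
move=> p0; apply: (@implicit_continuous (HS * A)%type A A
  (fun q => homeo_fun q.1.1 q.2) snd (fun p => homeo_inv p.1 p.2) p0).
- exact: annulus_compact.
- exact: annulus_separating.
- move=> z; apply: (@continuous_at_comp ((HS * A) * A)%type (HS * A)%type A
    (fun q : (HS * A) * A => (q.1.1, q.2)) (fun p => homeo_fun p.1 p.2) (p0, z));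
      last exact: eval_homeo_continuous.
  apply: continuous_at_pair; last exact: cvg_snd.
  have c1 : {for (p0, z), continuous (fun q : (HS * A) * A => q.1)} by exact: cvg_fst.
  exact: (continuous_at_fst c1).
- exact: cvg_snd.
- by move=> z /= <-; have [_ _ K _] := homeo_invP p0.1; rewrite K.
by near=> q; have [_ _ _ K] := homeo_invP q.1; rewrite /= K.
Unshelve. all: by end_near. Qed.

Lemma homeo_of_isotopy (Hi : U * A -> A) : isotopy Hi ->
  exists2 h : R -> HS, continuous h & forall t, homeo_fun (h t) = (fun w => Hi (uclamp t, w)).
Proof.
move=> iH; have P t : (fun w => Hi (uclamp t, w)) \in
    [set f : {compact-open, A -> A} | isotopic_to_id f].
  by apply/mem_set; exact: isotopy_at.
exists (fun t => SigSub (P t) : HS) => //.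
have [cH _ _] := iH.
have cc : continuous (fun p : R * A => Hi (uclamp p.1, p.2)).
  move=> p; apply: (@continuous_at_comp _ (U * A)%type A (fun p : R * A => (uclamp p.1, p.2)));
    last exact: cH.
  by apply: continuous_at_pair; [apply: continuous_at_uclamp; exact: cvg_fst|exact: cvg_snd].
apply: continuous_comp_initial.
exact: (continuous_curry_fun cc).
Qed.

Lemma push_continuous F : radial_foliation F ->
  continuous (fun h : HS => push (homeo_fun h) F).
Proof. by move=> rF; apply/continuousP => V oV; exact: oV. Qed.

Lemma push_homeoE F (h : HS) : push (homeo_fun h) F = push_inv (homeo_inv h) F.
Proof. exact/push_push_inv/inverse_isotopic_sym/homeo_invP. Qed.

Lemma push_homeo_radial F (h : HS) : radial_foliation F ->
  radial_foliation (push (homeo_fun h) F).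
Proof.
move=> rF; rewrite push_homeoE.
exact: (radial_push_inv (inverse_isotopic_sym (homeo_invP h))).
Qed.

Lemma map_lift_inj (u : A -> A) (k : S -> S) : injective u ->
  (forall n z, k (deck n z) = deck n (k z)) ->
  (forall z, cov (k z) = u (cov z)) -> injective k.
Proof.
move=> iu kd kc z z' E; have /cov_eqP [n zn] : cov z = cov z' by apply: iu; rewrite -!kc E.
move: E; rewrite zn kd => /(congr1 fst) /= /eqP.
by rewrite -subr_eq0 opprD addNKr oppr_eq0 intr_eq0 => /eqP ->; rewrite deck0.
Qed.

End HomeoStar.

Lemma dig_open (k j : int) : dig k j -> dig j `<=` dig k.
Proof.
case=> [->//|[[m km] jk]] i ji.
have [[l jl]|[l jl]] := parity j.
  have -> : k = j by lia.
  exact: ji.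
rewrite (dig_odd _ ji); last by exists l.
by right; split; first exists m.
Qed.

Lemma digital_at_congr (T : topologicalType) (c c' : T -> int) (p : T) :
  (\forall q \near p, eqmod4 (c q) (c' q)) -> digital_at c p -> digital_at c' p.
Proof.
move=> cc'; have [n cp] := nbhs_singleton cc'; rewrite /digital_at.
move: cc'; apply: filterS2 => q cq [k ck kq].
exists (4 * n + k); first by rewrite cp; exact: dig_add4.
apply: eqmod4_trans cq; apply: eqmod4_trans kq; exists (- n); lia.
Qed.

(** * Angles for a varying foliation *)

Section AngleLift.
Context (R : realType).
Local Notation S := (strip R).
Local Notation A := (annulus R).
Local Notation U := (unit_itv R).
Local Notation HS := (Homeo_star R).

(* Only the congruence class modulo 4 of [angle] is independent of this choice. *)
Definition some_coord (F : leaf_system R) : S -> R :=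
  xget (fun=> 0) [set a | leaf_coord F a].

Lemma some_coordP F : radial_foliation F -> leaf_coord F (some_coord F).
Proof.
move=> /leaf_coord_exists [a aF]; rewrite /some_coord.
by case: xgetP => [b _ //|/(_ a)].
Qed.

Definition angle (F : leaf_system R) (z z' : S) : int :=
  angle_class F (some_coord F) z z'.

Lemma dtheta_angle F z z' : radial_foliation F -> dtheta z z' F = (angle F z z')%:~R.
Proof. by move=> rF; apply: dthetaE => //; exact: some_coordP. Qed.

Lemma angle_push_inv u v F k z z' : inverse_isotopic u v -> radial_foliation F ->
  continuous k -> (forall z, cov (k z) = u (cov z)) ->
  eqmod4 (angle F (k z) (k z')) (angle (push_inv u F) z z').
Proof.
move=> uv rF ck kc; apply/eqmod4_Z4.
rewrite -(dtheta_angle _ _ (radial_push_inv uv rF)).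
by rewrite (dtheta_push_inv _ _ uv rF (some_coordP rF) ck kc).
Qed.

(** The points are moved instead of the foliation: the inverses of the [h q] lift to the strip
    locally in [q], and carry the pair to a moving pair of distinct points for the fixed [F]. *)
Lemma digital_at_angle_push (X : topologicalType) (F : leaf_system R)
    (h : X -> HS) (f g : X -> S) (p : X) : radial_foliation F ->
  {for p, continuous h} -> {for p, continuous f} -> {for p, continuous g} ->
  f p <> g p ->
  digital_at (fun q => angle (push (homeo_fun (h q)) F) (f q) (g q)) p.
Proof.
move=> rF ch cf cg fg.
have [k kP] := family_lift (h p) (@homeo_inv_continuous R).
have near_k : \forall q \near p, forall z,
    {for (h q, z), continuous k} /\ cov (k (h q, z)) = homeo_inv (h q) (cov z).
  exact: (continuous_at_near ch kP).
apply: (@digital_at_congr _ (fun q => angle F (k (h q, f q)) (k (h q, g q)))).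
  apply: filterS near_k => q kq; rewrite push_homeoE.
  apply: (@angle_push_inv _ (homeo_fun (h q)) F (fun z => k (h q, z))) => //.
  - exact/inverse_isotopic_sym/homeo_invP.
  - move=> z; apply: (@continuous_at_comp S (HS * S)%type S (fun z => (h q, z)) k);
      last by case: (kq z).
    exact: continuous_at_pairr.
  - by move=> z; case: (kq z).
have kp := nbhs_singleton near_k.
have ck (e : X -> S) : {for p, continuous e} -> {for p, continuous (fun q => k (h q, e q))}.
  move=> ce; apply: (@continuous_at_comp X (HS * S)%type S (fun q => (h q, e q)) k);
    last by case: (kp (e p)).
  exact: continuous_at_pair.
apply: (digital_at_angle rF (some_coordP rF) (ck f cf) (ck g cg)).
have [iu _ uK _] := inverse_isotopic_sym (homeo_invP (h p)).
have ckp : continuous (fun z => k (h p, z)).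
  move=> z; apply: (@continuous_at_comp S (HS * S)%type S (fun z => (h p, z)) k);
    last by case: (kp z).
  exact: continuous_at_pairr.
have kc z : cov (k (h p, z)) = homeo_inv (h p) (cov z) by case: (kp z).
have kinj : injective (fun z => k (h p, z)).
  exact: (@map_lift_inj R _ (fun z => k (h p, z)) (can_inj uK) (isotopic_lift_deck iu ckp kc) kc).
by move=> E; apply: fg; apply: kinj.
Qed.

Section Pair.
Variables (z z' : S) (zz' : z <> z').

(** Both points rise vertically from the bottom line, the second one sliding in by [sg] from the
    side away from [z], so that they never meet. *)
Let sg : R := if z.1 <= z'.1 then 1 else -1.
Let p1 (t : R) : S := lower (z, t).
Let p2 (t : R) : S := (z'.1 + sg * (1 - clamp t), uclamp (clamp t * ucoord z'.2)).

Let p1_continuous : continuous p1.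
Proof.
move=> t; apply: (@continuous_at_comp R (S * R)%type S (fun t => (z, t)));
  last exact: lower_continuous.
exact: continuous_at_pairr.
Qed.

Let p2_continuous : continuous p2.
Proof.
move=> t; have ct : {for t, continuous (fun t : R => clamp t)} by exact: clamp_continuous.
apply: (@continuous_at_pair R R U (fun t => z'.1 + sg * (1 - clamp t))
  (fun t => uclamp (clamp t * ucoord z'.2))).
  apply: continuous_at_add; first exact: cvg_cst.
  apply: continuous_at_mul; first exact: cvg_cst.
  by apply: continuous_at_sub => //; exact: cvg_cst.
apply: continuous_at_uclamp; apply: continuous_at_mul => //; exact: cvg_cst.
Qed.

Let p_ne t : p1 t <> p2 t.
Proof.
move=> E; have E1 : (p1 t).1 = (p2 t).1 by rewrite E.
have E2 : (p1 t).2 = (p2 t).2 by rewrite E.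
move: E1 E2; rewrite /p1 /p2 /lower [LHS]/= [RHS]/= => E1; rewrite [LHS]/= [RHS]/= => E2.
have /andP[c0 c1] := clamp01 t.
have [c1' zE] : clamp t = 1 /\ z.1 = z'.1.
  move: E1; rewrite /sg; move: (clamp t) c0 c1 => c c0 c1.
  by case: (leP z.1 z'.1) => h E1; split; lra.
apply: zz'; rewrite [LHS]surjective_pairing [RHS]surjective_pairing zE; congr (_, _).
by rewrite -(ucoordK z.2) -(ucoordK z'.2); move: E2; rewrite c1' !mul1r.
Qed.

Let p_end t : 1 <= t -> p1 t = z /\ p2 t = z'.
Proof.
move=> t1; rewrite /p1 lower_ge1 // /p2 clamp_ge1 // subrr mulr0 addr0 mul1r ucoordK.
by rewrite -surjective_pairing.
Qed.

Let p_start t : t <= 0 -> p1 t = (z.1, unit0 R) /\ p2 t = (z'.1 + sg, unit0 R).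
Proof.
by move=> t0; rewrite /p1 lower_le0 // /p2 clamp_le0 // subr0 mulr1 mul0r uclamp0.
Qed.

(** Leaves are ordered along the bottom line as the first coordinates, so the initial pair has the
    same angle for every foliation; this makes the lifts for different foliations comparable. *)
Let start : int := if z.1 <= z'.1 then -1 else 1.

Let angle_start F : radial_foliation F -> angle F (p1 0) (p2 0) = start.
Proof.
move=> rF; have [-> ->] := p_start (lexx 0).
rewrite /angle (angle_class_bottom rF (some_coordP rF)) /start /sg;
  move: (z.1 : R) (z'.1 : R) => x y; case: (leP x y) => h.
- by rewrite ifT //; lra.
- by rewrite ifF //; apply/negbTE; rewrite -leNgt; lra.
- by move=> E; lra.
- by move=> E; lra.
Qed.

Let path_lift F : radial_foliation F -> exists l : R -> digital_line,
  [/\ continuous l, l 0 = start & forall t, eqmod4 (angle F (p1 t) (p2 t)) (l t)].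
Proof.
move=> rF.
have [||p|||L [cL L0 Lc]] := @digital_lift_exists R U
    (fun p => angle F (p1 p.2) (p2 p.2)) (fun=> start).
- by move=> x t t0; have [/= -> ->] := p_start t0; have [-> ->] := p_start (lexx 0).
- by move=> x t t0; have [/= -> ->] := p_end t0; have [-> ->] := p_end (lexx 1).
- apply: (digital_at_angle rF (some_coordP rF) (f := fun p : U * R => p1 p.2)
    (g := fun p : U * R => p2 p.2)).
  + by apply: (@continuous_at_comp _ R S snd p1); [exact: cvg_snd|exact: p1_continuous].
  + by apply: (@continuous_at_comp _ R S snd p2); [exact: cvg_snd|exact: p2_continuous].
  + exact: p_ne.
- exact: (@cst_continuous U digital_line).
- by move=> x; rewrite /= angle_start //; exact: eqmod4_refl.
exists (fun t => L (unit0 R, t)); split.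
- by move=> t; apply: slice_continuous; exact: cL.
- by rewrite L0.
- by move=> t; exact: Lc (unit0 R, t).
Qed.

(* The lift at [F] is the final value of the angle of [F] along the path [(p1, p2)],
   which joins a pair of boundary points to [(z, z')]. *)
Lemma angle_lift_exists : exists theta, is_angle_lift z z' theta.
Proof.
have ex F : exists l : R -> digital_line, radial_foliation F ->
    [/\ continuous l, l 0 = start & forall t, eqmod4 (angle F (p1 t) (p2 t)) (l t)].
  have [/path_lift [l lP]|nF] := pselect (radial_foliation F); first by exists l.
  by exists (fun=> 0).
have [l lP] := choice ex.
pose theta F : digital_line := l F 1; exists theta; split; last first.
  move=> F rF; rewrite (dtheta_angle _ _ rF); apply/eqmod4_Z4/eqmod4_sym.
  by have [_ _ /(_ 1)] := lP F rF; have [-> ->] := p_end (lexx 1).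
have theta_push F : radial_foliation F ->
    continuous (fun h : HS => theta (push (homeo_fun h) F)).
  move=> rF.
  have rpF h := push_homeo_radial h rF.
  have [||p|||L [cL L0 Lc]] := @digital_lift_exists R HS
      (fun p => angle (push (homeo_fun p.1) F) (p1 p.2) (p2 p.2)) (fun=> start).
  - by move=> x t t0; have [/= -> ->] := p_start t0; have [-> ->] := p_start (lexx 0).
  - by move=> x t t0; have [/= -> ->] := p_end t0; have [-> ->] := p_end (lexx 1).
  - apply: (digital_at_angle_push (h := fun p : HS * R => p.1)
      (f := fun p : HS * R => p1 p.2) (g := fun p : HS * R => p2 p.2) rF).
    + exact: cvg_fst.
    + by apply: (@continuous_at_comp _ R S snd p1); [exact: cvg_snd|exact: p1_continuous].
    + by apply: (@continuous_at_comp _ R S snd p2); [exact: cvg_snd|exact: p2_continuous].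
    + exact: p_ne.
  - exact: (@cst_continuous HS digital_line).
  - by move=> x; rewrite /= angle_start //; exact: eqmod4_refl.
  (* By uniqueness from the same start, the lift with a parameter in the group restricts, for each
     [h], to the lift chosen for the image foliation. *)
  have -> : (fun h : HS => theta (push (homeo_fun h) F)) = (fun h => L (h, 1)).
    apply/funext => h; have [cl l0 lc] := lP _ (rpF h).
    apply: (@digital_segment_unique R (l (push (homeo_fun h) F)) (fun t => L (h, t)) 0).
      move=> t _; split; first exact: cl.
        by apply: slice_continuous; exact: cL.
      near=> u; apply: eqmod4_trans (eqmod4_sym (lc u)) (Lc (h, u)).
    by rewrite l0 L0.
  move=> h; apply: (@continuous_at_comp HS (HS * R)%type digital_line (fun h => (h, 1)));
    last exact: cL.
  exact: continuous_at_pairl.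
apply/subspace_continuousP => F0 rF0 B /nbhs_digital FB.
(* The topology of foliations is final for the orbit maps, so openness of [O] is tested along
   them. *)
pose O := [set F | radial_foliation F /\ dig (theta F0) (theta F)].
have oO : open O.
  move=> F rF; rewrite openE => h [_ hO].
  have : \forall h' \near h, dig (theta (push (homeo_fun h) F)) (theta (push (homeo_fun h') F)).
    by apply/continuous_digital; exact: theta_push.
  apply: filterS => h' hh'; split; first exact: push_homeo_radial.
  exact: dig_open hO _ hh'.
have OF0 : O F0 by split => //; exact: dig_refl.
have : \forall F \near F0, O F by apply: open_nbhs_nbhs; split.
by apply: filterS => F [_ OF] rF; exact: FB.
Unshelve. all: by end_near. Qed.

Lemma angle_liftP : is_angle_lift z z' (angle_lift z z').
Proof.
by have [theta tP] := angle_lift_exists; rewrite /angle_lift; case: xgetP => [t _ //|/(_ theta)].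
Qed.

End Pair.

Lemma push_inv_id (F : leaf_system R) : push_inv id F = F.
Proof. by rewrite /push_inv image_id. Qed.

(** Transporting [F] by the inverse isotopy with the pair fixed gives the same angles as fixing [F]
    and moving the pair along the lifted isotopy; two lifts of the same angles have the same
    variation. *)
Lemma tau_path (F : leaf_system R) (H : U * A -> A) (G : S * R -> S) (z z' : S)
    (M : R -> digital_line) :
  radial_foliation F -> isotopy H -> isotopy_lift H G -> z <> z' -> continuous M ->
  (forall t, eqmod4 (angle F (G (z, t)) (G (z', t))) (M t)) ->
  tau z z' F (push_inv (fun w => H (unit1 R, w)) F) = (M 1 : int) - M 0.
Proof.
move=> rF iH GP zz' cM MP; have [cl lP] := angle_liftP zz'.
have [Hi [iHi HiK HKi]] := isotopy_inverse iH.
have [h ch hE] := homeo_of_isotopy iHi.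
have inv t : inverse_isotopic (fun w => H (uclamp t, w)) (homeo_fun (h t)).
  split; [exact: isotopy_at|exact: homeo_fun_isotopic|rewrite hE|rewrite hE] => w //=.
pose path t := push_inv (fun w => H (uclamp t, w)) F.
have pathE t : path t = push (homeo_fun (h t)) F by rewrite (push_push_inv F (inv t)).
have rpath t : radial_foliation (path t) by exact: radial_push_inv (inv t) rF.
have cpath : continuous path.
  move=> t; have -> : path = (fun t => push (homeo_fun (h t)) F) by apply/funext.
  apply: (@continuous_at_comp R HS _ h (fun h => push (homeo_fun h) F)); first exact: ch.
  exact: push_continuous.
have clp : continuous (fun t => angle_lift z z' (path t)).
  move=> t; apply: (continuous_at_within cl (rpath t) (cpath t)).
  by near=> u.
have := @digital_segment_diff R (fun t => angle_lift z z' (path t)) M 0 1 ler01.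
rewrite /tau /path uclamp1 uclamp0; have -> : (fun w => H (unit0 R, w)) = id.
  by apply/funext => w; have [_ _ ->] := iH.
rewrite push_inv_id; apply => t _; split; [exact: clp|exact: cM|near=> u].
have e1 : eqmod4 (angle_lift z z' (path u)) (angle (path u) z z').
  by apply/eqmod4_Z4; rewrite (lP _ (rpath u)) (dtheta_angle _ _ (rpath u)).
apply: eqmod4_trans e1 _; apply: eqmod4_trans (MP u); apply: eqmod4_sym.
have [_ _ GH] := GP.
apply: (@angle_push_inv _ _ F (fun z => G (z, u)) z z' (inv u) rF) => //.
exact: isotopy_lift_at GP.
Unshelve. all: by end_near. Qed.

End AngleLift.

Lemma open_sub_continuous (T Y : topologicalType) (D : set T) (f : T -> Y) z :
  open D -> continuous (fun w : set_type D => f (set_val w)) -> D z ->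
  {for z, continuous f}.
Proof.
move=> oD cf Dz; have wf : {within D, continuous f} by exact/subspace_sigL_continuousP.
apply: (continuous_at_within wf Dz (@continuous_at_id T z)).
exact: open_nbhs_nbhs.
Qed.

(** * The angle along an increasing map *)

Lemma eqmod1_closed (R : realType) (x : R) : closed [set y | eqmod1 x y].
Proof.
have -> : [set y | eqmod1 x y] = @picircle R @^-1` [set picircle x].
  by rewrite eqEsubset; split => y; [move/picircleP|move=> /esym/picircleP].
apply: preimage_closed; first by move=> z _; exact: picircle_continuous.
apply: accessible_closed_set1; apply: hausdorff_accessible.
exact/separating_hausdorff/circle_separating.
Qed.

(** Odd integers are open points, and an even value above [2 * k + 1] is at least [2 * k + 2], so a
    step of 1 does not cross the threshold. *)
Lemma near_ge_odd (T : topologicalType) (f : T -> digital_line) (p : T) (k : int) :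
  {for p, continuous f} -> 2 * k + 1 <= (f p : int) ->
  \forall q \near p, 2 * k + 1 <= (f q : int).
Proof.
move=> /continuous_digital cf kp; apply: filterS cf => q.
move: (f p) (f q) kp => x y; rewrite /digital_line in x y * => kx xy.
have := dig_dist xy; have [[l xl]|[l xl]] := parity x; first by lia.
by rewrite (dig_odd _ xy) //; exists l.
Qed.

Lemma near_le_odd (T : topologicalType) (f : T -> digital_line) (p : T) (k : int) :
  {for p, continuous f} -> (f p : int) <= 2 * k + 1 ->
  \forall q \near p, (f q : int) <= 2 * k + 1.
Proof.
move=> /continuous_digital cf kp; apply: filterS cf => q.
move: (f p) (f q) kp => x y; rewrite /digital_line in x y * => kx xy.
have := dig_dist xy; have [[l xl]|[l xl]] := parity x; first by lia.
by rewrite (dig_odd _ xy) //; exists l.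
Qed.

Section AngleAlongMap.
Context (R : realType).
Local Notation S := (strip R).
Local Notation A := (annulus R).
Local Notation U := (unit_itv R).
Context (c : S -> int) (x0 y0 : R).

(** The deck orbit of the point with coordinates [x0] and [y0], meant to be the set of fixed points;
    it is empty when [y0] exceeds 1, which covers the case without fixed points. *)
Definition marked (z : S) := eqmod1 x0 z.1 /\ ucoord z.2 = y0.

Hypothesis c_digital : forall z, ~ marked z -> digital_at c z.
Hypothesis y0_gt0 : 0 < y0.
Hypothesis c_deck : forall n z, c (deck n z) = c z.
Hypothesis c_bottom : forall x, c (x, unit0 R) = -1.
Hypothesis c_top : forall x, c (x, unit1 R) = 1.

Definition off_column (z : S) := ~ eqmod1 x0 z.1.
Definition below_marked (z : S) := ~ (eqmod1 x0 z.1 /\ y0 <= ucoord z.2).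
Definition above_marked (z : S) := ~ (eqmod1 x0 z.1 /\ ucoord z.2 <= y0).

Lemma column_closed : closed [set z : S | eqmod1 x0 z.1].
Proof.
have -> : [set z : S | eqmod1 x0 z.1] = fst @^-1` [set y | eqmod1 x0 y] by [].
by apply: preimage_closed; [move=> z _; exact: cvg_fst|exact: eqmod1_closed].
Qed.

Lemma height_closed (P : set R) : closed P -> closed [set z : S | P (ucoord z.2)].
Proof.
move=> cP; have -> : [set z : S | P (ucoord z.2)] = (fun z : S => ucoord z.2) @^-1` P by [].
apply: preimage_closed cP => z _.
by apply: (@continuous_at_ucoord R S snd); exact: cvg_snd.
Qed.

Lemma off_column_open : open off_column.
Proof. exact/closed_openC/column_closed. Qed.

Lemma below_marked_open : open below_marked.
Proof.
apply: (@closed_openC _ ([set z : S | eqmod1 x0 z.1] `&` [set z : S | y0 <= ucoord z.2])).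
apply: closedI; first exact: column_closed.
exact: (height_closed (@closed_ge R y0)).
Qed.

Lemma above_marked_open : open above_marked.
Proof.
apply: (@closed_openC _ ([set z : S | eqmod1 x0 z.1] `&` [set z : S | ucoord z.2 <= y0])).
apply: closedI; first exact: column_closed.
exact: (height_closed (@closed_le R y0)).
Qed.

Lemma unmarked_open : open [set z | ~ marked z].
Proof.
apply: (@closed_openC _ ([set z : S | eqmod1 x0 z.1] `&` [set z : S | ucoord z.2 = y0])).
apply: closedI; first exact: column_closed.
exact: (height_closed (@closed_eq R y0)).
Qed.

Lemma below_or_above z : ~ marked z -> below_marked z \/ above_marked z.
Proof.
move=> nz; have [xz|nx] := pselect (eqmod1 x0 z.1); last by left; case.
have [lt|lt|E] := ltgtP (ucoord z.2) y0.
- by left => -[_]; rewrite leNgt lt.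
- by right => -[_]; rewrite leNgt lt.
by case: nz.
Qed.

Lemma below_above z : below_marked z -> above_marked z -> off_column z.
Proof.
move=> bz az xz; have [le|/ltW le] := leP y0 (ucoord z.2); first by apply: bz.
exact: az.
Qed.

Lemma off_column_below z : off_column z -> below_marked z.
Proof. by move=> oz [/oz]. Qed.

Lemma off_column_above z : off_column z -> above_marked z.
Proof. by move=> oz [/oz]. Qed.

Definition is_angle (D : set S) (th : S -> digital_line) :=
  forall z, D z -> {for z, continuous th} /\ eqmod4 (c z) (th z).

Lemma angle_near (D : set S) th th' (z : S) : open D -> is_angle D th ->
  is_angle D th' -> D z -> \forall w \near z, eqmod4 (th w) (th' w).
Proof.
move=> oD aD aD' Dz; have : \forall w \near z, D w by exact: open_nbhs_nbhs.
apply: filterS => w Dw; apply: eqmod4_trans (eqmod4_sym (aD w Dw).2) (aD' w Dw).2.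
Qed.

Lemma angle_path_unique (D : set S) th th' (g : R -> S) (s t : R) : open D ->
  is_angle D th -> is_angle D th' -> continuous g -> (forall u, D (g u)) ->
  th (g s) = th' (g s) -> th (g t) = th' (g t).
Proof.
move=> oD aD aD' cg Dg.
apply: (@digital_segment_unique R (fun u => th (g u)) (fun u => th' (g u))) => u _.
split.
- by apply: (@continuous_at_comp R S digital_line g th); [exact: cg|case: (aD _ (Dg u))].
- by apply: (@continuous_at_comp R S digital_line g th'); [exact: cg|case: (aD' _ (Dg u))].
have := angle_near oD aD aD' (Dg u).
by move/(continuous_at_near (cg u)).
Qed.

(** The tracks of [g] replace simple connectivity of [D]: they start where [c] has the class of [k],
    avoid the marked points, and end at the given point. *)
Lemma angle_by_retraction (D : set S) (g : S * R -> S) (k : int) : open D ->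
  continuous g -> (forall z t, t <= 0 -> g (z, t) = g (z, 0)) ->
  (forall z t, 1 <= t -> g (z, t) = z) ->
  (forall z t, D z -> ~ marked (g (z, t))) ->
  (forall z, eqmod4 (c (g (z, 0))) k) ->
  exists2 th, is_angle D th & forall z, D z -> (forall t, g (z, t) = z) -> th z = k.
Proof.
move=> oD cg g0 g1 gD gk.
have cgv (p : set_type D * R) : {for p, continuous (fun p : set_type D * R => g (set_val p.1,
  p.2))}.
  apply: (@continuous_at_comp _ (S * R)%type S (fun p : set_type D * R => (set_val p.1, p.2)));
    last exact: cg.
  apply: continuous_at_pair; last exact: cvg_snd.
  by apply: (@continuous_at_comp _ (set_type D) S fst (@set_val S D));
    [exact: cvg_fst|exact: initial_continuous].
have [||p|||L [cL L0 Lc]] := @digital_lift_exists R (set_type D)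
    (fun p => c (g (set_val p.1, p.2))) (fun=> k).
- by move=> w t t0; rewrite /= g0.
- by move=> w t t1; rewrite /= !g1.
- have dp := c_digital (gD _ p.2 (set_valP p.1)).
  exact: (continuous_at_near (cgv p) dp).
- exact: (@cst_continuous (set_type D) digital_line).
- by move=> w; exact: gk.
(* The lift lives on the subspace [D] and is extended by arbitrary values; as [D] is open,
   continuity at its points is unaffected. *)
have ex z : exists m : digital_line, forall w : set_type D, set_val w = z -> L (w, 1) = m.
  have [Dz|nDz] := pselect (D z); last by exists 0 => w wz; case: nDz; rewrite -wz;
    exact: set_valP.
  exists (L (SigSub (mem_set Dz), 1)) => w wz; congr (L (_, _)); exact: val_inj.
have [th thP] := choice ex.
have thL (w : set_type D) : th (set_val w) = L (w, 1) by rewrite (thP _ w erefl).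
exists th => [z Dz|z Dz gz].
  split; last first.
    pose w : set_type D := SigSub (mem_set Dz); rewrite -[z]/(set_val w) thL.
    by have := Lc (w, 1); rewrite /= g1.
  apply: (open_sub_continuous oD) Dz.
  have -> : (fun w : set_type D => th (set_val w)) = (fun w => L (w, 1)) by apply/funext.
  move=> w; apply: (@continuous_at_comp _ (set_type D * R)%type digital_line (fun w => (w,
    1))); last exact: cL.
  exact: continuous_at_pairl.
pose w : set_type D := SigSub (mem_set Dz); rewrite -[z]/(set_val w) thL.
apply: (@digital_segment_unique R (fun t => L (w, t)) (fun=> k) 0); last by rewrite L0.
move=> t _; split.
- by apply: slice_continuous; exact: cL.
- exact: (@continuous_at_cst R digital_line).
near=> u; apply: eqmod4_trans (eqmod4_sym (Lc (w, u))) _.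
by rewrite /= gz -(gz 0).
Unshelve. all: by end_near. Qed.

Definition vertical (x t : R) : S := (x, uclamp t).

Lemma vertical_continuous x : continuous (vertical x).
Proof.
by move=> t; apply: (@continuous_at_pair R R U (fun=> x) (@uclamp R));
  [exact: cvg_cst|exact: uclamp_continuous].
Qed.

Lemma verticalK (z : S) : vertical z.1 (ucoord z.2) = z.
Proof. by rewrite /vertical ucoordK -surjective_pairing. Qed.

Lemma vertical0 x : vertical x 0 = (x, unit0 R). Proof. by rewrite /vertical uclamp0. Qed.
Lemma vertical1 x : vertical x 1 = (x, unit1 R). Proof. by rewrite /vertical uclamp1. Qed.

(** Off the columns, vertical segments from the bottom avoid the marked points and determine the
    angle. On a column two angles differ locally by a constant, which vanishes by comparison with a
    neighbouring point off the column. *)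
Lemma angle_unique (th th' : S -> digital_line) :
  is_angle [set z | ~ marked z] th ->
  (forall z, ~ marked z -> {for z, continuous th'} /\ eqmod4 (c z) (th' z)) ->
  (forall x, th (x, unit0 R) = th' (x, unit0 R)) ->
  forall z, ~ marked z -> th z = th' z.
Proof.
move=> ath ath' th0.
have off z : off_column z -> th z = th' z.
  move=> oz; rewrite -(verticalK z).
  apply: (@angle_path_unique [set z | ~ marked z] th th' (vertical z.1) 0) => //.
  - exact: unmarked_open.
  - exact: vertical_continuous.
  - by move=> u [xz _]; exact: oz.
  - by rewrite vertical0.
move=> z nz; have [xz|] := pselect (eqmod1 x0 z.1); last exact: off.
have [cz _] := ath z nz; have [cz' _] := ath' z nz.
have near4 := angle_near unmarked_open ath ath' nz.
have [n nE] := near_same_orbit dact0 dactD dact_continuous dact_disc cz cz' near4.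
have [e /= e0 eP] : \forall x \near z.1, th' (x, z.2) = dact n (th (x, z.2)).
  have ch : {for z.1, continuous (fun x : R => (x, z.2) : S)} by exact: continuous_at_pairl.
  have nE' : nbhs ((z.1, z.2) : S) [set w | th' w = dact n (th w)] by rewrite -surjective_pairing.
  exact: (continuous_at_near ch nE').
(* [d < e] keeps the displaced point where the difference is constant, and [0 < d < 1] puts it off
   the columns. *)
pose d := Num.min e 1 / 2.
have [d0 de d1] : [/\ 0 < d, d < e & d < 1].
  have m0 : 0 < Num.min e 1 by rewrite lt_min e0 ltr01.
  have [m1 m2] : Num.min e 1 <= e /\ Num.min e 1 <= 1 by rewrite !ge_min !lexx orbT.
  by rewrite /d; split; lra.
have oz : off_column (z.1 + d, z.2).
  move=> /= [m mE]; have [l lE] := xz; move: mE; rewrite lE => mE.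
  have E : d = (m - l)%:~R by rewrite intrB; lra.
  move: d0 d1; rewrite E -[0]/(0%:~R) -[1]/(1%:~R) !ltr_int; lia.
have := eP (z.1 + d); rewrite /= opprD addNKr normrN gtr0_norm // => /(_ de).
rewrite (off _ oz) => /esym/(act_free dact_disc) n0.
by have := nbhs_singleton nE; rewrite n0 dact0 => ->.
Qed.

(* Below the marked points the angle is lifted upwards from the bottom, above them
   downwards from the top, where the first lift is constant by invariance under
   deck transformations. *)
Lemma angle_exists : exists th : S -> digital_line,
  is_angle [set z | ~ marked z] th /\ forall x, th (x, unit0 R) = -1.
Proof.
have [tb tbP tb0] : exists2 tb, is_angle below_marked tb &
    forall z, below_marked z -> (forall t, lower (z, t) = z) -> tb z = (-1 : int).
  apply: angle_by_retraction.
  - exact: below_marked_open.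
  - exact: lower_continuous.
  - by move=> z t t0; rewrite !lower_le0.
  - by move=> z t t1; rewrite lower_ge1.
  - move=> z t bz [xz]; rewrite /lower /= ucoord_uclamp => yz; apply: bz; split => //.
    have /andP[c0 c1] := clamp01 t; have /andP[u0 u1] := ucoord01 z.2.
    have cb : 0 <= clamp t * ucoord z.2 <= 1 by rewrite mulr_ge0 //= mulr_ile1.
    by rewrite -yz clamp_id // ler_piMl.
  - by move=> z; rewrite lower_le0 // c_bottom; exact: eqmod4_refl.
have bot x : below_marked (x, unit0 R) by move=> [_ /=]; rewrite ucoord0 leNgt y0_gt0.
have tbot x : tb (x, unit0 R) = (-1 : int).
  by apply: tb0 => // t; rewrite /lower /= mulr0 uclamp0.
(* The translated angle is again an angle, with the same value on the bottom line. *)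
have tbdeck n z : off_column z -> tb (deck n z) = tb z.
  move=> oz; have oD u : off_column (vertical z.1 u) by [].
  have odeck w : off_column w -> off_column (deck n w).
    move=> ow [m mE]; apply: ow; exists (m - n); rewrite intrB.
    by move: mE; rewrite /deck /= => mE; lra.
  have aD : is_angle off_column (fun w => tb (deck n w)).
    move=> w ow; have [cw ew] := tbP _ (off_column_below (odeck _ ow)).
    split; last by rewrite -(c_deck n).
    by apply: (@continuous_at_comp S S digital_line (deck n) tb); [exact: deck_continuous|].
  have aD' : is_angle off_column tb by move=> w /off_column_below; exact: tbP.
  rewrite -(verticalK z).
  apply: (@angle_path_unique off_column _ _ (vertical z.1) 0 _ off_column_open aD aD') => //.
    exact: vertical_continuous.
  by rewrite vertical0 /deck /= !tbot.
(* Halfway between two columns of marked points; the top of this vertical gives the reference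
   value. *)
pose xm := x0 + 1 / 2.
pose k0 := tb (xm, unit1 R).
have ttop x : off_column (x, unit1 R) -> tb (x, unit1 R) = k0.
  (* A deck transformation brings [x] between [x0] and [x0 + 1]. This interval contains [xm], and on
     its top side the class is constantly 1, so the angle is constant. *)
  move=> ox; pose n := Num.floor (x - x0).
  have /andP[f1 f2] := floor_itv (x - x0); rewrite -/n intrD mulr1z in f1 f2.
  pose x' := x - n%:~R.
  have xE : (x, unit1 R) = deck n (x', unit1 R) by rewrite /deck /= subrK.
  have ox' : off_column (x', unit1 R).
    move=> [m mE]; apply: ox; exists (m + n); rewrite intrD.
    by move: mE; rewrite /= /x' => mE; lra.
  rewrite xE tbdeck //.
  have x'0 : x0 < x'.
    rewrite lt_neqAle; apply/andP; split; last by rewrite /x'; lra.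
    by apply/eqP => E; apply: ox'; exists 0; rewrite addr0.
  have x'1 : x' < x0 + 1 by rewrite /x'; lra.
  apply: (@digital_segment_unique R (fun u => tb (u, unit1 R)) (fun=> k0) xm) => // t.
  have [xm0 xm1] : x0 < xm /\ xm < x0 + 1 by rewrite /xm; split; lra.
  move=> /andP[]; rewrite ge_min le_max => t1 t2.
  have tx0 : x0 < t by case/orP: t1; lra.
  have tx1 : t < x0 + 1 by case/orP: t2; lra.
  have ot u : x0 < u -> u < x0 + 1 -> off_column (u, unit1 R).
    move=> u0 u1 [m /= mE]; move: u0 u1; rewrite mE ltrDl ltrD2l.
    by rewrite -[0]/(0%:~R) -[1]/(1%:~R) !ltr_int; lia.
  split.
  - apply: (@continuous_at_comp R S digital_line (fun u => (u, unit1 R)) tb);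
      first exact: continuous_at_pairl.
    by case: (tbP _ (off_column_below (ot t tx0 tx1))).
  - exact: (@continuous_at_cst R digital_line).
  near=> u; have [u0 u1] : x0 < u /\ u < x0 + 1.
    by split; near: u; [exact: lt_nbhsr|exact: lt_nbhsl].
  have [_ e1] := tbP _ (off_column_below (ot u u0 u1)).
  have [_ e2] := tbP _ (off_column_below (ot xm xm0 xm1)).
  by rewrite c_top in e1; rewrite c_top in e2; exact: eqmod4_trans (eqmod4_sym e1) e2.
have k01 : eqmod4 1 k0.
  have /off_column_below ox : off_column (xm, unit1 R).
    move=> [m /= mE]; have E : 1 / 2 = m%:~R :> R by move: mE; rewrite /xm; lra.
    have [h0 h1] : 0 < m%:~R :> R /\ m%:~R < 1 :> R by rewrite -E; split; lra.
    by move: h0 h1; rewrite -[0]/(0%:~R) -[1]/(1%:~R) !ltr_int; lia.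
  by have [_] := tbP _ ox; rewrite c_top.
(* The counterpart of [lower] for the top line. *)
pose raise (p : S * R) : S := (p.1.1, uclamp (1 - clamp p.2 * (1 - ucoord p.1.2))).
have raise_continuous : continuous raise.
  move=> p; have h1 : {for p, continuous (fun q : S * R => q.2)} by exact: cvg_snd.
  have h2 : {for p, continuous (fun q : S * R => q.1)} by exact: cvg_fst.
  apply: (@continuous_at_pair (S * R)%type R U (fun p => p.1.1)
    (fun p => uclamp (1 - clamp p.2 * (1 - ucoord p.1.2)))).
    exact: (continuous_at_fst h2).
  apply: continuous_at_uclamp; apply: continuous_at_sub; first exact: cvg_cst.
  apply: continuous_at_mul; first exact: continuous_at_clamp.
  apply: continuous_at_sub; first exact: cvg_cst.
  by apply: continuous_at_ucoord; exact: (continuous_at_snd h2).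
have raise0 z t : t <= 0 -> raise (z, t) = (z.1, unit1 R).
  by move=> t0; rewrite /raise /= clamp_le0 // mul0r subr0 uclamp1.
have [tt ttP tt1] : exists2 tt, is_angle above_marked tt &
    forall z, above_marked z -> (forall t, raise (z, t) = z) -> tt z = k0.
  apply: angle_by_retraction.
  - exact: above_marked_open.
  - exact: raise_continuous.
  - by move=> z t t0; rewrite !raise0.
  - move=> z t t1; rewrite /raise /= clamp_ge1 // mul1r opprB addrCA subrr addr0 ucoordK.
    by rewrite -surjective_pairing.
  - move=> z t az [xz]; rewrite /raise /= ucoord_uclamp => yz; apply: az; split => //.
    have /andP[c0 c1] := clamp01 t; have /andP[u0 u1] := ucoord01 z.2.
    move: yz; move: (clamp t) (ucoord z.2) c0 c1 u0 u1 => d u c0 c1 u0 u1 <-.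
    have h0 : 0 <= d * (1 - u) by rewrite mulr_ge0 // subr_ge0.
    have h1 : d * (1 - u) <= 1 - u by rewrite ler_piMl // subr_ge0.
    by move: (d * _) h0 h1 => e h0 h1; rewrite clamp_id; [|apply/andP; split]; lra.
  - by move=> z; rewrite raise0 // c_top.
have agree z : off_column z -> tb z = tt z.
  move=> oz; rewrite -(verticalK z).
  have ab : is_angle off_column tb by move=> w /off_column_below; exact: tbP.
  have at' : is_angle off_column tt by move=> w /off_column_above; exact: ttP.
  apply: (@angle_path_unique off_column tb tt (vertical z.1) 1 _ off_column_open ab at') => //.
    exact: vertical_continuous.
  rewrite vertical1 ttop // tt1 //; first exact: off_column_above.
  by move=> t; rewrite /raise /= subrr mulr0 subr0 uclamp1.
exists (fun z => if `[<below_marked z>] then tb z else tt z); split; last first.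
  by move=> x; rewrite asboolT.
move=> z nz; have [bz|nbz] := pselect (below_marked z).
  rewrite asboolT //; have [cz ez] := tbP z bz; split => //.
  apply: near_eq_continuous_at cz; have := open_nbhs_nbhs (conj below_marked_open bz).
  by apply: filterS => w bw; rewrite asboolT.
have az : above_marked z by case: (below_or_above nz).
rewrite asboolF //; have [cz ez] := ttP z az; split => //.
apply: near_eq_continuous_at cz; have := open_nbhs_nbhs (conj above_marked_open az).
apply: filterS => w aw; case: asboolP => // bw.
by rewrite agree //; exact: below_above.
Unshelve. all: by end_near. Qed.

End AngleAlongMap.

(** * Wandering sets, and maps with at most one orbit of fixed points *)

Lemma iter_inj (T : Type) (f : T -> T) n : injective f -> injective (iter n f).
Proof. by move=> fi; elim: n => [x y //|n IH x y /= /fi/IH]. Qed.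

(** By injectivity, iterates can be cancelled in a common point of two images of [O], which leaves a
    point of [O] that a positive iterate sends back to [O]. *)
Lemma wandering_trivIset (R : realType) (f : annulus R -> annulus R)
    (O : set (annulus R)) : injective f ->
  (forall n x y, O x -> O y -> x <> iter n.+1 f y) ->
  trivIset setT (fun k : int => iterz_image f k O).
Proof.
move=> fi wander i j _ _ [x [xi xj]].
have key m n y z : O y -> O z -> iter m f y = iter n f z -> m = n.
  move=> Oy Oz E; have [lt|lt|//] := ltngtP m n.
    case: (@wander (n - m).-1 y z) => //; apply: (iter_inj (n := m) fi).
    by rewrite E -iterD prednK ?subn_gt0 // subnKC // ltnW.
  case: (@wander (m - n).-1 z y) => //; apply: (iter_inj (n := n) fi).
  by rewrite -E -iterD prednK ?subn_gt0 // subnKC // ltnW.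
case: i xi => m; case: j xj => n /=.
- by move=> [z Oz zx] [y Oy yx]; congr Posz; apply: (key _ _ y z) => //; rewrite yx zx.
- move=> On [y Oy yx]; case: (@wander (n + m)%N (iter n.+1 f x) y) => //.
  by rewrite -yx -iterD addSn.
- move=> [y Oy yx] Om; case: (@wander (m + n)%N (iter m.+1 f x) y) => //.
  by rewrite -yx -iterD addSn.
move=> On Om; congr Negz; apply/esym; apply: (key _ _ (iter m.+1 f x) (iter n.+1 f x)) => //.
by rewrite -!iterD !addnS addnC.
Qed.

Section SingleFixedOrbit.
Context (R : realType) (F : leaf_system R) (f : annulus R -> annulus R)
  (ft : strip R -> strip R) (x0 y0 : R).
Local Notation S := (strip R).
Local Notation A := (annulus R).
Local Notation U := (unit_itv R).
Hypotheses (radF : radial_foliation F) (incf : increasing F f)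
  (nwf : non_wandering f) (liftf : is_lift ft f)
  (twist0 : forall z : S, (@cov R @^-1` @C0 R) z -> z <> ft z /\ dtheta z (ft z) F = -1)
  (twist1 : forall z : S, (@cov R @^-1` @C1 R) z -> z <> ft z /\ dtheta z (ft z) F = 1)
  (y0_gt0 : 0 < y0)
  (fixP : forall z, ft z = z <-> marked x0 y0 z).

Let isof : isotopic_to_id f. Proof. by case: incf. Qed.
Let cft : continuous ft. Proof. by case: liftf. Qed.
Let ftf z : cov (ft z) = f (cov z). Proof. by case: liftf. Qed.

Let f_inj : injective f.
Proof. by have [g [_ _ K _]] := inverse_isotopic_exists isof; exact: can_inj K. Qed.

Let ft_deck n z : ft (deck n z) = deck n (ft z).
Proof. exact: isotopic_lift_deck isof cft ftf n z. Qed.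

Let ft_inj : injective ft.
Proof. exact: map_lift_inj f_inj ft_deck ftf. Qed.

Let ft_inverse : exists gt : S -> S, [/\ continuous gt, cancel ft gt & cancel gt ft].
Proof.
have [g [_ ig K Kg]] := inverse_isotopic_exists isof.
have [k ck kg] := map_lift (isotopic_continuous ig).
(* [ft \o k] lifts the identity, so it is a deck transformation, to be compensated. *)
have [||z|m mE] := @lifts_differ R id (ft \o k).
- by move=> z; exact: continuous_at_id.
- by move=> z; apply: (@continuous_at_comp S S S k ft); [exact: ck|exact: cft].
- by rewrite /= ftf kg Kg.
have gK : cancel (fun z => k (deck (- m) z)) ft.
  by move=> z; rewrite -[LHS]/((ft \o k) _) mE deckNK.
exists (fun z => k (deck (- m) z)); split => //; last first.
  by move=> z; apply: ft_inj; rewrite gK.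
move=> z; apply: (@continuous_at_comp S S S (deck (- m)) k); last exact: ck.
exact: deck_continuous.
Qed.

Let c (z : S) : int := angle F z (ft z).

Let angle_value z z' (k : int) : -1 <= k <= 2 -> dtheta z z' F = k%:~R -> angle F z z' = k.
Proof.
move=> kb; rewrite (dtheta_angle _ _ radF) => /eqmod4_Z4/eqmod4_sym.
exact: aclass_eqmod4.
Qed.

Let c_bottom x : c (x, unit0 R) = -1.
Proof. by apply: angle_value => //; rewrite mulrNz; case: (twist0 (z := (x, unit0 R))). Qed.

Let c_top x : c (x, unit1 R) = 1.
Proof. by apply: angle_value => //; case: (twist1 (z := (x, unit1 R))). Qed.

Let c_deck n z : c (deck n z) = c z.
Proof. by rewrite /c ft_deck /angle (angle_class_deck (some_coordP radF)). Qed.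

Let moved z : ~ marked x0 y0 z -> z <> ft z.
Proof. by move=> nz zE; apply/nz/fixP. Qed.

Let c_digital z : ~ marked x0 y0 z -> digital_at c z.
Proof.
move=> /moved zft; apply: (digital_at_angle radF (some_coordP radF) (f := id) (g := ft)).
- exact: continuous_at_id.
- exact: cft.
- exact: zft.
Qed.

Let ft_unmarked z : ~ marked x0 y0 z -> ~ marked x0 y0 (ft z).
Proof. by move=> nz /fixP/ft_inj/fixP. Qed.

Section Angle.
Context (th : S -> digital_line).
Hypothesis th_angle : is_angle c [set z | ~ marked x0 y0 z] th.
Hypothesis th_bottom : forall x, th (x, unit0 R) = -1.

Let th_deck n z : ~ marked x0 y0 z -> th (deck n z) = th z.
Proof.
move=> nz; apply/esym; move: z nz.
have deck_unmarked w : ~ marked x0 y0 w -> ~ marked x0 y0 (deck n w).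
  move=> nw /fixP; rewrite ft_deck => /(can_inj (deckK n))/fixP; exact: nw.
apply: (@angle_unique R c x0 y0 y0_gt0 th (fun z => th (deck n z)) th_angle) => [z nz|x].
  have [cd ed] := th_angle (deck_unmarked z nz); split; last by rewrite -(c_deck n).
  by apply: (@continuous_at_comp S S digital_line (deck n) th); [exact: deck_continuous|].
by rewrite /deck /= !th_bottom.
Qed.

(** [th \o ft] and the end value of the angle of the pair transported by the isotopy, started from
    [th], are both angles for [c \o ft]. They agree on the bottom line, hence everywhere, and the
    variation of the second is [tau]. *)
Let th_tau : forall z, ~ marked x0 y0 z ->
  (th (ft z) : int) = (th z : int) + tau z (ft z) F (push_inv f F).
Proof.
have [H iH Hf] := isotopic_isotopy isof.
have [G0 G0P] := isotopy_lift_exists iH.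
(* Time is truncated so that the pair is at rest after time 1. *)
pose G (p : S * R) := G0 (p.1, clamp p.2).
have cG : continuous G.
  have [cG0 _ _] := G0P; move=> p.
  apply: (@continuous_at_comp (S * R)%type (S * R)%type S (fun p => (p.1, clamp p.2)));
    last exact: cG0.
  by apply: continuous_at_pair; [exact: cvg_fst|apply: continuous_at_clamp; exact: cvg_snd].
have G_id z t : t <= 0 -> G (z, t) = z.
  by move=> t0; have [_ E _] := G0P; rewrite /G /= clamp_le0 // E.
have GP : isotopy_lift H G.
  split => // w t; have [_ _ E] := G0P; rewrite /G /= E; congr (H (_, _)).
  by apply: ucoord_inj; rewrite !ucoord_uclamp clamp_id ?clamp01.
have Ginj t : injective (fun z => G (z, t)) by exact: isotopy_lift_inj iH GP.
pose D := [set z : S | ~ marked x0 y0 z].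
have oD : open D by exact: unmarked_open.
pose pairing (p : set_type D * R) : S * S :=
  (G (set_val p.1, p.2), G (ft (set_val p.1), p.2)).
have cval (p : set_type D * R) :
    {for p, continuous (fun p : set_type D * R => set_val p.1)}.
  by apply: (@continuous_at_comp _ (set_type D) S fst (@set_val S D));
    [exact: cvg_fst|exact: initial_continuous].
have [||p|w||L [cL L0 Lc]] := @digital_lift_exists R (set_type D)
    (fun p => angle F (pairing p).1 (pairing p).2) (fun w => th (set_val w)).
- by move=> w t t0; rewrite /pairing /= !G_id.
- by move=> w t t1; rewrite /pairing /G /= !(clamp_ge1 t1) !(clamp_ge1 (lexx 1)).
- have cG' (k : set_type D * R -> S) : {for p, continuous k} ->
      {for p, continuous (fun p => G (k p, p.2))}.
    move=> ck; apply: (@continuous_at_comp _ (S * R)%type S (fun p => (k p, p.2)));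
      last exact: cG.
    by apply: continuous_at_pair => //; exact: cvg_snd.
  apply: (digital_at_angle radF (some_coordP radF)
    (f := fun p : set_type D * R => G (set_val p.1, p.2))
    (g := fun p : set_type D * R => G (ft (set_val p.1), p.2))).
  + exact: cG'.
  + by apply: cG'; apply: (continuous_at_comp (cval p)); exact: cft.
  + by move/Ginj; apply: moved; exact: (set_valP p.1).
- apply: (@continuous_at_comp (set_type D) S digital_line (@set_val S D) th).
    exact: initial_continuous.
  by case: (th_angle (set_valP w)).
- by move=> w; rewrite /pairing /= !G_id //; case: (th_angle (set_valP w)).
have ex z : exists m : digital_line, forall w : set_type D, set_val w = z -> L (w, 1) = m.
  have [Dz|nDz] := pselect (D z); last by exists 0 => w wz; case: nDz; rewrite -wz;
    exact: set_valP.
  exists (L (SigSub (mem_set Dz), 1)) => w wz; congr (L (_, _)); exact: val_inj.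
have [M MP] := choice ex.
have ML (w : set_type D) : M (set_val w) = L (w, 1) by rewrite (MP _ w erefl).
(* [ft] is the end of the lifted isotopy up to a deck transformation, which does not change
   angles. *)
have [m mE] : exists m, forall w, ft w = deck m (G (w, 1)).
  apply: lifts_differ; [exact: isotopy_lift_at GP|exact: cft|move=> w].
  by have [_ _ E] := GP; rewrite E ftf uclamp1 Hf.
have tauE (w : set_type D) :
    tau (set_val w) (ft (set_val w)) F (push_inv f F) = (L (w, 1) : int) - th (set_val w).
  have -> : f = (fun w => H (unit1 R, w)) by apply/funext => v; rewrite Hf.
  rewrite -(L0 w 0 (lexx 0)).
  apply: (tau_path radF iH GP (moved (set_valP w)) (M := fun t => L (w, t))).
    by move=> t; apply: slice_continuous; exact: cL.
  by move=> t; exact: (Lc (w, t)).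
suff main : forall z, ~ marked x0 y0 z -> th (ft z) = M z.
  move=> z nz; pose w : set_type D := SigSub (mem_set (nz : D z)).
  have zw : z = set_val w by [].
  by rewrite main // zw tauE ML addrC subrK.
apply: (@angle_unique R (c \o ft) x0 y0 y0_gt0 (th \o ft) M).
- move=> z nz; have [cd ed] := th_angle (ft_unmarked nz); split => //.
  by apply: (@continuous_at_comp S S digital_line ft th); [exact: cft|].
- move=> z nz; split.
    apply: (open_sub_continuous oD) nz.
    have -> : (fun w : set_type D => M (set_val w)) = (fun w => L (w, 1)) by apply/funext.
    move=> w; apply: (@continuous_at_comp _ (set_type D * R)%type digital_line (fun w => (w,
      1))); last exact: cL.
    exact: continuous_at_pairl.
  pose w : set_type D := SigSub (mem_set (nz : D z)); rewrite -[z]/(set_val w) ML.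
  have := Lc (w, 1); congr eqmod4; rewrite /pairing /= /c !mE /angle.
  by rewrite (angle_class_deck (some_coordP radF)).
have ft_bottom x : exists x', ft (x, unit0 R) = (x', unit0 R).
  exists (ft (x, unit0 R)).1; rewrite [LHS]surjective_pairing; congr (_, _).
  apply: ucoord_inj; rewrite ucoord0.
  have : @C0 R (f (cov (x, unit0 R))) by apply: isotopic_C0.
  by rewrite -ftf.
move=> x; have nx : ~ marked x0 y0 (x, unit0 R).
  by move=> [_ /=]; rewrite ucoord0 => y00; move: y0_gt0; rewrite -y00 ltxx.
have [x' x'E] := ft_bottom x; rewrite /= x'E th_bottom; apply/esym.
pose w : set_type D := SigSub (mem_set (nx : D (x, unit0 R)));
  rewrite -[(x, unit0 R)]/(set_val w) ML.
have G_bottom v t : exists v', G ((v, unit0 R), t) = (v', unit0 R).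
  exists (G ((v, unit0 R), t)).1; rewrite [LHS]surjective_pairing; congr (_, _).
  apply: ucoord_inj; rewrite ucoord0; have [_ _ E] := GP.
  have : @C0 R (H (uclamp t, cov (v, unit0 R))).
    by apply: (isotopic_C0 (isotopy_at (uclamp t) iH)).
  by rewrite -E.
(* Distinct points of the bottom line lie on distinct leaves, so the even classes do not occur. *)
have odd t (e : int) : e = 0 \/ e = 2 -> ~ eqmod4 e (L (w, t)).
  move=> e02 eL; have := Lc (w, t); rewrite /pairing /= x'E.
  have [v vE] := G_bottom x t; have [v' v'E] := G_bottom x' t.
  have vv' : v <> v'.
    move=> E; have := moved nx; rewrite x'E; apply; apply: (Ginj t) => /=.
    by rewrite vE v'E E.
  rewrite vE v'E /angle (angle_class_bottom radF (some_coordP radF) vv') => e1.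
  have := eqmod4_trans eL (eqmod4_sym e1).
  by case: ifP => _ [n]; case: e02 => ->; lia.
have cLw t : {for t, continuous (fun t => L (w, t))} by apply: slice_continuous; exact: cL.
have Lw0 : L (w, 0) = -1 by rewrite L0 // th_bottom.
(* The windows are those between -4 and 0 and between -2 and 2; -1 is the only integer inside
   both. *)
have h1 := @digital_avoid R (fun t => L (w, t)) 0 (-1) 0 1 ler01
  (fun t _ => cLw t) (fun t _ => odd t 0 (or_introl erefl)).
have h2 := @digital_avoid R (fun t => L (w, t)) 2 (-1) 0 1 ler01
  (fun t _ => cLw t) (fun t _ => odd t 2 (or_intror erefl)).
rewrite Lw0 in h1 h2; have {}h1 := h1 isT; have {}h2 := h2 isT.
have aux (y : int) : 4 * -1 + 0 < y < 4 * -1 + 0 + 4 -> 4 * -1 + 2 < y < 4 * -1 + 2 + 4 ->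
  y = -1 by lia.
exact: aux h1 h2.
Qed.

Let th_mono z : ~ marked x0 y0 z -> (th z : int) <= th (ft z).
Proof.
move=> nz; have [_ /(_ _ _ (moved nz)) [tau0 _]] := incf.
by rewrite th_tau // lerDl.
Qed.

(** If [tau] vanishes, the class of the pair is odd, so [th z] is odd and already at least
    [2 * k + 1]; otherwise [tau] adds at least 1. *)
Let th_step z k : ~ marked x0 y0 z -> 2 * k <= (th z : int) -> 2 * k + 1 <= (th (ft z) : int).
Proof.
move=> nz kz; have [_ /(_ _ _ (moved nz)) [tau0 tau1]] := incf.
have [_ cz] := th_angle nz; rewrite th_tau //.
move: tau0 tau1 cz kz; move: (tau _ _ _ _) (th z) => t y; rewrite /digital_line in y *.
move=> t0 t1 cz kz; have [tE|tne] := eqVneq t 0; last by lia.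
have [_ d] := t1 tE; have [m yE] : eqmod4 (c z) y by [].
have : c z = -1 \/ c z = 1.
  by case: d => d; [left|right]; apply: angle_value => //; rewrite ?mulrNz d.
by lia.
Qed.

(* Otherwise the points of angle at least [2 * k + 1] whose preimage has angle at most
   [2 * k - 1] project to a wandering open set. *)
Let no_angle_gap (gt : S -> S) : continuous gt -> cancel ft gt -> cancel gt ft ->
  forall k z, ~ marked x0 y0 z -> 2 * k + 1 <= (th z : int) -> 2 * k <= (th (gt z) : int).
Proof.
move=> cg fK gK k z nz kz; rewrite leNgt; apply/negP => gz.
have gt_unmarked w : ~ marked x0 y0 w -> ~ marked x0 y0 (gt w).
  by move=> nw /fixP; rewrite gK => wE; apply/nw/fixP; rewrite {1}wE gK.
have gt_deck n w : gt (deck n w) = deck n (gt w).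
  by apply: ft_inj; rewrite ft_deck !gK.
(* The negation of [2 * k <= th (gt w)] is written with the odd bound [2 * k - 1], which makes both
   inequalities open conditions. *)
pose W := [set w : S | [/\ ~ marked x0 y0 w, 2 * k + 1 <= (th w : int)
  & (th (gt w) : int) <= 2 * (k - 1) + 1]].
have oW : open W.
  rewrite openE => w [nw w1 w2].
  have h0 : \forall v \near w, ~ marked x0 y0 v.
    by apply: open_nbhs_nbhs; split => //; exact: unmarked_open.
  have [cw _] := th_angle nw; have h1 := near_ge_odd cw w1.
  have cgw : {for w, continuous (fun w => th (gt w))}.
    apply: (@continuous_at_comp S S digital_line gt th); first exact: cg.
    by case: (th_angle (gt_unmarked w nw)).
  have h2 := near_le_odd cgw w2.
  by apply: filterS3 h0 h1 h2 => v v0 v1 v2; split.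
have Wz : W z by split => //; move: gz; lia.
have iter_unmarked n w : ~ marked x0 y0 w -> ~ marked x0 y0 (iter n ft w).
  by move=> nw; elim: n => //= n IH; exact: ft_unmarked.
have iter_mono n w : ~ marked x0 y0 w -> (th w : int) <= th (iter n ft w).
  move=> nw; elim: n => //= n IH; apply: le_trans IH _.
  by apply: th_mono; exact: iter_unmarked.
have iter_cov n w : cov (iter n ft w) = iter n f (cov w).
  by elim: n => //= n IH; rewrite ftf IH.
suff : @cov R @` W = set0.
  by move=> E; suff : (set0 : set A) (cov z) by []; rewrite -E; exists z.
apply: nwf; first exact: cov_open_image.
apply: wandering_trivIset => // n _ _ [w [nw w1 w2] <-] [v [nv v1 v2] <-].
rewrite -iter_cov => /esym/cov_eqP [m wE].
(* Up to a deck transformation [w] is the image of [v] by [n.+1] iterates of [ft], so by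
   monotonicity its preimage has at least the angle of [v]. *)
have : th (gt w) = th (iter n ft v).
  by rewrite wE gt_deck iterS fK th_deck //; exact: iter_unmarked.
have := iter_mono n v nv; move: v1 w2.
move: (th v) (th (gt w)) (th (iter n ft v)) => p q r; rewrite /digital_line in p q r *.
by move=> h1 h2 h3 h4; move: h1 h2 h3; rewrite h4; lia.
Qed.

Lemma angle_contradiction : False.
Proof.
have [gt [cg fK gK]] := ft_inverse.
have gap := no_angle_gap cg fK gK.
pose xm := x0 + 1 / 2.
have nxm u : ~ marked x0 y0 (xm, u).
  move=> [[m /= mE] _]; have E : 1 / 2 = m%:~R :> R by move: mE; rewrite /xm; lra.
  have [h0 h1] : 0 < m%:~R :> R /\ m%:~R < 1 :> R by rewrite -E; split; lra.
  by move: h0 h1; rewrite -[0]/(0%:~R) -[1]/(1%:~R) !ltr_int; lia.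
have gt_unmarked w : ~ marked x0 y0 w -> ~ marked x0 y0 (gt w).
  by move=> nw /fixP; rewrite gK => wE; apply/nw/fixP; rewrite {1}wE gK.
have [_ top1] := th_angle (nxm (unit1 R)); rewrite c_top in top1.
have step k : (2 * k + 1 <= (th (xm, unit0 R) : int)) <-> (2 * k + 1 <= (th (xm, unit1 R) : int)).
  rewrite -vertical0 -vertical1.
  apply: (@segment_locally_constant R 0 1 (fun t => 2 * k + 1 <= (th (vertical xm t) :
    int)) ler01).
  move=> t _; have nt : ~ marked x0 y0 (vertical xm t) by exact: nxm.
  have [ct _] := th_angle nt.
  have cv : {for t, continuous (fun t => th (vertical xm t))}.
    by apply: (@continuous_at_comp R S digital_line (vertical xm) th);
      [exact: vertical_continuous|].
  have [kt|kt] := leP (2 * k + 1) (th (vertical xm t) : int).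
    by exists True; apply: filterS (near_ge_odd cv kt) => u ->.
  exists False.
  (* By [th_step], below the threshold the preimage has angle less than [2 * k], hence at most
     [2 * k - 1]. This is an open condition, and by [gap] it keeps the neighbours below the
     threshold. *)
  have gkt : (th (gt (vertical xm t)) : int) <= 2 * (k - 1) + 1.
    suff : (th (gt (vertical xm t)) : int) < 2 * k.
      by move: (th (gt _)) => y; rewrite /digital_line in y *; lia.
    rewrite ltNge; apply/negP => /(th_step (gt_unmarked _ nt)); rewrite gK.
    by rewrite leNgt kt.
  have cgv : {for t, continuous (fun t => th (gt (vertical xm t)))}.
    apply: (@continuous_at_comp R S digital_line (fun t => gt (vertical xm t)) th).
      by apply: (@continuous_at_comp R S S (vertical xm) gt);
        [exact: vertical_continuous|exact: cg].
    by case: (th_angle (gt_unmarked _ nt)).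
  apply: filterS (near_le_odd cgv gkt) => u ku _; split=> // ku'.
  have := gap k _ (nxm (uclamp u)) ku'; move: ku; rewrite /vertical.
  by move: (th (gt _)) => y; rewrite /digital_line in y *; lia.
rewrite th_bottom in step; move: step top1.
move: (th (xm, unit1 R)) => y; rewrite /digital_line in y *.
move=> step [n yE].
(* The bottom value -1 reaches the threshold -1 but not 1, and so does [y]; no integer congruent to
   1 modulo 4 lies in this range. *)
have y1 : -1 <= y by apply/(step (-1)).
have y0' : ~ 1 <= y by move/(step 0).
by move: y1 y0'; rewrite yE; lia.
Qed.

End Angle.

Lemma single_fixed_orbit_false : False.
Proof.
have [th [thA th0]] := angle_exists c_digital y0_gt0 c_deck c_bottom c_top.
exact: angle_contradiction thA th0.
Qed.

End SingleFixedOrbit.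

Theorem theorem5p1 (R : realType) (F : leaf_system R)
    (f : annulus R -> annulus R) (ft : strip R -> strip R)
    (radF : radial_foliation F) (incf : increasing F f)
    (nwf : non_wandering f) (liftf : is_lift ft f)
    (twist0 : forall z : strip R, (@cov R @^-1` @C0 R) z ->
       z <> ft z /\ dtheta z (ft z) F = -1)
    (twist1 : forall z : strip R, (@cov R @^-1` @C1 R) z ->
       z <> ft z /\ dtheta z (ft z) F = 1) :
  exists p q : annulus R,
    [/\ p <> q, (@cov R @` [set z | ft z = z]) p
      & (@cov R @` [set z | ft z = z]) q].
Proof.
apply: contrapT => no_two.
have one z z' : ft z = z -> ft z' = z' -> cov z = cov z'.
  move=> fz fz'; apply: contrapT => ne; apply: no_two.
  by exists (cov z), (cov z'); split=> //.
have [iof _] := incf; have [cft ftf] := liftf.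
have [[z0 fz0]|none] := pselect (exists z, ft z = z); last first.
  (* No point of the strip has height 2, so that no point is removed. *)
  apply: (@single_fixed_orbit_false R F f ft 0 2 radF incf nwf liftf twist0 twist1) => // z.
  split=> [fz|[_ z2]]; first by case: none; exists z.
  by have /andP[_] := ucoord01 z.2; rewrite z2 leNgt ltr1n.
have z0_gt0 : 0 < ucoord z0.2.
  rewrite lt_neqAle; have /andP[-> _] := ucoord01 z0.2; rewrite andbT.
  by apply/eqP => E; case: (twist0 z0 (esym E)) => + _; rewrite fz0.
apply: (single_fixed_orbit_false radF incf nwf liftf twist0 twist1 z0_gt0 (x0 := z0.1)) => z.
split=> [fz|[[n zn] z2]].
  by have /cov_eqP [n ->] := one _ _ fz0 fz; split => //; exists n.
have -> : z = deck n z0.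
  by rewrite /deck -zn -(ucoord_inj z2) -surjective_pairing.
by rewrite (isotopic_lift_deck iof cft ftf) fz0.
Qed.
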